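(* There exist two compact plane sets $K_1$ and $K_2$ such that each of $R(K_1)$ and $R(K_2)$ is strongly regular, but $R(K_1\cup K_2)$ is not strongly regular. Furthermore, $K_1$ and $K_2$ can be chosen in such a way that, in addition, $R(K_1\cup K_2)$ is normal and is strongly regular at every point of $K_1\cup K_2$ with one exception, at which $R(K_1\cup K_2)$ has a nondegenerate bounded point derivation of infinite order.
   Context: A compact plane set is a nonempty compact subset of $\mathbb{C}$. For a compact plane set $K$, $R(K)$ is the uniform closure on $K$ of the rational functions with poles off $K$; it is a uniform algebra on $K$ (a closed subalgebra of $C(K)$, sup norm, containing constants and separating points). For a uniform algebra $A$ on a compact Hausdorff space $X$ and $x\in X$: $M_x=\{f\in A:f(x)=0\}$, $J_x=\{f\in A: f^{-1}(0)\text{ contains a neighborhood of }x\text{ in }X\}$. $A$ is strongly regular at $x$ if $\overline{J_x}=M_x$, and strongly regular if it is strongly regular at every point of $X$. $A$ is natural if its maximal ideal space is $X$ (points identified with point evaluations); $A$ is normal on $X$ if for disjoint closed $L_0,L_1\subset X$ there is $f\in A$ with $f=1$ on $L_1$ and $f=0$ on $L_0$; $A$ is normal if it is natural and normal on $X$. A point derivation of infinite order on $A$ at a complex homomorphism $\phi$ is a sequence $(d^{(k)})_{k=0}^\infty$ of linear functionals on $A$ with $d^{(0)}=\phi$ and $d^{(k)}(fg)=\sum_{j=0}^k d^{(j)}(f)\,d^{(k-j)}(g)$ for all $f,g\in A$ and all $1\le k<\infty$. It is bounded if every $d^{(k)}$ is bounded, and nondegenerate if $d^{(1)}\neq0$.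 A point derivation at a point $a\in X$ is one at the evaluation functional $f\mapsto f(a)$. *)

(* Defs.v *)
From mathcomp Require Import all_boot all_order all_algebra.
From mathcomp Require Import all_classical all_reals all_analysis.
From mathcomp Require Export complex.

Set Implicit Arguments.
Unset Strict Implicit.
Unset Printing Implicit Defensive.

Import Order.TTheory GRing.Theory Num.Theory.
Import numFieldNormedType.Exports.

Local Open Scope classical_set_scope.
Local Open Scope ring_scope.

(* [R[i]] carries no topology of its own in the libraries; the regular module
   [R[i]^o] carries the one given by the modulus. *)
Notation Cplx R := (R[i]^o)%type (only parsing).

(* A space of complex functions is a set [A : set (X -> Cplx R)]. A functional
   on [A] is a total map [(X -> Cplx R) -> Cplx R] of which only the values on
   [A] matter. The definitions are meant for uniform algebras [A] on a compact
   Hausdorff space [X]. *)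
Section FunctionAlgebras.
Variables (R : realType) (X : topologicalType).
Implicit Types (A : set (X -> Cplx R)) (x : X).

(* For a subset [A] of C(X) with X compact, this is the closure of [A] in C(X)
   for the sup norm, since uniform limits of continuous functions are
   continuous. *)
Definition uniform_closure A : set (X -> Cplx R) :=
  @closure {uniform X -> Cplx R} A.

Definition supnorm (f : X -> Cplx R) : R :=
  sup (range (fun x => ComplexField.Normc.normc (f x))).

Definition vanishing_at A x : set (X -> Cplx R) := [set f | A f /\ f x = 0].

Definition vanishing_near A x : set (X -> Cplx R) :=
  [set f | A f /\ nbhs x (f @^-1` [set 0])].

Definition strongly_regular_at A x : Prop :=
  uniform_closure (vanishing_near A x) = vanishing_at A x.

Definition strongly_regular A : Prop := forall x, strongly_regular_at A x.

Definition linear_on A (d : (X -> Cplx R) -> Cplx R) : Prop :=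
  forall (a b : Cplx R) f g, A f -> A g ->
    d ((cst a \* f) \+ (cst b \* g)) = a * d f + b * d g.

Definition complex_homomorphism A (phi : (X -> Cplx R) -> Cplx R) : Prop :=
  [/\ linear_on A phi,
      forall f g, A f -> A g -> phi (f \* g) = phi f * phi g &
      phi (cst 1) = 1].

(* Existence says that every complex homomorphism is a point evaluation;
   uniqueness, applied to point evaluations, that distinct points give distinct
   homomorphisms. As X is compact and the maximal ideal space is Hausdorff, the
   continuous bijection so obtained is a homeomorphism. *)
Definition natural_algebra A : Prop :=
  forall phi, complex_homomorphism A phi ->
    exists! x, forall f, A f -> phi f = f x.

Definition normal_on A : Prop :=
  forall L0 L1 : set X, closed L0 -> closed L1 -> L0 `&` L1 = set0 ->
    exists f, [/\ A f, forall x, L1 x -> f x = 1 & forall x, L0 x -> f x = 0].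

Definition normal_algebra A : Prop := natural_algebra A /\ normal_on A.

Definition point_derivation A (phi : (X -> Cplx R) -> Cplx R)
    (d : nat -> (X -> Cplx R) -> Cplx R) : Prop :=
  [/\ complex_homomorphism A phi,
      forall f, A f -> d 0%N f = phi f,
      forall k, linear_on A (d k) &
      forall k, (1 <= k)%N -> forall f g, A f -> A g ->
        d k (f \* g) = \sum_(j < k.+1) d j f * d (k - j)%N g].

Definition point_derivation_at A x (d : nat -> (X -> Cplx R) -> Cplx R) :=
  point_derivation A (fun f => f x) d.

Definition bounded_on A (d : (X -> Cplx R) -> Cplx R) : Prop :=
  exists M : R, forall f, A f -> ComplexField.Normc.normc (d f) <= M * supnorm f.

Definition bounded_derivation A (d : nat -> (X -> Cplx R) -> Cplx R) : Prop :=
  forall k, bounded_on A (d k).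

Definition nondegenerate_derivation A (d : nat -> (X -> Cplx R) -> Cplx R) : Prop :=
  exists2 f, A f & d 1%N f != 0.

End FunctionAlgebras.

Section PlaneSets.
Variable R : realType.
Implicit Types K : set (Cplx R).

Definition compact_plane_set K : Prop := compact K /\ K !=set0.

(* Below, [K] used as a type is the subspace of the plane [set_type K]. *)
Definition rational_functions K : set (K -> Cplx R) :=
  [set f | exists p q : {poly R[i]},
     (forall z, K z -> ~~ root q z) /\
     (forall z : K, f z = p.[\val z] / q.[\val z])].

Arguments rational_functions K : clear implicits.

Definition RK K : set (K -> Cplx R) := uniform_closure (rational_functions K).

End PlaneSets.

Arguments rational_functions {R} K.
Arguments RK {R} K.

(* Main.v *)
Require Import Defs.
From mathcomp Require Import all_boot all_order all_algebra.
From mathcomp Require Import all_classical all_reals all_analysis.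
From mathcomp Require Import ring lra zify.

(* K is the square [-1,1]^2 minus open squares (a, rho) with
   sum rho / |a|^l finite for every l, so that Cauchy's formula bounds all Taylor
   coefficients at 0 of rational functions on K and yields a bounded point
   derivation of infinite order at 0. The squares are chosen so that for every
   x <> 0 in K the coordinate z - x lies in the closure I of J_x:
   - squares around 2^n-th roots of unity on circles decreasing to a limit circle
     (McKissick's construction) give functions of R(K) that vanish near x and are
     close to 1 away from x, with polynomial control of the norm; hence
     (z - x)^4 is in I, and R(K) is normal;
   - squares of half-side c s^2 on lattices of spacing s give rational functions
     w with w(x) = 0, w'(x) = 1 and sup |w| of order 1 / log(1/s), because
     sum_p s^2 / |z - p| is bounded while sum_p s^2 / |x - p|^2 diverges like
     log(1/s). So R(K) has no bounded point derivation at x, and (z - x)^(m+1) in I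
     implies (z - x)^m in I for m >= 1.
   Finally K is cut along annuli around 0: K1 (resp. K2) avoids the open annuli
   2^-(n+1) < |z| < 2^-n with n odd (resp. even). In each piece 0 has arbitrarily
   small relatively clopen neighbourhoods, whose characteristic functions are in
   R(K1) (resp. R(K2)). *)

Set Implicit Arguments.
Unset Strict Implicit.
Unset Printing Implicit Defensive.
Import Order.TTheory GRing.Theory Num.Theory numFieldNormedType.Exports.
Local Open Scope classical_set_scope.
Local Open Scope ring_scope.

(** * The modulus *)

Section Modulus.
Variable R : realType.
Implicit Types x y z : R[i].

(** Two demands compete: every [x <> 0] needs holes of all small scales around it, while the
    estimates at 0 tolerate few holes near 0. They are reconciled by letting level [i] work at scale
    [2^-i] but only at distance at least [1 / (i + 1)] from 0, with total half-side of order [2^-i]: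
    a power of [1 / |a|] then costs only a power of [i]. The exponent 4 comes from a count. Level
    [i] has of the order of [4^i] plateau functions, so each gets total half-side of order
    [2^(-3 i)] and has norm of order [2^(3 i)]. Where such a function is far from 1, [|z - x|] is of
    order [2^-i], and the fourth power wins. At 0 the algebra fails to be strongly regular because,
    by normality, a bounded derivation kills [J_0], hence its closure, while the one built here does
    not kill [M_0]. Cauchy's formula takes the form of sums over the edges of a fine grid. The holes
    are squares parallel to the axes because the grid cells that meet them are easy to count; the
    analytic estimates use only the inscribed discs. *)

Definition cmod z : R := ComplexField.Normc.normc z.

Lemma cmodE z : cmod z = Num.sqrt ((complex.Re z) ^+ 2 + (complex.Im z) ^+ 2).
Proof. by case: z. Qed.

Lemma cmod_ge0 z : 0 <= cmod z.
Proof. by rewrite cmodE sqrtr_ge0. Qed.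

Lemma cmod0 : cmod 0 = 0.
Proof. exact: ComplexField.Normc.normc0. Qed.

Lemma cmod1 : cmod 1 = 1.
Proof. exact: ComplexField.Normc.normc1. Qed.

Lemma cmodM x y : cmod (x * y) = cmod x * cmod y.
Proof. exact: ComplexField.Normc.normcM. Qed.

Lemma cmodV x : cmod x^-1 = (cmod x)^-1.
Proof. exact: ComplexField.Normc.normcV. Qed.

Lemma cmod_div x y : cmod (x / y) = cmod x / cmod y.
Proof. by rewrite cmodM cmodV. Qed.

Lemma cmodN x : cmod (- x) = cmod x.
Proof. exact: normcN. Qed.

Lemma cmodB x y : cmod (x - y) = cmod (y - x).
Proof. by rewrite -cmodN opprB. Qed.

Lemma cmodX x n : cmod (x ^+ n) = cmod x ^+ n.
Proof. by elim: n => [|n IH]; rewrite ?expr0 ?cmod1 // !exprS cmodM IH. Qed.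

Lemma cmod_eq0 x : (cmod x == 0) = (x == 0).
Proof.
apply/eqP/eqP => [|->]; last exact: cmod0.
exact: ComplexField.Normc.eq0_normc.
Qed.

Lemma cmod_gt0 x : (0 < cmod x) = (x != 0).
Proof. by rewrite lt_def cmod_eq0 cmod_ge0 andbT. Qed.

Lemma ler_cmodD x y : cmod (x + y) <= cmod x + cmod y.
Proof. exact: le_normcD. Qed.

Lemma ler_cmodB x y : cmod (x - y) <= cmod x + cmod y.
Proof. by rewrite -[cmod y]cmodN ler_cmodD. Qed.

Lemma ler_dist_cmod x y z : cmod (x - z) <= cmod (x - y) + cmod (y - z).
Proof. by rewrite -[x - z](subrKA y) ler_cmodD. Qed.

Lemma lerB_cmodD x y : cmod x - cmod y <= cmod (x + y).
Proof. by rewrite lerBlDr -{1}(addrK y x) -[cmod y]cmodN ler_cmodD. Qed.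

Lemma lerB_cmod x y : cmod x - cmod y <= cmod (x - y).
Proof. by rewrite -[cmod y]cmodN lerB_cmodD. Qed.

Lemma ler_cmod_sum (I : Type) (r : seq I) (P : pred I) (F : I -> R[i]) :
  cmod (\sum_(i <- r | P i) F i) <= \sum_(i <- r | P i) cmod (F i).
Proof.
elim/big_ind2: _ => [|x1 x2 y1 y2 h1 h2|//]; first by rewrite cmod0.
exact: le_trans (ler_cmodD _ _) (lerD h1 h2).
Qed.

Lemma cmod_real (a : R) : cmod a%:C%C = `|a|.
Proof. by rewrite cmodE /= expr0n addr0 sqrtr_sqr. Qed.

Lemma cmod_nat n : cmod n%:R = n%:R.
Proof. by rewrite -[n%:R](rmorph_nat (real_complex R)) cmod_real ger0_norm. Qed.

Lemma cmod_i : cmod 'i%C = 1.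
Proof. by rewrite cmodE /= expr0n add0r expr1n sqrtr1. Qed.

Lemma ler_Re_cmod z : `|complex.Re z| <= cmod z.
Proof. by rewrite cmodE -sqrtr_sqr ler_wsqrtr // lerDl sqr_ge0. Qed.

Lemma ler_Im_cmod z : `|complex.Im z| <= cmod z.
Proof. by rewrite cmodE -sqrtr_sqr ler_wsqrtr // lerDr sqr_ge0. Qed.

Lemma ler_cmod_ReIm z : cmod z <= `|complex.Re z| + `|complex.Im z|.
Proof.
rewrite cmodE -[leRHS]ger0_norm ?addr_ge0 // -sqrtr_sqr ler_wsqrtr //.
rewrite -[X in X ^+ 2 + _ <= _]/(complex.Re z) -(real_normK (num_real (complex.Re z))).
rewrite -(real_normK (num_real (complex.Im z))).
have := normr_ge0 (complex.Re z); have := normr_ge0 (complex.Im z); nra.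
Qed.

Lemma normC_cmod z : `|z| = (cmod z)%:C%C.
Proof. by []. Qed.

End Modulus.

(** * Removing discs around roots of unity *)

Section Gadget.
Variable R : realType.
Implicit Types x y z t : R[i].

Lemma expr_small (q d : R) : 0 <= q < 1 -> 0 < d ->
  exists m, forall n, (m <= n)%N -> q ^+ n <= d.
Proof.
move=> /andP[q0 q1] d0.
have [->|qn0] := eqVneq q 0.
  by exists 1%N => -[|n] // _; rewrite expr0n /= ltW.
have qp : 0 < q by rewrite lt_def qn0.
have bern n : 1 + n%:R * (q^-1 - 1) <= q^-1 ^+ n.
  elim: n => [|n IH]; first by rewrite mul0r addr0 expr0.
  rewrite exprS; have h : 0 < q^-1 - 1 by rewrite subr_gt0 invf_gt1.
  apply: (@le_trans _ _ (q^-1 * (1 + n%:R * (q^-1 - 1)))); last first.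
    by rewrite ler_wpM2l // invr_ge0.
  rewrite -natr1; have hn := ler0n R n.
  set u := q^-1 - 1 in h *; have -> : q^-1 = 1 + u by rewrite /u; ring.
  by nra.
have h : 0 < q^-1 - 1 by rewrite subr_gt0 invf_gt1.
set m := Num.Def.archi_bound (d^-1 / (q^-1 - 1)).
have hm : d^-1 / (q^-1 - 1) < m%:R by apply: archi_boundP; rewrite divr_ge0 ?invr_ge0 ?ltW.
exists m => n mn.
have hn : d^-1 <= q^-1 ^+ n.
  apply: le_trans (bern n).
  move: hm; rewrite ltr_pdivrMr // => hm.
  have : m%:R * (q^-1 - 1) <= n%:R * (q^-1 - 1) by rewrite ler_pM2r // ler_nat.
  lra.
by move: hn; rewrite exprVn lef_pV2 // posrE ?exprn_gt0.
Qed.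

(* The principal square root contracts the distance to 1 by nearly 2. *)
Lemma root_near_1 n t : cmod t <= 2^-1 ->
  exists y, y ^+ (2 ^ n) = 1 - t /\ (2 ^ n)%:R * cmod (1 - y) <= 2 * cmod t.
Proof.
move=> ht; have t0 := cmod_ge0 t.
(* With [x = |1 - y|] the invariant says that [2^n * x / (1 - x) <= |t| / (1 - |t|)], in product
   form: a principal square root at least halves [x / (1 - x)], because [|1 + v| >= 2 - |1 - v|]. *)
suff [y [h1 h2]] : exists y, y ^+ (2 ^ n) = 1 - t /\
    (2 ^ n)%:R * cmod (1 - y) * (1 - cmod t) <= cmod t * (1 - cmod (1 - y)).
  exists y; split => //.
  have y0 := cmod_ge0 (1 - y); have p0 : 0 <= (2 ^ n)%:R :> R by [].
  have : 0 <= (2 ^ n)%:R * cmod (1 - y) by rewrite mulr_ge0.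
  set u := _ * cmod (1 - y) in h2 *; nra.
elim: n => [|n [y [hy IH]]].
  by exists (1 - t); rewrite expr1 subKr mul1r mulrC.
have [v [v2 vRe]] : exists v : R[i], v ^+ 2 = y /\ 0 <= complex.Re v.
  have [h|h] := leP 0 (complex.Re (sqrtc y)).
    by exists (sqrtc y); rewrite sqr_sqrtc.
  exists (- sqrtc y); rewrite sqrrN sqr_sqrtc raddfN; split=> //.
  by move: h => /=; lra.
exists v; rewrite expnS exprM v2; split=> //.
have e : 1 - y = (1 - v) * (1 + v) by rewrite -v2; ring.
have e1 : cmod (1 - y) = cmod (1 - v) * cmod (1 + v) by rewrite e cmodM.
have h1 : 1 <= cmod (1 + v).
  apply: le_trans (ler_Re_cmod _); apply: le_trans (ler_norm _).
  by case: (v) vRe => a b /= ?; lra.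
have h2 : 2 - cmod (1 - v) <= cmod (1 + v).
  have := lerB_cmod 2 (1 - v); rewrite (_ : 2 - (1 - v) = 1 + v); last by ring.
  by rewrite cmod_nat.
move: IH h1 h2; rewrite natrM.
have := cmod_ge0 (1 - v); have := cmod_ge0 (1 - y).
move: e1; set x := cmod (1 - y); set x' := cmod (1 - v); set u := cmod (1 + v).
set P := (2 ^ n)%:R; set x0 := cmod t in ht t0 *.
have P1 : 0 <= P by rewrite /P.
move=> e1 hx hx' IH h1 h2.
have h3 : x' <= x by nra.
have h4 : 2 * x' <= x + x * x' by nra.
have [x00|xn0] := eqVneq x 0.
  have -> : x' = 0 by lra.
  by rewrite !mulr0 mul0r subr0 mulr1.
have xp : 0 < x by rewrite lt_def xn0.
rewrite -(ler_pM2l xp).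
apply: (@le_trans _ _ (2 * x' * (x0 * (1 - x)))).
  rewrite (_ : x * _ = 2 * x' * (P * x * (1 - x0))); last by ring.
  have h0 : 0 <= 2 * x' by rewrite mulr_ge0. have := ler_wpM2l h0 IH. move=> hh. exact: hh.
rewrite (_ : 2 * x' * _ = x0 * (2 * x' * (1 - x))); last by ring.
have h5 : 2 * x' * (1 - x) <= x * (1 - x') by nra.
have := ler_wpM2l t0 h5; move=> hh; rewrite [leRHS]mulrCA; exact: hh.
Qed.

Lemma unity_roots_seq N : (0 < N)%N -> exists2 rs : seq R[i], size rs = N &
  forall z, (z ^+ N == 1) = (z \in rs).
Proof.
move=> N0; have [rs hrs] := closed_field_poly_normal ('X^N - 1 : {poly R[i]}).
have hl : lead_coef ('X^N - 1 : {poly R[i]}) = 1 by rewrite lead_coefXnsubC.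
exists rs.
  apply/eqP; rewrite -eqSS -(size_prod_XsubC rs id) -(scale1r (\prod_(_ <- _) _)) -[X in X *: _]hl -hrs.
  by rewrite size_XnsubC.
move=> z; rewrite -root_prod_XsubC -(scale1r (\prod_(_ <- _) _)) -[X in X *: _]hl -hrs.
by rewrite rootE !hornerE subr_eq0.
Qed.

(** If [z^N] is close to 1, with [N = 2^n], it has an [N]-th root [y] close to 1; then [z / y] is a
    root of unity and lies at distance [|y - 1|] from [z]. *)
Lemma far_from_roots n (rs : seq R[i]) (e : R) z :
  (forall z, (z ^+ (2 ^ n) == 1) = (z \in rs)) ->
  e <= 1 -> {in rs, forall o, e <= (2 ^ n)%:R * cmod (z - o)} ->
  e / 2 <= cmod (1 - z ^+ (2 ^ n)).
Proof.
move=> hrs e1 he; have [|h] := lerP (cmod (1 - z ^+ (2 ^ n))) 2^-1; last first.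
  by apply: le_trans (ltW h); lra.
move=> /(root_near_1 n)[y []]; rewrite subKr => hy hle.
have [y0|yn0] := eqVneq y 0.
  have : z ^+ (2 ^ n) == 0 by rewrite -hy y0 expf_eq0 eqxx expn_gt0.
  by move=> /eqP ->; rewrite subr0 cmod1; lra.
have zn0 : z != 0.
  apply: contra_neq yn0 => z0.
  have : y ^+ (2 ^ n) == 0 by rewrite hy z0 expf_eq0 eqxx andbT expn_gt0.
  by rewrite expf_eq0 => /andP[_ /eqP].
have roots : forall o : R[i], o ^+ (2 ^ n) == 1 -> cmod o = 1.
  move=> o /eqP ho1; have := congr1 (@cmod R) ho1; rewrite cmodX cmod1 => ho.
  apply/eqP; rewrite -(@pexpr_eq1 _ _ (2 ^ n)) ?cmod_ge0 ?ho ?expn_gt0 //.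
have ho : (z / y) ^+ (2 ^ n) == 1 by rewrite expr_div_n hy divff // expf_neq0.
have := he (z / y); rewrite -hrs => /(_ ho).
have -> : z - z / y = (z / y) * (y - 1) by field.
rewrite cmodM (roots _ ho) mul1r cmodB; lra.
Qed.

(** Being outside the open discs is weaker than being outside the open squares with the same centres
    and half-sides, which are what is removed later. *)
Definition off (l : seq (R[i] * R)) z := {in l, forall s, s.2 <= cmod (z - s.1)}.

(* The factor is [w / (w - 1)] with [w = ((z - c) / r) ^+ (2 ^ n)]. *)
Lemma circle_factor (c : R[i]) (r s' s b d : R) : 0 <= s' < r -> r < s ->
  0 < b <= r -> 0 < d <= 1 -> exists (l : seq (R[i] * R)) (p q : {poly R[i]}),
  [/\ \sum_(k <- l) k.2 <= b,
      {in l, forall k, cmod (k.1 - c) = r /\ 0 < k.2 <= b} &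
      forall z, off l z -> [/\ q.[z] != 0, cmod (p.[z] / q.[z]) <= 3 * r / b,
        s <= cmod (z - c) -> cmod (p.[z] / q.[z] - 1) <= d &
        cmod (z - c) <= s' -> cmod (p.[z] / q.[z]) <= d]].
Proof.
move=> /andP[s0 s'r] rs /andP[b0 br] /andP[d0 d1].
have r0 : 0 < r by apply: le_lt_trans s'r.
have sp : 0 < s by apply: lt_trans rs.
have d20 : 0 < d / 2 by rewrite divr_gt0.
have qs' : 0 <= s' / r < 1 by rewrite divr_ge0 ?(ltW r0) //= ltr_pdivrMr // mul1r.
have qs : 0 <= r / s < 1.
  by rewrite divr_ge0 ?(ltW r0) ?(ltW sp) //= ltr_pdivrMr // mul1r.
have [m1 hm1] := expr_small qs' d20; have [m2 hm2] := expr_small qs d20.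
pose n := maxn m1 m2; pose N := (2 ^ n)%N.
have nN : (n <= N)%N by rewrite ltnW // ltn_expl.
have N0 : (0 < N)%N by rewrite expn_gt0.
have NR : 0 < N%:R :> R by rewrite ltr0n.
have {}hm1 : (s' / r) ^+ N <= d / 2 by apply: hm1; apply: leq_trans nN; rewrite leq_maxl.
have {}hm2 : (r / s) ^+ N <= d / 2 by apply: hm2; apply: leq_trans nN; rewrite leq_maxr.
have [rts szr hr] := unity_roots_seq N0.
have rC : r%:C%C != 0 by rewrite -cmod_gt0 cmod_real gtr0_norm.
exists [seq (c + r%:C%C * o, b / N%:R) | o <- rts].
pose W : {poly R[i]} := (('X - c%:P) * (r%:C%C^-1)%:P) ^+ N.
exists W, (W - 1); split.
- rewrite big_map /= big_const_seq count_predT szr iter_addr_0 -[leLHS]mulr_natr.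
  by rewrite divfK // gt_eqF.
- move=> _ /mapP[w ho ->] /=; rewrite addrC addKr cmodM cmod_real gtr0_norm //.
  rewrite divr_gt0 //= ler_pdivrMr //; split; last first.
    by rewrite ler_peMr ?(ltW b0) // -[1]/(1%:R) ler_nat.
  suff -> : cmod w = 1 by rewrite mulr1.
  move: ho; rewrite -hr => /eqP ho1; have := congr1 (@cmod R) ho1; rewrite cmodX cmod1 => ho.
  by apply/eqP; rewrite -(@pexpr_eq1 _ _ N) ?cmod_ge0 ?ho.
move=> z hz; pose u := (z - c) / r%:C%C.
have Wz : W.[z] = u ^+ N by rewrite /W horner_exp !hornerE.
have Qz : (W - 1).[z] = u ^+ N - 1 by rewrite hornerD Wz hornerN hornerC.
(* The discs have radius [b / N], so after rescaling by [r] the point [u] is at distance at least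
   [b / (r N)] from every root of unity; this yields a bound on the factor independent of [N]. *)
have far : b / r / 2 <= cmod (1 - u ^+ N).
  apply: (@far_from_roots n rts) => //; first by rewrite ler_pdivrMr // mul1r.
  move=> o ho; have := hz (c + r%:C%C * o, b / N%:R).
  rewrite (map_f (fun o => (c + r%:C%C * o, b / N%:R))) //= => /(_ isT).
  have -> : z - (c + r%:C%C * o) = r%:C%C * (u - o) by rewrite /u; field.
  rewrite cmodM cmod_real gtr0_norm // ler_pdivrMr // => hb.
  by rewrite ler_pdivrMr //; apply: le_trans hb _; rewrite [leLHS]mulrC mulrA [leRHS]mulrAC.
have far0 : 0 < b / r / 2 by rewrite !divr_gt0.
have cu : cmod u = cmod (z - c) / r by rewrite cmod_div cmod_real gtr0_norm.
rewrite Wz Qz; rewrite cmodB in far.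
have un1 : u ^+ N - 1 != 0 by rewrite -cmod_gt0 (lt_le_trans far0 far).
have key : cmod ((u ^+ N) / (u ^+ N - 1) - 1) = (cmod (u ^+ N - 1))^-1.
  by rewrite -cmodV; congr cmod; field.
split=> //.
- rewrite -[_ / _](subrK 1); apply: le_trans (ler_cmodD _ _) _.
  rewrite key cmod1; apply: (@le_trans _ _ ((b / r / 2)^-1 + 1)).
    by rewrite lerD2r lef_pV2 // posrE // (lt_le_trans far0 far).
  have -> : (b / r / 2)^-1 = 2 * (r / b).
    by field; rewrite !gt_eqF.
  have : 1 <= r / b by rewrite ler_pdivlMr // mul1r.
  by rewrite -mulrA; lra.
- move=> sz; rewrite key -[leRHS]invrK lef_pV2 ?posrE ?invr_gt0 //; last first.
    exact: lt_le_trans far0 far.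
  have h : 2 / d <= cmod u ^+ N.
    have : (r / s) ^+ N * cmod u ^+ N >= 1.
      rewrite -exprMn exprn_ege1 // cu mulf_div [s * r]mulrC.
      by rewrite ler_pdivlMr ?mulr_gt0 // mul1r ler_pM2l.
    move=> h1; rewrite ler_pdivrMr //.
    have := exprn_ge0 N (cmod_ge0 u).
    by nra.
  apply: le_trans (lerB_cmod _ _); rewrite cmod1 cmodX.
  apply: le_trans (lerB h (lexx _)).
  have : 1 <= d^-1 by rewrite invf_ge1.
  by rewrite mulrC; lra.
- move=> zs; rewrite cmod_div.
  have h : cmod (u ^+ N) <= d / 2.
    rewrite cmodX; apply: le_trans hm1; rewrite lerXn2r ?nnegrE ?cmod_ge0 //.
      by rewrite divr_ge0 // ltW.
    by rewrite cu ler_pM2r ?invr_gt0.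
  have h2 : 2^-1 <= cmod (u ^+ N - 1).
    have := lerB_cmod 1 (u ^+ N); rewrite cmodB cmod1; lra.
  rewrite ler_pdivrMr ?(lt_le_trans _ h2) ?invr_gt0 //.
  by nra.
Qed.

End Gadget.

(** * Plateau functions as infinite products of circle factors *)

Section Plateau.
Variable R : realType.
Implicit Types z c : R[i].

Local Notation h n := ((2^-1 : R) ^+ n).

Lemma half_pow_gt0 n : 0 < h n.
Proof. by rewrite exprn_gt0 // invr_gt0. Qed.

Lemma half_pow_le1 n : h n <= 1.
Proof. by rewrite exprn_ile1 ?invr_ge0 ?invf_le1 ?ler1n. Qed.

Lemma half_powS n : h n.+1 = h n / 2.
Proof. by rewrite exprSr. Qed.

Lemma half_pow_small (d : R) : 0 < d -> exists m, forall n, (m <= n)%N -> h n <= d.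
Proof. by apply: expr_small; rewrite invr_ge0 ?invf_lt1 ?ltr1n // ler0n. Qed.

(** The intervals of half-length [2 * C * h n] around [u n] are nested, and the limit is their
    common point. *)
Lemma geometric_limit (C : R) (u : nat -> R) :
  (forall n, `|u n.+1 - u n| <= C * h n) ->
  exists l, forall n, `|l - u n| <= 2 * C * h n.
Proof.
move=> hu.
have C0 : 0 <= C by have := hu 0%N; rewrite mulr1; apply: le_trans.
pose a n := u n - 2 * C * h n; pose b n := u n + 2 * C * h n.
have step n : a n <= a n.+1 /\ b n.+1 <= b n.
  have := hu n; rewrite ler_norml /a /b half_powS.
  by have := half_pow_gt0 n; nra.
have mon n k : a n <= a (n + k)%N /\ b (n + k)%N <= b n.
  elim: k => [|k [h1 h2]]; first by rewrite addn0.
  by rewrite addnS; have [h3 h4] := step (n + k)%N; split; lra.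
have ab n : a n <= b n.
  by rewrite /a /b; have := mulr_ge0 C0 (ltW (half_pow_gt0 n)); lra.
have cross n m : a n <= b m.
  have [h1 _] := mon n m; have [_ h2] := mon m n; rewrite addnC in h2.
  exact: le_trans h1 (le_trans (ab _) h2).
pose E : set R := fun x => exists n, x = a n.
exists (sup E) => n.
have hs : has_sup E.
  split; first by exists (a 0%N), 0%N.
  by exists (b 0%N) => _ [m ->].
have h1 : a n <= sup E by apply: ub_le_sup; [exact: hs.2|exists n].
have h2 : sup E <= b n by apply: ge_sup; [exact: hs.1|move=> _ [m ->]].
by rewrite ler_norml; move: h1 h2; rewrite /a /b; lra.
Qed.

Lemma geometric_climit (C : R) (u : nat -> R[i]) :
  (forall n, cmod (u n.+1 - u n) <= C * h n) ->
  exists l, forall n, cmod (l - u n) <= 4 * C * h n.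
Proof.
move=> hu.
have [n|a ha] := @geometric_limit C (fun n => complex.Re (u n)).
  by apply: le_trans (hu n); rewrite -raddfB ler_Re_cmod.
have [n|b hb] := @geometric_limit C (fun n => complex.Im (u n)).
  by apply: le_trans (hu n); rewrite -raddfB ler_Im_cmod.
exists (Complex a b) => n; apply: le_trans (ler_cmod_ReIm _) _.
by rewrite !raddfB /=; have := ha n; have := hb n; lra.
Qed.

(* The bound on [v] does not depend on [e]. *)
Lemma plateau (c : R[i]) (r b e : R) : 0 < b <= r / 2 -> 0 < e <= 1 ->
  exists (L : nat -> seq (R[i] * R)) (p q : nat -> {poly R[i]}) (v : R[i] -> R[i]),
  [/\ forall n, \sum_(k <- L n) k.2 <= b * h n.+1,
      forall n, {in L n, forall k, r / 2 <= cmod (k.1 - c) <= r /\ 0 < k.2 <= b} &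
      forall z, (forall n, off (L n) z) ->
        [/\ forall n, (q n).[z] != 0 /\ cmod (v z - (p n).[z] / (q n).[z]) <= h n,
            cmod (v z) <= 8 * r / b,
            r <= cmod (z - c) -> cmod (v z - 1) <= e &
            cmod (z - c) <= r / 2 -> v z = 0]].
Proof.
move=> /andP[b0 br] /andP[e0 e1].
have r0 : 0 < r by lra.
(* The factor [n] lives on a circle between the radii [s n.+1] and [s n], which decrease to [r / 2],
   and has norm at most [B n]. All partial products will stay below [M]. The tolerance [d n] is set
   against the norm of the next factor, so that [M * d n * (B n.+1 + 2) = e * h n / 4]. *)
pose s n := r / 2 * (1 + h n).
pose B n := 3 * r / (b * h n.+1).
pose M := B 0%N + 1.
pose d n := e / (M * (4 * (B n.+1 + 2))) * h n.
have B0 n : 0 < B n by rewrite /B divr_gt0 ?mulr_gt0 ?half_pow_gt0.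
have M1 : 1 <= M by rewrite /M; have := B0 0%N; lra.
have M0 : 0 < M by lra.
have hM : M <= 7 * r / b.
  have h1 : 1 <= r / b by rewrite ler_pdivlMr // mul1r; lra.
  have e2 : B 0%N = 6 * (r / b) by rewrite /B expr1; field; rewrite gt_eqF.
  by rewrite /M e2 -mulrA; lra.
have d0 n : 0 < d n.
  rewrite /d mulr_gt0 ?half_pow_gt0 ?divr_gt0 ?mulr_gt0 //.
  by have := B0 n.+1; lra.
have dB n : M * d n * (B n.+1 + 2) = e * h n / 4.
  rewrite /d; field; have := B0 n.+1 => ?; apply/andP; split; apply: lt0r_neq0; lra.
have dM n : M * d n <= e * h n / 8.
  have h1 : 2 * (M * d n) <= M * d n * (B n.+1 + 2).
    by rewrite mulrC ler_pM2l ?(mulr_gt0 M0 (d0 n)) //; have := B0 n.+1; lra.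
  by rewrite dB in h1; lra.
have d1 n : d n <= 1.
  have h1 : d n <= M * d n by rewrite ler_peMl // ltW.
  have h2 : e * h n <= 1 by rewrite mulr_ile1 ?half_pow_le1 // ltW ?half_pow_gt0.
  by have := dM n; lra.
have hs n : s n.+1 < s n.
  by rewrite /s half_powS; have := half_pow_gt0 n; nra.
have sr n : r / 2 < s n by rewrite /s; have := half_pow_gt0 n; nra.
have sr' n : s n <= r by rewrite /s; have := half_pow_le1 n; nra.
have H n : exists lpq : seq (R[i] * R) * {poly R[i]} * {poly R[i]},
    [/\ \sum_(k <- lpq.1.1) k.2 <= b * h n.+1,
        {in lpq.1.1, forall k, r / 2 <= cmod (k.1 - c) <= r /\ 0 < k.2 <= b} &
        forall z, off lpq.1.1 z -> [/\ lpq.2.[z] != 0,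
          cmod (lpq.1.2.[z] / lpq.2.[z]) <= B n,
          s n <= cmod (z - c) -> cmod (lpq.1.2.[z] / lpq.2.[z] - 1) <= d n &
          cmod (z - c) <= s n.+1 -> cmod (lpq.1.2.[z] / lpq.2.[z]) <= d n]].
  pose rn := (s n + s n.+1) / 2.
  have := hs n; have := sr n.+1; have := sr' n => h1 h2 h3.
  have bn : 0 < b * h n.+1 <= b.
    by rewrite mulr_gt0 ?half_pow_gt0 //= ler_piMr ?half_pow_le1 // ltW.
  have ha : 0 <= s n.+1 < rn by apply/andP; rewrite /rn; split; lra.
  have hb : rn < s n by rewrite /rn; lra.
  have hc : 0 < b * h n.+1 <= rn by move: bn => /andP[? ?]; apply/andP; rewrite /rn; split; lra.
  have hd : 0 < d n <= 1 by rewrite d0 d1.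
  have [l [p [q [hl1 hl2 hl3]]]] := @circle_factor R c rn (s n.+1) (s n) (b * h n.+1) (d n) ha hb hc hd.
  exists (l, p, q); split=> //= [k /hl2[-> /andP[k1 k2]]|z /hl3[q0 hB h4 h5]].
    rewrite k1; split; first by apply/andP; rewrite /rn; split; lra.
    by move: bn => /andP[_]; apply: le_trans.
  split=> //; apply: le_trans hB _; rewrite /B ler_pM2r ?invr_gt0 ?mulr_gt0 ?half_pow_gt0 //.
  by rewrite ler_pM2l // /rn; lra.
have [G hG] := choice H.
pose F n z := (G n).1.2.[z] / (G n).2.[z].
pose P n z := \prod_(k < n) F k z.
have PS n z : P n.+1 z = P n z * F n z by rewrite /P big_ord_recr.
pose ok z := forall n, off (G n).1.1 z.
have Fd n z : ok z -> s n <= cmod (z - c) -> cmod (F n z - 1) <= d n.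
  by move=> /(_ n) hz; have [_ _ hGz] := hG n; have [_ _] := hGz z hz.
have Fd' n z : ok z -> cmod (z - c) <= s n.+1 -> cmod (F n z) <= d n.
  by move=> /(_ n) hz; have [_ _ hGz] := hG n; have [_ _] := hGz z hz.
have FB n z : ok z -> cmod (F n z) <= B n.
  by move=> /(_ n) hz; have [_ _ hGz] := hG n; have [_] := hGz z hz.
(* At each point one of two consecutive factors behaves well: outside radius [s n.+1] the factor
   [n.+1] is close to 1, and inside it the factor [n] is small enough to absorb the norm of the
   factor [n.+1]. *)
have key n z : ok z -> cmod (P n z) <= M -> cmod (P n.+1 z) <= M /\
   cmod (P n.+2 z - P n.+1 z) <= e / 4 * h n \/ M < cmod (P n.+1 z).
  move=> hz hP; have [hP1|] := lerP (cmod (P n.+1 z)) M; last by right.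
  left; split=> //; rewrite PS -[X in _ - X]mulr1 -mulrBr cmodM.
  have [hc|hc] := leP (s n.+1) (cmod (z - c)).
    apply: (@le_trans _ _ (M * d n.+1)).
      by apply: ler_pM; rewrite ?cmod_ge0 ?Fd.
    apply: le_trans (dM n.+1) _; rewrite half_powS; have := half_pow_gt0 n; nra.
  apply: (@le_trans _ _ (M * d n * (B n.+1 + 2))); last by rewrite dB; lra.
  apply: ler_pM; rewrite ?cmod_ge0 //.
    by rewrite PS cmodM; apply: ler_pM; rewrite ?cmod_ge0 ?Fd' // ltW.
  by apply: le_trans (ler_cmodB _ _) _; rewrite cmod1; have := FB n.+1 z hz; lra.
(* Only the first factor costs its full norm [B 0]; the later increments sum to at most 1, hence
   [M = B 0 + 1]. *)
have bnd n z : ok z -> cmod (P n z) <= M /\ cmod (P n.+1 z) <= B 0%N + (1 - h n).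
  move=> hz; elim: n => [|n [IH1 IH2]].
    have P0 : P 0%N z = 1 by rewrite /P big_ord0.
    rewrite PS P0 cmod1 mul1r expr0 subrr addr0.
    by split=> //; apply: FB.
  have IH3 : cmod (P n.+1 z) <= M by apply: le_trans IH2 _; rewrite /M; have := half_pow_gt0 n; lra.
  have [[_ hk]|] := key n z hz IH1; last by rewrite ltNge IH3.
  split=> //; rewrite -[P n.+2 z](subrK (P n.+1 z)); apply: le_trans (ler_cmodD _ _) _.
  rewrite half_powS; have := half_pow_gt0 n; have : e * h n <= h n by have := half_pow_gt0 n; nra.
  lra.
have hM' z n : ok z -> cmod (P n z) <= M by move=> /(bnd n)[].
have diff n z : ok z -> cmod (P n.+2 z - P n.+1 z) <= e / 4 * h n.
  by move=> hz; have [[]|] := key n z hz (hM' _ _ hz); rewrite // ltNge hM'.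
have vex z : exists l, ok z -> forall n, cmod (l - P n.+1 z) <= e * h n.
  have [hz|hz] := pselect (ok z); last by exists 0.
  have [l hl] := @geometric_climit (e / 4) (fun n => P n.+1 z) (fun n => diff n z hz).
  by exists l => _ n; have := hl n; have -> : 4 * (e / 4) = e by field.
have [v hv] := choice vex.
exists (fun n => (G n).1.1), (fun n => \prod_(k < n.+1) (G k).1.2),
  (fun n => \prod_(k < n.+1) (G k).2), v; split.
- by move=> n; have [] := hG n.
- by move=> n; have [] := hG n.
move=> z hz; have {}hv := hv z hz.
have lim0 x : (forall n, x <= 2 * h n) -> x <= 0.
  move=> hx; rewrite leNgt; apply/negP => x0.
  have [|m hm] := @half_pow_small (x / 4); first by rewrite divr_gt0.
  by have := hx m; have := hm m (leqnn m); lra.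
have eh n : e * h n <= h n by have := half_pow_gt0 n; nra.
split=> [n|||].
- split.
    rewrite horner_prod; apply/prodf_neq0 => k _.
    by have [_ _ hGz] := hG k; have [] := hGz z (hz k).
  rewrite !horner_prod -prodf_div; apply: le_trans (eh n); exact: hv.
- rewrite -[v z](subrK (P 1%N z)); apply: le_trans (ler_cmodD _ _) _.
  have := hv 0%N; have := hM' z 1%N hz; rewrite expr0.
  have : 1 <= r / b by rewrite ler_pdivlMr // mul1r; lra.
  by rewrite -mulrA; move: hM; rewrite -mulrA; lra.
- move=> rz; have far n : s n <= cmod (z - c) by apply: le_trans rz.
  suff hP n : cmod (P n z - 1) <= e * (1 - h n).
    rewrite -subr_le0; apply: lim0 => n.
    have := hP n.+1; have := hv n; have := ler_dist_cmod (v z) (P n.+1 z) 1.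
    rewrite half_powS; have := eh n; have := half_pow_gt0 n; nra.
  elim: n => [|n IH]; first by rewrite /P big_ord0 subrr cmod0 expr0 subrr mulr0.
  rewrite PS; have -> : P n z * F n z - 1 = P n z * (F n z - 1) + (P n z - 1) by ring.
  apply: le_trans (ler_cmodD _ _) _; rewrite cmodM.
  have : cmod (P n z) * cmod (F n z - 1) <= M * d n.
    by apply: ler_pM; rewrite ?cmod_ge0 ?hM' ?Fd.
  by have := dM n; rewrite half_powS; have := mulr_gt0 e0 (half_pow_gt0 n); nra.
- move=> zr; apply/eqP; rewrite -cmod_eq0 eq_le cmod_ge0 andbT; apply: lim0 => n.
  have := ler_cmodD (v z - P n.+1 z) (P n.+1 z); rewrite subrK => h1; apply: le_trans h1 _.
  have : cmod (P n.+1 z) <= M * d n.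
    rewrite PS cmodM; apply: ler_pM; rewrite ?cmod_ge0 ?hM' ?Fd' //.
    by apply: le_trans zr (ltW (sr _)).
  by have := hv n; have := dM n; have := eh n; have := half_pow_gt0 n; lra.
Qed.

End Plateau.

(** * Lattices of poles *)

Section Lattice.
Variable R : realType.
Implicit Types x z : R[i].

Lemma ler_sum_ord_widen (f : nat -> R) m n : (forall i, 0 <= f i) -> (m <= n)%N ->
  \sum_(i < m) f i <= \sum_(i < n) f i.
Proof.
move=> f0 /subnKC <-; elim: (n - m)%N => [|k IH]; first by rewrite addn0.
by rewrite addnS big_ord_recr /= ler_wpDr.
Qed.

(** In truncated subtraction [i - m + (m - i)] is the distance of [i] and [m], and every distance
    occurs at most twice. *)
Lemma ler_sum_dist (f : nat -> R) m n : (forall i, 0 <= f i) -> (m <= n)%N ->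
  \sum_(i < n) f (i - m + (m - i))%N <= 2 * \sum_(i < n.+1) f i.
Proof.
move=> f0 mn; have [q e] : exists q, n = (m + q)%N by exists (n - m)%N; rewrite subnKC.
rewrite {}e in mn *; rewrite big_split_ord /= mulr_natl mulr2n; apply: lerD.
  rewrite (reindex_inj rev_ord_inj) /=.
  apply: (@le_trans _ _ (\sum_(i < m) f i.+1)).
    by apply: ler_sum => i _; rewrite (_ : _ + _ = i.+1)%N //; have := ltn_ord i; lia.
  apply: (@le_trans _ _ (\sum_(i < m.+1) f i)).
    by rewrite [leRHS]big_ord_recl /= ler_wpDl.
  exact: ler_sum_ord_widen.
apply: (@le_trans _ _ (\sum_(i < q) f i)).
  by apply: ler_sum => i _; rewrite (_ : _ + _ = i)%N //; lia.
by apply: ler_sum_ord_widen => //; lia.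
Qed.

(** The index is the integer part of [a] clamped to [[0, n]]; up to an error 1, distances to [a]
    become distances of indices. *)
Lemma nearest_index n (a : R) : exists2 m, (m <= n)%N &
  forall i, (i < n)%N -> (i - m + (m - i))%:R - 1 <= `|a - i%:R|.
Proof.
have [a0|a0] := leP a 0.
  exists 0%N => // i _; rewrite subn0 sub0n addn0.
  by rewrite ler0_norm; have := ler0n R i; lra.
have [an|an] := leP n%:R a.
  exists n => // i ni; have -> : (i - n + (n - i) = n - i)%N by lia.
  have := ler_nat R i n; rewrite (ltnW ni) natrB ?(ltnW ni) // => h.
  by rewrite ger0_norm; lra.
have /andP[t1 t2] := truncn_itv (ltW a0); set m := Num.truncn a in t1 t2.
exists m => [|i ni].
  by rewrite -(ler_nat R); apply: le_trans t1 (ltW an).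
rewrite -natr1 in t2.
have [im|mi] := leqP m i.
  have -> : (i - m + (m - i) = i - m)%N by lia.
  rewrite natrB // -normrN opprB; apply: le_trans (ler_norm _); lra.
have -> : (i - m + (m - i) = m - i)%N by lia.
rewrite natrB ?(ltnW mi) //; apply: le_trans (ler_norm _); lra.
Qed.

Lemma harmonic_unbounded (M : R) : exists2 n, (0 < n)%N &
  M <= \sum_(i < n) (i.+1%:R)^-1.
Proof.
have H k : k%:R / 2 <= \sum_(i < 2 ^ k) (i.+1%:R)^-1 :> R.
  elim: k => [|k IH]; first by rewrite mul0r; apply: sumr_ge0 => i _; rewrite invr_ge0.
  rewrite expnS mul2n -addnn big_split_ord /= -natr1 mulrDl; apply: lerD => //.
  apply: (@le_trans _ _ (\sum_(i < 2 ^ k) ((2 ^ k + 2 ^ k)%:R)^-1)); last first.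
    apply: ler_sum => i _; rewrite lef_pV2 ?posrE ?ltr0n ?addn_gt0 ?expn_gt0 //.
    by rewrite ler_nat; have := ltn_ord i; lia.
  rewrite sumr_const card_ord -[leRHS]mulr_natr addnn -muln2 natrM invfM.
  by rewrite mulrAC mulVf // pnatr_eq0 expn_eq0.
exists (2 ^ Num.Def.archi_bound (`|M| * 2))%N; first by rewrite expn_gt0.
apply: le_trans (H _); rewrite ler_pdivlMr //.
apply: le_trans (ltW (archi_boundP _)); last by rewrite mulr_ge0.
by rewrite ler_pM2r // ler_norm.
Qed.

Variable P : nat.
Hypothesis P0 : (0 < P)%N.

(** The grid of pitch [1 / P] fills [[-2, 2]^2], so that a [P] by [P] block of its points starting
    near any point of [[-1, 1]^2] and leading away from the axes still fits. *)
Definition gridpt (a b : nat) : R[i] :=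
  Complex ((a%:R - (2 * P)%:R) / P%:R) ((b%:R - (2 * P)%:R) / P%:R).

Definition lattice (d c : R) : seq (R[i] * R) :=
  [seq k <- [seq (gridpt ab.1 ab.2, c / P%:R ^+ 2) | ab <- [seq (a, b) | a <- iota 0 (4 * P).+1, b <- iota 0 (4 * P).+1]]
    | d <= cmod k.1].

Lemma latticeP d c k : reflect
  (exists a b, [/\ (a <= 4 * P)%N, (b <= 4 * P)%N, d <= cmod (gridpt a b) &
     k = (gridpt a b, c / P%:R ^+ 2)]) (k \in lattice d c).
Proof.
rewrite mem_filter; apply: (iffP andP) => [[dk /mapP[ab hab e]]|].
  case/allpairsP: hab e => -[a b] [ha hb ->] e; rewrite e in dk *.
  by exists a, b; move: ha hb; rewrite !mem_iota !add0n !ltnS.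
move=> [a [b [ha hb hd ->]]]; split=> //; apply/mapP; exists (a, b) => //.
by apply/allpairsP; exists (a, b); rewrite !mem_iota !add0n !ltnS ha hb.
Qed.

Lemma lattice_radii d c : 0 <= c -> \sum_(k <- lattice d c) k.2 <= 25 * c.
Proof.
move=> c0; rewrite big_filter big_map.
apply: (@le_trans _ _ (\sum_(ab <- [seq (a, b) | a <- iota 0 (4 * P).+1, b <- iota 0 (4 * P).+1]) c / P%:R ^+ 2)).
  rewrite big_mkcond /=; apply: ler_sum => ab _; case: ifP => // _.
  by rewrite divr_ge0 // exprn_ge0.
rewrite big_const_seq count_predT iter_addr_0 size_allpairs !size_iota -[leLHS]mulr_natr.
have PR : 0 < P%:R :> R by rewrite ltr0n.
rewrite mulrAC ler_pdivrMr ?exprn_gt0 // [25 * c]mulrC -mulrA ler_wpM2l //.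
rewrite -natrX -natrM ler_nat; nia.
Qed.

(** The indices start just beyond [y] and move away from 0. Both coordinates then dominate those of
    the given point, so the whole block of grid points is at least as far from 0 as that point and
    survives the restriction in [lattice]. *)
Lemma coord_indices (y : R) : `|y| <= 1 -> exists (e : nat -> nat) (A sg : R),
  `|sg| = 1 /\ forall i, (i < P)%N -> [/\ (e i <= 4 * P)%N,
    ((e i)%:R - (2 * P)%:R) / P%:R = A + sg * (i%:R / P%:R),
    `|y| <= `|((e i)%:R - (2 * P)%:R) / P%:R| &
    `|y - ((e i)%:R - (2 * P)%:R) / P%:R| <= i.+1%:R / P%:R].
Proof.
have PR : 0 < P%:R :> R by rewrite ltr0n.
have Pn : P%:R != 0 :> R by rewrite gt_eqF.
wlog y0 : y / 0 <= y => [hw|].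
  have [|y0 y1] := leP 0 y; first exact: hw.
  have [||e [A [sg [s1 H]]]] := hw (- y); rewrite ?normrN //; first by lra.
  exists (fun i => (4 * P - e i)%N), (- A), (- sg); rewrite normrN; split=> // i /H[h1 h2 h3 h4].
  have e1 : ((4 * P - e i)%:R - (2 * P)%:R) / P%:R = - (((e i)%:R - (2 * P)%:R) / P%:R) :> R.
    by rewrite natrB // !natrM; field.
  rewrite e1 leq_subr; split=> //; first by rewrite h2; ring.
    by rewrite normrN -(normrN y).
  by rewrite opprK -normrN opprD.
rewrite (ger0_norm y0) => y1.
have yP : 0 <= y * P%:R by rewrite mulr_ge0.
have /andP[t1 t2] := truncn_itv yP; set m := Num.truncn _ in t1 t2.
have mP : (m <= P)%N.
  by rewrite -(ler_nat R); apply: le_trans t1 _; rewrite ler_piMl.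
exists (fun i => (2 * P + m.+1 + i)%N), (m.+1%:R / P%:R), 1; rewrite normr1; split=> // i iP.
have e1 : ((2 * P + m.+1 + i)%:R - (2 * P)%:R) / P%:R = (m.+1%:R + i%:R) / P%:R :> R.
  by rewrite !natrD; congr (_ / _); ring.
have yle : y <= (m.+1%:R + i%:R) / P%:R.
  by rewrite ler_pdivlMr //; have := ler0n R i; lra.
rewrite e1; split; first by lia.
- by rewrite mul1r mulrDl.
- by rewrite (ger0_norm (le_trans y0 yle)).
rewrite distrC ger0_norm ?subr_ge0 // lerBlDr -lerBlDl -(@ler_pM2r _ P%:R) // mulrBl !divfK //.
by rewrite -!natr1 in t2 *; lra.
Qed.

(** A discrete form of the local integrability of [1 / |z|] in the plane. Grid points within one
    index of the nearest one in both coordinates are at most 16 and contribute at most [1 / c] each,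
    by the separation hypothesis; the others contribute a bounded amount in all. *)
Lemma lattice_sum_bound (A1 A2 s1 s2 c : R) z (l : nat -> nat -> R[i]) :
  `|s1| = 1 -> `|s2| = 1 -> 0 < c ->
  (forall i j, (i < P)%N -> (j < P)%N ->
     l i j = Complex (A1 + s1 * (i%:R / P%:R)) (A2 + s2 * (j%:R / P%:R))) ->
  (forall i j, (i < P)%N -> (j < P)%N -> c / P%:R ^+ 2 <= cmod (z - l i j)) ->
  \sum_(i < P) \sum_(j < P) (P%:R ^+ 2)^-1 / cmod (z - l i j) <= 16 / c + 48.
Proof.
move=> hs1 hs2 c0 hl hz.
have PR : 0 < P%:R :> R by rewrite ltr0n.
have Pn : P%:R != 0 :> R by rewrite gt_eqF.
have coord (A sg y : R) : `|sg| = 1 -> exists2 m, (m <= P)%N & forall i, (i < P)%N ->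
    ((i - m + (m - i))%:R - 1) / P%:R <= `|y - (A + sg * (i%:R / P%:R))|.
  move=> hsg; have [m mP hm] := nearest_index P (sg * (y - A) * P%:R).
  exists m => // i /hm; rewrite ler_pdivrMr // => /le_trans; apply.
  have s2' : sg * sg = 1 by rewrite -expr2 -real_normK ?num_real // hsg expr1n.
  have -> : sg * (y - A) * P%:R - i%:R = sg * (y - (A + sg * (i%:R / P%:R))) * P%:R.
    by rewrite -[X in _ - X = _]mul1r -[X in _ - X * _ = _]s2'; field.
  by rewrite !normrM hsg mul1r (gtr0_norm PR).
have [m mP hm] := coord A1 s1 (complex.Re z) hs1.
have [n nP hn] := coord A2 s2 (complex.Im z) hs2.
(* [g] majorizes a term whose index distances are [k] and [k']; far terms are bounded by the larger
   distance, and for each value of it the terms add up to a constant multiple of [1 / P]. *)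
pose g (k k' : nat) : R := ((k < 2)%N && (k' < 2)%N)%:R / c +
  3 / P%:R * ((k <= k')%N%:R / k'.+1%:R + (k' <= k)%N%:R / k.+1%:R).
have g0 k k' : 0 <= g k k' by rewrite addr_ge0 ?mulr_ge0 ?addr_ge0 ?mulr_ge0 ?invr_ge0 // ltW.
have near i j : (i < P)%N -> (j < P)%N ->
    (P%:R ^+ 2)^-1 / cmod (z - l i j) <= g (i - m + (m - i))%N (j - n + (n - j))%N.
  move=> iP jP; have hij := hz i j iP jP.
  have cp : 0 < c / P%:R ^+ 2 by rewrite divr_gt0 // exprn_gt0.
  have zp := lt_le_trans cp hij.
  move: (hm i iP) (hn j jP); set k := (i - m + (m - i))%N; set k' := (j - n + (n - j))%N => h1 h2.
  have q0 (a b : bool) p q : 0 <= 3 / P%:R * (a%:R / p.+1%:R + b%:R / q.+1%:R) :> R.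
    by rewrite mulr_ge0 ?addr_ge0 ?mulr_ge0 ?invr_ge0.
  rewrite /g; case: (boolP ((k < 2)%N && (k' < 2)%N)) => [kk|].
    apply: ler_wpDr; first exact: q0.
    rewrite mul1r -[leLHS]invfM lef_pV2 ?posrE ?mulr_gt0 ?exprn_gt0 //.
    by move: hij; rewrite ler_pdivrMr ?exprn_gt0 // mulrC.
  rewrite negb_and -!leqNgt => kk; rewrite mul0r add0r.
  have far p : (2 <= p)%N -> (p%:R - 1) / P%:R <= cmod (z - l i j) ->
      (P%:R ^+ 2)^-1 / cmod (z - l i j) <= 3 / P%:R * (p.+1%:R)^-1.
    move=> p2 hp; rewrite ler_pdivrMr //.
    have pr : 2 <= p%:R :> R by rewrite ler_nat.
    have h3 : p.+1%:R / 3 <= p%:R - 1 :> R by rewrite -natr1; lra.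
    apply: (@le_trans _ _ (3 / P%:R * (p.+1%:R)^-1 * (p.+1%:R / 3 / P%:R))).
      have wn : p.+1%:R != 0 :> R by rewrite pnatr_eq0.
      move: (p.+1%:R) wn => w wn.
      by rewrite le_eqVlt; apply/orP; left; apply/eqP; field; rewrite wn Pn.
    apply: ler_wpM2l; first by rewrite !mulr_ge0 ?invr_ge0.
    by apply: le_trans hp; rewrite ler_pM2r ?invr_gt0.
  have hk : (k%:R - 1) / P%:R <= cmod (z - l i j).
    apply: le_trans h1 (le_trans _ (ler_Re_cmod _)).
    by rewrite hl //; case: (z).
  have hk' : (k'%:R - 1) / P%:R <= cmod (z - l i j).
    apply: le_trans h2 (le_trans _ (ler_Im_cmod _)).
    by rewrite hl //; case: (z).
  have [kk'|kk'] := leqP k k'.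
    apply: le_trans (far k' _ hk') _; first by case/orP: kk => //; move=> /leq_trans; apply.
    rewrite ler_wpM2l ?divr_ge0 // mul1r lerDl divr_ge0 //.
  apply: le_trans (far k _ hk) _; first by case/orP: kk => //; move=> /leq_trans; apply; exact: ltnW.
  rewrite ler_wpM2l ?divr_ge0 // (ltnW kk') mul1r lerDr divr_ge0 //.
apply: (@le_trans _ _ (\sum_(i < P) \sum_(j < P) g (i - m + (m - i))%N (j - n + (n - j))%N)).
  by apply: ler_sum => i _; apply: ler_sum => j _; apply: near.
apply: (@le_trans _ _ (\sum_(i < P) 2 * \sum_(k' < P.+1) g (i - m + (m - i))%N k')).
  by apply: ler_sum => i _; apply: (@ler_sum_dist (g _)).
apply: le_trans (@ler_sum_dist (fun k => 2 * \sum_(k' < P.+1) g k k') m P _ mP) _.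
  by move=> k; rewrite mulr_ge0 // sumr_ge0 // => k' _; apply: g0.
rewrite -mulr_sumr mulrA.
have row k (kP : (k < P.+1)%N) : \sum_(k' < P.+1) (k' <= k)%N%:R / k.+1%:R = 1 :> R.
  rewrite -mulr_suml -natr_sum -(big_mkord xpredT (fun k' => (k' <= k) : nat)).
  rewrite (@big_cat_nat _ _ _ k.+1) //= [X in (_ + X)%N]big1_seq; last first.
    by move=> q /andP[_]; rewrite mem_index_iota => /andP[]; rewrite ltnNge => + _; case: (q <= k)%N.
  rewrite addn0 (eq_big_nat _ _ (F2 := fun=> 1%N)); last by move=> q /andP[_]; rewrite ltnS => ->.
  by rewrite sum_nat_const_nat subn0 muln1 divff ?pnatr_eq0.
have -> : \sum_(k < P.+1) \sum_(k' < P.+1) g k k' =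
   (\sum_(k < P.+1) \sum_(k' < P.+1) ((k < 2)%N && (k' < 2)%N)%:R / c) + 3 / P%:R * (2 * P.+1%:R).
  rewrite (eq_bigr (fun k : 'I_P.+1 => \sum_(k' < P.+1) ((k < 2)%N && (k' < 2)%N)%:R / c +
     3 / P%:R * (\sum_(k' < P.+1) (k <= k')%N%:R / k'.+1%:R + 1))); last first.
    move=> k _; rewrite big_split /= -mulr_sumr; congr (_ + _ * _).
    by rewrite big_split /= row.
  rewrite big_split /= -mulr_sumr; congr (_ + _ * _).
  rewrite big_split /= exchange_big /= (eq_bigr (fun=> 1)); last by move=> k _; rewrite row.
  by rewrite sumr_const card_ord mulr_natl mulr2n.
have two : (\sum_(k < P.+1) (k < 2)%N <= 2)%N.
  have [q ->] : exists q, P = q.+1 by case: (P) P0 => // q _; exists q.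
  by rewrite !big_ord_recl /= big1 // => i _.
have -> : \sum_(k < P.+1) \sum_(k' < P.+1) ((k < 2)%N && (k' < 2)%N)%:R / c =
    ((\sum_(k < P.+1) (k < 2)%N) * \sum_(k < P.+1) (k < 2)%N)%:R / c.
  rewrite big_distrl /= natr_sum mulr_suml; apply: eq_bigr => k _.
  rewrite -mulr_suml -natr_sum big_distrr /=; congr (_%:R / _); apply: eq_bigr => k' _.
  by case: (k < 2)%N; case: (k' < 2)%N.
have h1 : ((\sum_(k < P.+1) (k < 2)%N) * \sum_(k < P.+1) (k < 2)%N)%:R / c <= 4 / c.
  by rewrite ler_pM2r ?invr_gt0 // ler_nat (leq_mul two two).
have h2 : 3 / P%:R * (2 * P.+1%:R) <= 12 :> R.
  rewrite mulrAC ler_pdivrMr // -natr1; have : 1 <= P%:R :> R by rewrite ler1n.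
  by lra.
rewrite -natrM; lra.
Qed.

(** The function is a convex combination of the functions [(x - l) (z - x) / (z - l)], each zero at
    [x] with derivative 1. Weights proportional to [1 / |x - l|^2] turn the estimate into two sums
    of type [1 / |z - l|], bounded by [16 / c + 48], over a total weight of at least [D / 2]; hence
    the factor 4 in the constants. *)
Lemma lattice_derivation (d c D : R) x : 0 < c -> 0 < d -> 0 < D ->
  D <= \sum_(i < P) (i.+1%:R)^-1 ->
  `|complex.Re x| <= 1 -> `|complex.Im x| <= 1 -> d <= cmod x ->
  off (lattice d c) x ->
  exists T : seq (R[i] * R[i]),
    {in T, forall k, exists r, (k.2, r) \in lattice d c} /\
    forall z, off (lattice d c) z ->
      cmod ((z - x) * (1 + (z - x) * \sum_(k <- T) k.1 / (z - k.2))) <=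
      (64 / c + 192) / D.
Proof.
move=> c0 d0 D0 hD x1 x2 dx offx.
have PR : 0 < P%:R :> R by rewrite ltr0n.
have Pn : P%:R != 0 :> R by rewrite gt_eqF.
have [e1 [A1 [s1 [hs1 H1]]]] := coord_indices x1.
have [e2 [A2 [s2 [hs2 H2]]]] := coord_indices x2.
pose l i j := gridpt (e1 i) (e2 j).
have hl i j : (i < P)%N -> (j < P)%N ->
    l i j = Complex (A1 + s1 * (i%:R / P%:R)) (A2 + s2 * (j%:R / P%:R)).
  by move=> /H1[_ h1 _ _] /H2[_ h2 _ _]; rewrite /l /gridpt h1 h2.
have lin i j : (i < P)%N -> (j < P)%N -> (l i j, c / P%:R ^+ 2) \in lattice d c.
  move=> /H1[h1 _ h2 _] /H2[h3 _ h4 _]; apply/latticeP; exists (e1 i), (e2 j); split=> //.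
  apply: le_trans dx _; rewrite !cmodE /= ler_sqrt ?addr_ge0 ?sqr_ge0 //.
  by apply: lerD; rewrite -[leLHS]real_normK ?num_real // -[leRHS]real_normK ?num_real // lerXn2r ?nnegrE.
have sep z i j : off (lattice d c) z -> (i < P)%N -> (j < P)%N ->
    c / P%:R ^+ 2 <= cmod (z - l i j).
  by move=> hz iP jP; apply: (hz (l i j, c / P%:R ^+ 2)); apply: lin.
have cP : 0 < c / P%:R ^+ 2 by rewrite divr_gt0 // exprn_gt0.
have gtz z i j hz iP jP : 0 < cmod (z - l i j) := lt_le_trans cP (@sep z i j hz iP jP).
have nz z i j : off (lattice d c) z -> (i < P)%N -> (j < P)%N -> z - l i j != 0.
  by move=> hz iP jP; rewrite -cmod_gt0; apply: gtz.
pose s : R := (P%:R ^+ 2)^-1.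
have s0 : 0 <= s by rewrite invr_ge0 exprn_ge0.
pose w (i j : nat) : R := s / cmod (x - l i j) ^+ 2.
have w0 i j : 0 <= w i j by rewrite divr_ge0 // exprn_ge0 // cmod_ge0.
pose W := \sum_(i < P) \sum_(j < P) w i j.
(* Only the triangle [j <= i] is used: there [|x - l i j|^2] is at most [2 * ((i + 1) / P)^2], so
   row [i] contributes at least [1 / (2 * (i + 1))]. *)
have hW : D / 2 <= W.
  apply: (@le_trans _ _ (\sum_(i < P) (i.+1%:R)^-1 / 2)).
    by rewrite -mulr_suml ler_pM2r ?invr_gt0.
  apply: ler_sum => i _.
  apply: (@le_trans _ _ (\sum_(j < P) ((j <= i)%N%:R * (2 * i.+1%:R ^+ 2)^-1))).
    rewrite -mulr_suml -natr_sum -(big_mkord xpredT (fun j => (j <= i)%N : nat)).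
    rewrite (@big_cat_nat _ _ _ i.+1) //= [X in (_ + X)%N]big1_seq; last first.
      by move=> q /andP[_]; rewrite mem_index_iota => /andP[]; rewrite ltnNge => + _; case: (q <= i)%N.
    rewrite addn0 (eq_big_nat _ _ (F2 := fun=> 1%N)); last by move=> q /andP[_]; rewrite ltnS => ->.
    rewrite sum_nat_const_nat subn0 muln1.
    have : i.+1%:R != 0 :> R by rewrite pnatr_eq0.
    move: (i.+1%:R) => u u0; rewrite le_eqVlt; apply/orP; left; apply/eqP.
    by field.
  apply: ler_sum => j _; case: (leqP j i) => [ji|_]; last by rewrite mul0r.
  have [iP jP] := (ltn_ord i, ltn_ord j); have g := gtz x i j offx iP jP.
  rewrite mul1r /w /s -invfM lef_pV2 ?posrE ?mulr_gt0 ?exprn_gt0 ?ltr0n //.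
  rewrite -exprMn cmodE exprMn sqr_sqrtr ?addr_ge0 ?sqr_ge0 //.
  have [_ _ _ h1] := H1 i iP; have [_ _ _ h2] := H2 j jP.
  have q1 : (complex.Re (x - l i j)) ^+ 2 <= (i.+1%:R / P%:R) ^+ 2.
    rewrite -[leLHS]real_normK ?num_real // lerXn2r ?nnegrE ?divr_ge0 //.
    by move: h1; case: (x).
  have q2 : (complex.Im (x - l i j)) ^+ 2 <= (i.+1%:R / P%:R) ^+ 2.
    rewrite -[leLHS]real_normK ?num_real // lerXn2r ?nnegrE ?divr_ge0 //.
    apply: (@le_trans _ _ (j.+1%:R / P%:R)); first by move: h2; case: (x).
    by rewrite ler_pM2r ?invr_gt0 // ler_nat.
  rewrite mulrC -ler_pdivlMr ?exprn_gt0 //; apply: le_trans (lerD q1 q2) _.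
  by rewrite expr_div_n -mulr2n -[leLHS]mulr_natl mulrA.
have Wp : 0 < W by apply: lt_le_trans hW; rewrite divr_gt0.
pose ps := [seq (i, j) | i <- index_enum 'I_P, j <- index_enum 'I_P].
pose T := map (fun ij : 'I_P * 'I_P => (- (w ij.1 ij.2 / W)%:C%C, l ij.1 ij.2)) ps.
have sumT (F : R[i] * R[i] -> R[i]) : \sum_(k <- T) F k =
    \sum_(i < P) \sum_(j < P) F (- (w i j / W)%:C%C, l i j).
  by rewrite big_map big_allpairs.
exists T; split.
  move=> _ /mapP[[i j] _ ->]; exists (c / P%:R ^+ 2); exact: lin.
move=> z offz; rewrite sumT.
have WC : W%:C%C != 0 by rewrite -cmod_gt0 cmod_real gtr0_norm.
have -> : (z - x) * (1 + (z - x) * \sum_(i < P) \sum_(j < P) - (w i j / W)%:C%C / (z - l i j)) =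
    \sum_(i < P) \sum_(j < P) (w i j / W)%:C%C * ((x - l i j) * (z - x) / (z - l i j)).
  have one : \sum_(i < P) \sum_(j < P) (w i j / W)%:C%C = 1 :> R[i].
    under eq_bigr do rewrite -rmorph_sum -mulr_suml.
    by rewrite -rmorph_sum -mulr_suml divff ?rmorph1 // gt_eqF.
  rewrite -[in LHS]one mulr_sumr -big_split mulr_sumr /=; apply: eq_bigr => i _.
  rewrite mulr_sumr -big_split mulr_sumr /=; apply: eq_bigr => j _.
  have := nz z i j offz (ltn_ord i) (ltn_ord j).
  by move: (l i j) ((w i j / W)%:C%C) => lij q hB; field.
have bound v : off (lattice d c) v ->
    \sum_(i < P) \sum_(j < P) s / cmod (v - l i j) <= 16 / c + 48.
  by move=> offv; apply: (lattice_sum_bound hs1 hs2 c0 hl) => i j iP jP; apply: sep.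
apply: (@le_trans _ _ (\sum_(i < P) \sum_(j < P)
    (s / cmod (x - l i j) + s / cmod (z - l i j)) / W)).
  apply: le_trans (ler_cmod_sum _ _ _) _; apply: ler_sum => i _.
  apply: le_trans (ler_cmod_sum _ _ _) _; apply: ler_sum => j _.
  rewrite cmodM cmod_real ger0_norm; last exact: divr_ge0 (w0 i j) (ltW Wp).
  rewrite mulrAC.
  rewrite ler_pM2r ?invr_gt0 // cmod_div cmodM.
  have A0 := gtz x i j offx (ltn_ord i) (ltn_ord j).
  have B0 := gtz z i j offz (ltn_ord i) (ltn_ord j).
  have : cmod (z - x) <= cmod (z - l i j) + cmod (x - l i j).
    by rewrite [cmod (x - l i j)]cmodB; apply: ler_dist_cmod.
  rewrite /w; move: A0 B0; set A := cmod (x - _); set B := cmod (z - l i j) => A0 B0 hAB.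
  have -> : s / A + s / B = s / A ^+ 2 * (A * (B + A) / B).
    by field; rewrite !gt_eqF.
  apply: ler_wpM2l; first by rewrite divr_ge0 // exprn_ge0 // ltW.
  by rewrite ler_pM2r ?invr_gt0 // ler_pM2l.
under eq_bigr do rewrite -mulr_suml big_split /=.
rewrite -mulr_suml big_split /= ler_pdivrMr // mulrAC ler_pdivlMr //.
have := bound x offx; have := bound z offz; move: hW.
set S1 := \sum_(i < P) _; set S2 := \sum_(i < P) _ => h0 h1 h2.
have c1 : 0 < c^-1 by rewrite invr_gt0.
apply: (@le_trans _ _ ((32 / c + 96) * D)); first by rewrite ler_pM2r //; lra.
have -> : (64 / c + 192) * W = (32 / c + 96) * (2 * W) by ring.
by rewrite ler_pM2l; lra.
Qed.

End Lattice.

(** * A discrete Cauchy estimate *)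

Section SecondOrder.
Variable R : realType.
Implicit Types (z w : R[i]) (G : set R[i]) (f g : R[i] -> R[i]).

(** A quantitative form of complex differentiability on an arbitrary set [G], with one constant for
    all pairs of points. It is stable under sums, products and inverses bounded away from 0, hence
    available for rational functions. *)
Definition second_order G f := exists (C : R) (f' : R[i] -> R[i]),
  [/\ 0 <= C, forall z, G z -> cmod (f z) <= C /\ cmod (f' z) <= C,
      forall z w, G z -> G w -> cmod (f w - f z) <= C * cmod (w - z) &
      forall z w, G z -> G w -> cmod (f w - f z - f' z * (w - z)) <= C * cmod (w - z) ^+ 2].

Lemma second_order_cst G c : second_order G (fun=> c).
Proof.
exists (cmod c), (fun=> 0); split=> [|z _|z w _ _|z w _ _].
- exact: cmod_ge0.
- by rewrite cmod0 cmod_ge0.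
- by rewrite subrr cmod0 mulr_ge0 ?cmod_ge0.
by rewrite subrr mul0r subrr cmod0 mulr_ge0 ?cmod_ge0 ?exprn_ge0 ?cmod_ge0.
Qed.

Lemma second_order_id G (B : R) : (forall z, G z -> cmod z <= B) -> second_order G id.
Proof.
move=> hB; have B1 : 0 <= `|B| + 1 by rewrite addr_ge0.
exists (`|B| + 1), (fun=> 1); split=> // [z /hB h|z w _ _|z w _ _].
- rewrite cmod1 lerDr; split=> //.
  by apply: le_trans h _; apply: le_trans (ler_norm B) _; rewrite lerDl.
- by rewrite ler_peMl ?cmod_ge0 // lerDr.
by rewrite mul1r subrr cmod0 mulr_ge0 ?exprn_ge0 ?cmod_ge0.
Qed.

Lemma second_orderD G f g : second_order G f -> second_order G g ->
  second_order G (fun z => f z + g z).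
Proof.
move=> [C [f' [h0 h1 h2 h3]]] [D [g' [k0 k1 k2 k3]]].
exists (C + D), (fun z => f' z + g' z); split=> [|z Gz|z w Gz Gw|z w Gz Gw].
- exact: addr_ge0.
- by have [? ?] := h1 z Gz; have [? ?] := k1 z Gz; split;
    apply: le_trans (ler_cmodD _ _) (lerD _ _).
- have -> : f w + g w - (f z + g z) = (f w - f z) + (g w - g z) by ring.
  rewrite mulrDl; exact: le_trans (ler_cmodD _ _) (lerD (h2 _ _ Gz Gw) (k2 _ _ Gz Gw)).
have -> : f w + g w - (f z + g z) - (f' z + g' z) * (w - z) =
  (f w - f z - f' z * (w - z)) + (g w - g z - g' z * (w - z)) by ring.
rewrite mulrDl; exact: le_trans (ler_cmodD _ _) (lerD (h3 _ _ Gz Gw) (k3 _ _ Gz Gw)).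
Qed.

Lemma second_orderM G f g : second_order G f -> second_order G g ->
  second_order G (fun z => f z * g z).
Proof.
move=> [C [f' [h0 h1 h2 h3]]] [D [g' [k0 k1 k2 k3]]].
have CD : 0 <= C * D by apply: mulr_ge0.
exists (3 * (C * D)), (fun z => f' z * g z + f z * g' z).
split=> [|z Gz|z w Gz Gw|z w Gz Gw].
- exact: mulr_ge0.
- have [a1 a2] := h1 z Gz; have [b1 b2] := k1 z Gz.
  have m (u v : R[i]) : cmod u <= C -> cmod v <= D -> cmod (u * v) <= C * D.
    by move=> ? ?; rewrite cmodM; apply: ler_pM; rewrite ?cmod_ge0.
  split; first by apply: le_trans (m _ _ a1 b1) _; lra.
  apply: le_trans (ler_cmodD _ _) _.
  by have := m _ _ a2 b1; have := m _ _ a1 b2; lra.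
- have -> : f w * g w - f z * g z = (f w - f z) * g w + f z * (g w - g z) by ring.
  apply: le_trans (ler_cmodD _ _) _; rewrite !cmodM.
  have [a1 _] := h1 z Gz; have [b1 _] := k1 w Gw.
  have e1 : cmod (f w - f z) * cmod (g w) <= (C * cmod (w - z)) * D.
    by apply: ler_pM; rewrite ?cmod_ge0 ?h2.
  have e2 : cmod (f z) * cmod (g w - g z) <= C * (D * cmod (w - z)).
    by apply: ler_pM; rewrite ?cmod_ge0 ?k2.
  have := mulr_ge0 CD (cmod_ge0 (w - z)); lra.
have -> : f w * g w - f z * g z - (f' z * g z + f z * g' z) * (w - z) =
    (f w - f z - f' z * (w - z)) * g w + f z * (g w - g z - g' z * (w - z)) +
    f' z * (w - z) * (g w - g z) by ring.
have [a1 a2] := h1 z Gz; have [b1 _] := k1 w Gw.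
apply: le_trans (ler_cmodD _ _) _; apply: le_trans (lerD (ler_cmodD _ _) (lexx _)) _.
rewrite !cmodM.
have e1 : cmod (f w - f z - f' z * (w - z)) * cmod (g w) <= (C * cmod (w - z) ^+ 2) * D.
  by apply: ler_pM; rewrite ?cmod_ge0 ?h3.
have e2 : cmod (f z) * cmod (g w - g z - g' z * (w - z)) <= C * (D * cmod (w - z) ^+ 2).
  by apply: ler_pM; rewrite ?cmod_ge0 ?k3.
have e3 : cmod (f' z) * cmod (w - z) * cmod (g w - g z) <= C * cmod (w - z) * (D * cmod (w - z)).
  by apply: ler_pM; rewrite ?mulr_ge0 ?cmod_ge0 ?k2 // ler_pM // cmod_ge0.
lra.
Qed.

Lemma second_orderV G f (c : R) : 0 < c -> (forall z, G z -> c <= cmod (f z)) ->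
  second_order G f -> second_order G (fun z => (f z)^-1).
Proof.
move=> c0 hc [C [f' [h0 h1 h2 h3]]].
have fp z : G z -> 0 < cmod (f z) by move=> /hc; apply: lt_le_trans.
have fn z : G z -> f z != 0 by move=> /fp; rewrite cmod_gt0.
have cV z : G z -> (cmod (f z))^-1 <= c^-1.
  by move=> Gz; rewrite lef_pV2 ?posrE ?fp ?hc.
have V0 z : 0 <= (cmod (f z))^-1 by rewrite invr_ge0 cmod_ge0.
have c0' : 0 <= c^-1 by rewrite invr_ge0 ltW.
exists (2 * C ^+ 2 * c^-1 ^+ 3 + C * c^-1 ^+ 2 + c^-1), (fun z => - f' z / f z ^+ 2).
have p1 : 0 <= C ^+ 2 * c^-1 ^+ 3 by rewrite mulr_ge0 ?exprn_ge0.
have p2 : 0 <= C * c^-1 ^+ 2 by rewrite mulr_ge0 ?exprn_ge0.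
split=> [|z Gz|z w Gz Gw|z w Gz Gw].
- by lra.
- rewrite cmodV cmod_div cmodN cmodX; have [_ a2] := h1 z Gz.
  split; first by have := cV z Gz; lra.
  have : cmod (f' z) / cmod (f z) ^+ 2 <= C * c^-1 ^+ 2.
    by rewrite -exprVn; apply: ler_pM; rewrite ?cmod_ge0 ?exprn_ge0 // lerXn2r ?nnegrE ?cV.
  lra.
- have -> : (f w)^-1 - (f z)^-1 = - ((f w - f z) / f w / f z).
    by have := fn z Gz; have := fn w Gw => ? ?; field; apply/andP.
  rewrite cmodN !cmod_div.
  have : cmod (f w - f z) / cmod (f w) / cmod (f z) <= C * cmod (w - z) * c^-1 * c^-1.
    by apply: ler_pM; rewrite ?mulr_ge0 ?cmod_ge0 ?cV //; apply: ler_pM; rewrite ?cmod_ge0 ?cV ?h2.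
  have := mulr_ge0 p1 (cmod_ge0 (w - z)); have := mulr_ge0 c0' (cmod_ge0 (w - z)).
  lra.
have -> : (f w)^-1 - (f z)^-1 - - f' z / f z ^+ 2 * (w - z) =
    (f' z * (w - z) * (f w - f z) - (f w - f z - f' z * (w - z)) * f z) / f z / f z / f w.
  by have := fn z Gz; have := fn w Gw => ? ?; field; apply/andP.
rewrite !cmod_div; set h := cmod (w - z).
have hh : 0 <= h by apply: cmod_ge0.
have [a1 a2] := h1 z Gz.
have e : cmod (f' z * (w - z) * (f w - f z) - (f w - f z - f' z * (w - z)) * f z) <= 2 * C ^+ 2 * h ^+ 2.
  apply: le_trans (ler_cmodB _ _) _; rewrite !cmodM -/h.
  have e1 : cmod (f' z) * h * cmod (f w - f z) <= C * h * (C * h).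
    by apply: ler_pM; rewrite ?mulr_ge0 ?cmod_ge0 ?h2 // ler_pM // cmod_ge0.
  have e2 : cmod (f w - f z - f' z * (w - z)) * cmod (f z) <= C * h ^+ 2 * C.
    by apply: ler_pM; rewrite ?cmod_ge0 ?h3.
  lra.
have : cmod (f' z * (w - z) * (f w - f z) - (f w - f z - f' z * (w - z)) * f z) / cmod (f z) / cmod (f z) / cmod (f w)
   <= 2 * C ^+ 2 * h ^+ 2 * c^-1 * c^-1 * c^-1.
  apply: ler_pM; rewrite ?mulr_ge0 ?cmod_ge0 ?cV //.
  apply: ler_pM; rewrite ?mulr_ge0 ?cmod_ge0 ?cV //.
  by apply: ler_pM; rewrite ?cmod_ge0 ?cV.
have := mulr_ge0 p2 (exprn_ge0 2 hh); have := mulr_ge0 c0' (exprn_ge0 2 hh).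
lra.
Qed.

Lemma second_order_poly G (B : R) (p : {poly R[i]}) : (forall z, G z -> cmod z <= B) ->
  second_order G (fun z => p.[z]).
Proof.
move=> hB; elim/poly_ind: p => [|p c IH].
  by rewrite (_ : (fun _ => _) = fun=> 0); [exact: second_order_cst|apply/funext=> z; rewrite horner0].
rewrite (_ : (fun _ => _) = fun z => p.[z] * z + c); last first.
  by apply/funext => z; rewrite hornerMXaddC.
apply: second_orderD (second_order_cst _ _); apply: second_orderM IH _.
exact: second_order_id hB.
Qed.

Lemma second_order_rat G (B c : R) (p q : {poly R[i]}) : 0 < c ->
  (forall z, G z -> cmod z <= B) -> (forall z, G z -> c <= cmod q.[z]) ->
  second_order G (fun z => p.[z] / q.[z]).
Proof.
move=> c0 hB hc; apply: second_orderM; first exact: second_order_poly hB.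
by apply: second_orderV c0 hc _; apply: second_order_poly hB.
Qed.

(* Midpoint rule for the integral around a square with centre [m] and half-side
   [e], divided by the side; linear functions integrate to zero exactly. *)
Definition circulation f (m : R[i]) (e : R) : R[i] :=
  f (m - Complex 0 e) - f (m + Complex 0 e) +
  'i%C * (f (m + e%:C%C) - f (m - e%:C%C)).

(** The order [e ^+ 2] is that of the area of the square: over a whole grid these circulations sum
    to a bounded amount, against a main term of order [1 / e] in [full_circulation]. *)
Lemma circulation_le G f : second_order G f -> exists2 C : R, 0 <= C &
  forall m e, 0 <= e -> G m -> G (m - Complex 0 e) -> G (m + Complex 0 e) ->
    G (m + e%:C%C) -> G (m - e%:C%C) -> cmod (circulation f m e) <= C * e ^+ 2.
Proof.
move=> [C [f' [h0 _ _ h3]]]; exists (4 * C); first exact: mulr_ge0.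
move=> m e e0 Gm G1 G2 G3 G4.
have E h : cmod h = e -> G (m + h) -> cmod (f (m + h) - f m - f' m * h) <= C * e ^+ 2.
  by move=> <- Gh; have := h3 _ _ Gm Gh; rewrite [m + h - m]addrC addKr.
have ci : cmod (Complex 0 e) = e by rewrite cmodE /= expr0n add0r sqrtr_sqr ger0_norm.
have cr : cmod e%:C%C = e by rewrite cmod_real ger0_norm.
have E1 := E (- Complex 0 e) _ G1; have E2 := E (Complex 0 e) ci G2.
have E3 := E e%:C%C cr G3; have E4 := E (- e%:C%C) _ G4.
have {}E1 := E1 (etrans (cmodN _) ci); have {}E4 := E4 (etrans (cmodN _) cr).
have ie : Complex 0 e = 'i%C * e%:C%C :> R[i] by apply/eqP; rewrite eq_complex /=; simpc.
have -> : circulation f m e =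
   (f (m - Complex 0 e) - f m - f' m * - Complex 0 e) -
   (f (m + Complex 0 e) - f m - f' m * Complex 0 e) +
   'i%C * (f (m + e%:C%C) - f m - f' m * e%:C%C) -
   'i%C * (f (m - e%:C%C) - f m - f' m * - e%:C%C).
  by rewrite /circulation ie; ring.
do 2![apply: le_trans (ler_cmodB _ _) _ || apply: le_trans (lerD (ler_cmodD _ _) (lexx _)) _].
apply: le_trans (lerD (lerD (ler_cmodB _ _) (lexx _)) (lexx _)) _.
rewrite !cmodM cmod_i !mul1r; lra.
Qed.

End SecondOrder.

(** * Summation by parts over the edges of a grid *)

Section Edges.
Variable R : realType.

Lemma count_interval n (u v : R) : u <= v ->
  \sum_(a < n) ((u < a%:R) && (a%:R < v))%:R <= v - u + 1 :> R.
Proof.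
move=> uv.
(* The bound must depend on [n] for the induction on [n] to go through: only the part of the
   interval already scanned is measured. *)
suff H : \sum_(a < n) ((u < a%:R) && (a%:R < v))%:R <= Num.max 0 (Num.min n%:R (v + 1) - u) :> R.
  apply: le_trans H _; rewrite ge_max; apply/andP; split; first by lra.
  have : Num.min n%:R (v + 1) <= v + 1 by rewrite ge_min lexx orbT.
  lra.
elim: n => [|n IH]; first by rewrite big_ord0 le_max lexx.
rewrite big_ord_recr /=.
have mono : Num.min n%:R (v + 1) <= Num.min n.+1%:R (v + 1).
  by rewrite le_min !ge_min ler_nat leqnSn lexx orbT.
have [/andP[h1 h2]|_] := boolP (_ && _); last first.
  rewrite addr0; apply: le_trans IH _.
  by rewrite ge_max !le_max lexx /= lerD2r mono orbT.
rewrite le_max; apply/orP; right.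
have e1 : Num.min n%:R (v + 1) = n%:R by apply: min_l; lra.
have e2 : Num.min n.+1%:R (v + 1) = n.+1%:R by apply: min_l; rewrite -natr1; lra.
have -> : (true : nat)%:R = 1 :> R by [].
rewrite e2 -natr1; apply: le_trans (lerD IH (lexx _)) _.
by rewrite e1 max_r; lra.
Qed.

Lemma sum_by_parts n (c H : nat -> R[i]) :
  \sum_(b < n.+1) c b * (H b - H b.+1) =
  c 0%N * H 0%N - c n * H n.+1 + \sum_(b < n) (c b.+1 - c b) * H b.+1.
Proof.
elim: n => [|n IH]; first by rewrite big_ord_recr !big_ord0 /=; ring.
by rewrite big_ord_recr IH /= [in RHS]big_ord_recr /=; ring.
Qed.

Variables (T : eqType) (ks : seq T) (X Y : T -> nat -> bool).

(** [ks] will be the removed squares, with [X k a] and [Y k b] saying that [k] meets column [a] and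
    row [b]; an unmarked cell is one that meets no square. *)
Definition unmarked a b := ~~ has (fun k => X k a && Y k b) ks.

Lemma unmarked_change a b : unmarked a b != unmarked a b.+1 -> exists2 k, k \in ks &
  [/\ X k a, Y k b != Y k b.+1 &
   (unmarked a b /\ X k a && Y k b.+1) \/ (unmarked a b.+1 /\ X k a && Y k b)].
Proof.
have [f1|nf1] := boolP (unmarked a b); have [f2|nf2] := boolP (unmarked a b.+1) => //= _.
  move: nf2; rewrite negbK => /hasP[k ks_k /andP[h1 h2]]; exists k => //.
  move: f1 => f1; have := f1; rewrite /unmarked -all_predC => /allP/(_ k ks_k) /=.
  by rewrite h1 h2 /= eqb_id; split=> //; left.
move: nf1; rewrite negbK => /hasP[k ks_k /andP[h1 h2]]; exists k => //.
have := f2; rewrite /unmarked -all_predC => /allP/(_ k ks_k) /=.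
by rewrite h1 h2 /= => h3; split=> //; right.
Qed.

(** Along a column, differences across consecutive unmarked cells cancel. What remains sits on the
    two ends and on edges between a marked and an unmarked cell; each of the latter is charged to a
    square [k] that starts or stops there, which happens at most 6 times in each of at most [c k]
    columns. *)
Lemma edge_bound n (U : nat -> nat -> R[i]) (A : R) (B c : T -> R) :
  (forall a, (a < n.+1)%N -> unmarked a 0 -> cmod (U a 0%N) <= A) ->
  (forall a, (a < n.+1)%N -> unmarked a n -> cmod (U a n.+1) <= A) ->
  (forall a b k, (a < n.+1)%N -> (b < n)%N -> k \in ks ->
     (unmarked a b /\ X k a && Y k b.+1) \/ (unmarked a b.+1 /\ X k a && Y k b) ->
     cmod (U a b.+1) <= B k) ->
  0 <= A -> (forall k, 0 <= B k) ->
  (forall k, k \in ks -> \sum_(a < n.+1) (X k a)%:R <= c k) ->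
  (forall k, k \in ks -> \sum_(b < n) (Y k b != Y k b.+1)%:R <= 6 :> R) ->
  cmod (\sum_(a < n.+1) \sum_(b < n.+1) (unmarked a b)%:R * (U a b - U a b.+1)) <=
  2 * n.+1%:R * A + \sum_(k <- ks) c k * 6 * B k.
Proof.
move=> h1 h2 h3 A0 B0 hX hY.
have bc (b : bool) : cmod (b%:R : R[i]) = b%:R by rewrite cmod_nat.
have bnd (b : bool) (u : R[i]) (M : R) : 0 <= M -> (b -> cmod u <= M) -> cmod (b%:R * u) <= M.
  by case: b => M0 hb; rewrite ?mul1r ?mul0r ?cmod0 // hb.
apply: (@le_trans _ _ (\sum_(a < n.+1) (2 * A + \sum_(k <- ks) (X k a)%:R * 6 * B k))).
  apply: le_trans (ler_cmod_sum _ _ _) _; apply: ler_sum => a _.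
  rewrite (sum_by_parts n (fun b => (unmarked a b)%:R) (U a)).
  apply: le_trans (ler_cmodD _ _) _; apply: lerD.
    apply: le_trans (ler_cmodB _ _) _; rewrite [leRHS]mulr_natl mulr2n.
    by apply: lerD; apply: bnd => // f; [exact: h1|exact: h2].
  apply: le_trans (ler_cmod_sum _ _ _) _.
  apply: (@le_trans _ _ (\sum_(b < n) \sum_(k <- ks) (X k a && (Y k b != Y k b.+1))%:R * B k)).
    apply: ler_sum => b _.
    have s0 : 0 <= \sum_(k <- ks) (X k a && (Y k b != Y k b.+1))%:R * B k.
      by apply: sumr_ge0 => k _; rewrite mulr_ge0.
    have [->|ne] := eqVneq (unmarked a b) (unmarked a b.+1); first by rewrite subrr mul0r cmod0.
    have [k kks [Xk Yk hk]] := unmarked_change ne.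
    rewrite cmodM; have -> : cmod ((unmarked a b.+1)%:R - (unmarked a b)%:R : R[i]) = 1.
      by case: (unmarked a b) (unmarked a b.+1) ne => -[] // _; rewrite ?subr0 ?sub0r ?cmodN cmod1.
    rewrite mul1r (big_rem k) //= Xk Yk mul1r; apply: ler_wpDr.
      by apply: sumr_ge0 => k' _; rewrite mulr_ge0.
    exact: (h3 a b k).
  rewrite exchange_big /= big_seq [leRHS]big_seq; apply: ler_sum => k kks.
  rewrite -mulr_suml; apply: ler_wpM2r => //.
  case: (X k a) => /=; last by rewrite big1 ?mul0r.
  by rewrite mul1r; apply: hY.
rewrite big_split /= sumr_const card_ord -[X in X + _ <= _]mulr_natl mulrA [n.+1%:R * 2]mulrC; apply: lerD => //.
rewrite exchange_big /= big_seq [leRHS]big_seq; apply: ler_sum => k kks.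
by rewrite -!mulr_suml; apply: ler_wpM2r => //; apply: ler_wpM2r => //; apply: hX.
Qed.

End Edges.

(** * Cauchy's estimate with finitely many holes *)

Section FiniteCauchy.
Variable R : realType.
Implicit Types (z : R[i]) (k : R[i] * R).

Definition insq k (z : R[i]) : bool := (`|complex.Re (z - k.1)| < k.2) && (`|complex.Im (z - k.1)| < k.2).

Definition square_minus (Q : seq (R[i] * R)) : set R[i] :=
  [set z | [/\ `|complex.Re z| <= 1, `|complex.Im z| <= 1 & ~~ has (fun k => insq k z) Q]].

(** The distance from [z] to the centre is at most [2 * (k.2 + t)], that is, three quarters of
    [|k.1|]. The margin [t] will be the pitch of the grid. *)
Lemma cmod_near_square k (t : R) z : 4 * k.2 <= cmod k.1 -> 8 * t <= cmod k.1 ->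
  `|complex.Re (z - k.1)| <= k.2 + t -> `|complex.Im (z - k.1)| <= k.2 + t ->
  cmod k.1 / 4 <= cmod z.
Proof.
move=> h1 h2 hx hy; have := ler_cmod_ReIm (z - k.1).
have := lerB_cmod k.1 (k.1 - z); rewrite subKr cmodB; lra.
Qed.

Lemma zero_square_minus (Q : seq (R[i] * R)) :
  {in Q, forall k, 0 < k.2 /\ 4 * k.2 <= cmod k.1} -> square_minus Q 0.
Proof.
move=> hQ; split; rewrite ?raddf0 ?normr0 //.
apply/hasPn => k /hQ[k0 k4]; apply/negP => /andP[h1 h2].
have := @cmod_near_square k 0 0 k4; rewrite mulr0 addr0 cmod0 => /(_ (cmod_ge0 _) (ltW h1) (ltW h2)).
lra.
Qed.

Section Grid.
Variables (N' : nat).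
Let N := N'.+1.
Let n := (2 * N)%N.

(** The cells have side [1 / N] and fill [[-1, 1]^2]. The point [hmid a b] is on the lower edge of
    cell [(a, b)] and [vmid a b] on its left edge; the opposite edges carry [hmid a b.+1] and
    [vmid a.+1 b]. *)
Definition hmid (a b : nat) : R[i] := Complex ((a%:R + 2^-1) / N%:R - 1) (b%:R / N%:R - 1).
Definition vmid (a b : nat) : R[i] := Complex (a%:R / N%:R - 1) ((b%:R + 2^-1) / N%:R - 1).
Definition center (a b : nat) : R[i] :=
  Complex ((a%:R + 2^-1) / N%:R - 1) ((b%:R + 2^-1) / N%:R - 1).
Definition meets (x r : R) (a : nat) := (a%:R / N%:R - 1 < x + r) && (x - r < a.+1%:R / N%:R - 1).
Definition meetsX k := meets (complex.Re k.1) k.2.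
Definition meetsY k := meets (complex.Im k.1) k.2.
Definition between (a : nat) (x : R) := a%:R / N%:R - 1 <= x <= a.+1%:R / N%:R - 1.
Definition in_cell a b z := between a (complex.Re z) && between b (complex.Im z).

Lemma N_gt0 : 0 < N%:R :> R. Proof. by rewrite ltr0n. Qed.
Local Notation N0 := N_gt0.

Lemma circulation_grid (f : R[i] -> R[i]) a b :
  circulation f (center a b) (2 * N%:R)^-1 =
  f (hmid a b) - f (hmid a b.+1) + 'i%C * (f (vmid a.+1 b) - f (vmid a b)).
Proof.
have Nn : N%:R != 0 :> R by rewrite gt_eqF ?N0.
rewrite /circulation; congr (f _ - f _ + _ * (f _ - f _)); apply/eqP;
  rewrite eq_complex /= ?addr0 ?subr0 ?eqxx ?andbT /=; apply/eqP; rewrite -?[a.+1%:R]natr1 -?[b.+1%:R]natr1; field; exact: Nn.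
Qed.

Lemma between_near a x y r : between a y -> meets x r a -> `|y - x| <= r + N%:R^-1.
Proof.
move=> /andP[h1 h2] /andP[h3 h4]; rewrite ler_norml.
by move: h2 h4; rewrite -[a.+1%:R]natr1 mulrDl mul1r; lra.
Qed.

Lemma near_meets a x y r : between a y -> `|y - x| < r -> meets x r a.
Proof.
move=> /andP[h1 h2]; rewrite ltr_norml => /andP[h3 h4].
by apply/andP; split; lra.
Qed.

Lemma between_mid a : between a ((a%:R + 2^-1) / N%:R - 1).
Proof.
by apply/andP; split; rewrite lerD2r ler_pM2r ?invr_gt0 ?N0 // -?[a.+1%:R]natr1; lra.
Qed.

Lemma between_left a : between a (a%:R / N%:R - 1).
Proof. by rewrite /between lexx lerD2r ler_pM2r ?invr_gt0 ?N0 // ler_nat leqnSn. Qed.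

Lemma between_right a : between a (a.+1%:R / N%:R - 1).
Proof. by rewrite /between lexx lerD2r ler_pM2r ?invr_gt0 ?N0 // ler_nat leqnSn. Qed.

Lemma between_le1 a x : (a < n)%N -> between a x -> `|x| <= 1.
Proof.
move=> an /andP[h1 h2]; rewrite ler_norml.
have h3 : a.+1%:R / N%:R <= 2 :> R.
  by rewrite ler_pdivrMr ?N0 // -natrM ler_nat.
have h4 : 0 <= a%:R / N%:R :> R by rewrite divr_ge0.
by apply/andP; split; lra.
Qed.

Lemma meets_count x r : 0 < r -> \sum_(a < n) (meets x r a)%:R <= 2 * N%:R * r + 2.
Proof.
move=> r0; have r1 := ltW r0.
have Nr := mulr_gt0 N0 r0.
apply: (@le_trans _ _ (N%:R * (x + r + 1) - (N%:R * (x - r + 1) - 1) + 1)); last by lra.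
apply: le_trans (count_interval n _); last by lra.
apply: ler_sum => a _; rewrite ler_nat; case: (boolP (meets x r a)) => // /andP[h1 h2].
have -> : N%:R * (x - r + 1) - 1 < a%:R.
  rewrite ltrBlDr natr1 mulrC -ltr_pdivlMr ?N0 //; lra.
by have -> : a%:R < N%:R * (x + r + 1) by rewrite mulrC -ltr_pdivrMr ?N0 //; lra.
Qed.

(** A change can occur only within one step of either end of the interval, and an open interval of
    length 2 contains at most 3 integers. *)
Lemma meets_change x r : \sum_(b < n.-1) (meets x r b != meets x r b.+1)%:R <= 6 :> R.
Proof.
pose v := N%:R * (x + r + 1); pose u := N%:R * (x - r + 1) - 1.
have mE a : meets x r a = (a%:R < v) && (u < a%:R).
  rewrite /meets /u /v; congr (_ && _).
    by rewrite [N%:R * _]mulrC -ltr_pdivrMr ?N0 // ltrBlDr.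
  have -> : (N%:R * (x - r + 1) - 1 < a%:R) = (x - r + 1 < a.+1%:R / N%:R).
    by rewrite ltrBlDr natr1 mulrC ltr_pdivlMr ?N0.
  by rewrite ltrBrDr.
apply: (@le_trans _ _ (\sum_(b < n.-1) (((v - 2 < b%:R) && (b%:R < v))%:R + ((u - 1 < b%:R) && (b%:R < u + 1))%:R))).
  apply: ler_sum => b _; rewrite -natrD ler_nat !mE -!natr1.
  case: (boolP (_ == _)) => //= h; rewrite addn_gt0 !lt0b; apply: contraNT h.
  rewrite negb_or !negb_and -!leNgt => /andP[h1 h2]; apply/eqP; congr (_ && _).
    apply/idP/idP => h3; last by lra.
    by case/orP: h1 => h1; lra.
  apply/idP/idP => h3; first by lra.
  by case/orP: h2 => h2; lra.
rewrite big_split /=.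
have := @count_interval R n.-1 (v - 2) v; have := @count_interval R n.-1 (u - 1) (u + 1).
move=> h1 h2; apply: le_trans (lerD (h2 _) (h1 _)) _; lra.
Qed.

(** Inner edges cancel, leaving a midpoint rule for the integral of [dz / z] around [[-1, 1]^2]. All
    midpoints contribute in the same imaginary direction, each at least [1 / 2], and there are
    [2 * N] of them on each of the four sides. *)
Lemma full_circulation :
  4 * N%:R <= cmod (\sum_(a < n) \sum_(b < n) circulation (@GRing.inv R[i]) (center a b) (2 * N%:R)^-1).
Proof.
pose k (a : nat) : R := (a%:R + 2^-1) / N%:R - 1.
have Nn : N%:R != 0 :> R by rewrite gt_eqF ?N0.
have tele (H : nat -> R[i]) : \sum_(b < n) (H b.+1 - H b) = H n - H 0%N.
  by rewrite -(big_mkord xpredT (fun b => H b.+1 - H b)) telescope_sumr.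
have ends0 : (0%:R / N%:R - 1 : R) = -1 by rewrite mul0r sub0r.
have endsn : (n%:R / N%:R - 1 : R) = 1 by rewrite natrM mulfK //; ring.
have inv (u v : R) : (Complex u v : R[i])^-1 = Complex (u / (u ^+ 2 + v ^+ 2)) (- (v / (u ^+ 2 + v ^+ 2))).
  by [].
pose t (a : nat) : R := (k a ^+ 2 + 1)^-1.
have -> : \sum_(a < n) \sum_(b < n) circulation (@GRing.inv R[i]) (center a b) (2 * N%:R)^-1 =
   Complex 0 (4 * \sum_(a < n) t a).
  under eq_bigr do under eq_bigr do rewrite circulation_grid.
  under eq_bigr do rewrite big_split.
  rewrite big_split /= [X in _ + X]exchange_big /=.
  have h1 (a : 'I_n) : \sum_(b < n) ((hmid a b)^-1 - (hmid a b.+1)^-1) = Complex 0 (2 * t a).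
    under eq_bigr do rewrite -opprB.
    rewrite sumrN (tele (fun b => (hmid a b)^-1)) opprB /hmid ends0 endsn !inv -/(k a).
    apply/eqP; rewrite eq_complex /= /t sqrrN expr1n !mulN1r; apply/andP; split; apply/eqP; ring.
  have h2 (b : 'I_n) : \sum_(a < n) 'i%C * ((vmid a.+1 b)^-1 - (vmid a b)^-1) = Complex 0 (2 * t b).
    rewrite -mulr_sumr (tele (fun a => (vmid a b)^-1)) /vmid ends0 endsn !inv -/(k b).
    apply/eqP; rewrite eq_complex /= /t sqrrN expr1n [1 + _]addrC; apply/andP; split; apply/eqP; ring.
  rewrite (eq_bigr _ (fun a _ => h1 a)) (eq_bigr _ (fun b _ => h2 b)) -big_split /=.
  apply: (big_rec2 (fun x y => x = Complex 0 (4 * y))); first by rewrite mulr0.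
  by move=> i x y _ ->; apply/eqP; rewrite eq_complex /=; apply/andP; split; apply/eqP; ring.
rewrite cmodE /= expr0n add0r sqrtr_sqr ger0_norm; last first.
  by rewrite mulr_ge0 ?sumr_ge0 // => a _; rewrite invr_ge0 addr_ge0 ?sqr_ge0.
rewrite ler_pM2l //; apply: (@le_trans _ _ (\sum_(a < n) 2^-1)).
  by rewrite sumr_const card_ord -[leRHS]mulr_natr natrM; lra.
apply: ler_sum => a _; rewrite lef_pV2 ?posrE ?ltr_wpDl ?sqr_ge0 //.
have : `|k a| <= 1 by apply: (between_le1 (ltn_ord a)); apply: between_mid.
rewrite -(@ler_pXn2r _ 2) ?nnegrE // expr1n real_normK ?num_real //; lra.
Qed.

End Grid.

Lemma finite_list_bound (Q : seq (R[i] * R)) : {in Q, forall k, 0 < cmod k.1} ->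
  exists2 d : R, 0 < d & {in Q, forall k, d <= cmod k.1}.
Proof.
elim: Q => [|k Q IH] hQ; first by exists 1.
have [|d d0 hd] := IH; first by move=> j jQ; apply: hQ; rewrite inE jQ orbT.
have k0 : 0 < cmod k.1 by apply: hQ; rewrite inE eqxx.
exists (Num.min d (cmod k.1)); first by rewrite lt_min d0.
by move=> j; rewrite inE => /predU1P[->|/hd h]; rewrite ge_min ?lexx ?orbT // h.
Qed.

Lemma limit_le (x y c : R) N0 : (forall N, (N0 <= N)%N -> x <= y + c / N.+1%:R) -> x <= y.
Proof.
move=> H; apply/ler_addgt0Pr => e e0.
pose m := Num.Def.archi_bound (`|c| / e).
have hm : `|c| / e < m%:R by apply: archi_boundP; rewrite divr_ge0 // ltW.
apply: le_trans (H (maxn N0 m) (leq_maxl _ _)) _; rewrite lerD2l ler_pdivrMr ?ltr0n //.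
apply: le_trans (ler_norm c) _; rewrite -ler_pdivrMl // mulrC; apply: le_trans (ltW hm) _.
by rewrite ler_nat leqW ?leq_maxr.
Qed.

(* On a fine grid, (g - g 0) / z with g = p / q is regular on the cells that meet no
   square of [Q], so its circulations around them are negligible; those of 1 / z
   around the other cells are negligible too, as these cells stay away from 0. *)
Lemma finite_cauchy (Q : seq (R[i] * R)) (p q : {poly R[i]}) (l : nat) (A c0 : R) :
  {in Q, forall k, 0 < k.2 /\ 4 * k.2 <= cmod k.1} -> 0 < c0 -> 0 <= A ->
  (forall z, square_minus Q z -> c0 <= cmod q.[z]) ->
  (forall z, square_minus Q z -> cmod p.[z] * cmod z ^+ l <= A * cmod q.[z]) ->
  cmod (p.[0] / q.[0]) <= A * (2 + 6 * \sum_(k <- Q) k.2 * (4 / cmod k.1) ^+ l.+1).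
Proof.
move=> hQ c00 A0 hq hp.
have Q0 k : k \in Q -> 0 < cmod k.1 by move=> /hQ[k0 k4]; lra.
have G0 := zero_square_minus hQ.
have q0 : q.[0] != 0 by rewrite -cmod_gt0; apply: lt_le_trans (hq _ G0).
pose G := square_minus Q; pose g0 := p.[0] / q.[0].
have GB z : G z -> cmod z <= 2.
  by move=> [h1 h2 _]; apply: le_trans (ler_cmod_ReIm _) _; lra.
(* Thus [r / q] is [(g - g 0) / z] without a singularity at 0, while away from 0 it splits into
   [g / z] and [g 0 / z]. *)
have [r hr] : exists r : {poly R[i]}, p - g0 *: q = r * 'X.
  have : root (p - g0 *: q) 0 by rewrite rootE !hornerE /g0 divfK // subrr.
  by move=> /factor_theorem[r ->]; exists r; rewrite subr0.
have [d d0 hd] := finite_list_bound Q0.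
pose Gd : set R[i] := fun z => d / 4 <= cmod z /\ cmod z <= 2.
have [C1 C10 hC1] := circulation_le (second_order_rat r c00 GB hq).
have [C2 C20 hC2] : exists2 C : R, 0 <= C &
  forall m e, 0 <= e -> Gd m -> Gd (m - Complex 0 e) -> Gd (m + Complex 0 e) ->
    Gd (m + e%:C%C) -> Gd (m - e%:C%C) -> cmod (circulation (@GRing.inv R[i]) m e) <= C * e ^+ 2.
  apply: (@circulation_le R Gd); apply: (@second_orderV R Gd id (d / 4)).
  - by rewrite divr_gt0.
  - by move=> z [].
  - by apply: (@second_order_id R Gd 2) => z [].
(* [B k] bounds [g / z] at edges next to the square [k]: the hypothesis gives
   [|g / z| <= A / |z|^(l+1)], and such edges satisfy [|z| >= |k.1| / 4]. *)
pose B k := A * (4 / cmod k.1) ^+ l.+1.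
have B0 k : 0 <= B k by rewrite mulr_ge0 // exprn_ge0 // divr_ge0 // cmod_ge0.
pose N0 := Num.Def.archi_bound (8 / d).
apply: (@limit_le _ _ ((12 * 2 * \sum_(k <- Q) B k + C1 + cmod g0 * C2) / 4) N0) => N' NN'.
pose N := N'.+1; pose n := (2 * N)%N; pose e : R := (2 * N%:R)^-1.
have Np : 0 < N%:R :> R by rewrite ltr0n.
have e0 : 0 <= e by rewrite invr_ge0 mulr_ge0.
have Nd : 8 * N%:R^-1 <= d.
  rewrite ler_pdivrMr // mulrC -ler_pdivrMr //.
  apply: le_trans (ltW (archi_boundP _)) _; first by rewrite divr_ge0 // ltW.
  by rewrite ler_nat; apply: leq_trans NN' _.
pose cell (a b : nat) z := in_cell N' a b z.
have cellc a b : cell a b (center N' a b) by rewrite /cell /in_cell /= !between_mid.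
have cell1 a b : cell a b (hmid N' a b) by rewrite /cell /in_cell /= between_mid between_left.
have cell2 a b : cell a b (hmid N' a b.+1) by rewrite /cell /in_cell /= between_mid between_right.
have cell3 a b : cell a b (vmid N' a b) by rewrite /cell /in_cell /= between_mid between_left.
have cell4 a b : cell a b (vmid N' a.+1 b) by rewrite /cell /in_cell /= between_mid between_right.
pose fr (a b : nat) := unmarked Q (meetsX N') (meetsY N') a b.
have frG a b z : (a < n)%N -> (b < n)%N -> fr a b -> cell a b z -> G z.
  move=> an bn f /andP[h1 h2]; split; [exact: between_le1 h1|exact: between_le1 h2|].
  move: f; apply: contraNN => /hasP[k kQ /andP[k1 k2]]; apply/hasP; exists k => //.
  rewrite /meetsX /meetsY (near_meets h1) ?(near_meets h2) //.
    by rewrite -raddfB.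
  by rewrite -raddfB.
have badk a b k z : k \in Q -> meetsX N' k a && meetsY N' k b -> cell a b z ->
    cmod k.1 / 4 <= cmod z.
  move=> kQ /andP[m1 m2] /andP[h1 h2].
  apply: (@cmod_near_square k N%:R^-1) => //; first by have [] := hQ _ kQ.
  - by apply: le_trans Nd (hd _ kQ).
  - by rewrite raddfB; apply: between_near h1 m1.
  - by rewrite raddfB; apply: between_near h2 m2.
have badG a b z : (a < n)%N -> (b < n)%N -> ~~ fr a b -> cell a b z -> Gd z.
  move=> an bn; rewrite negbK => /hasP[k kQ hk] hz; split.
    by apply: le_trans (badk _ _ _ _ kQ hk hz); rewrite ler_pM2r ?invr_gt0 // hd.
  move: hz => /andP[h1 h2]; apply: le_trans (ler_cmod_ReIm _) _.
  by have := between_le1 an h1; have := between_le1 bn h2; lra.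
have half_neq (a : nat) : (a%:R + 2^-1) / N%:R - 1 != 0 :> R.
  rewrite subr_eq0; apply/negP => /eqP h.
  have : a%:R + 2^-1 = (a%:R + 2^-1) / N%:R * N%:R :> R by rewrite divfK ?gt_eqF.
  rewrite h mul1r => h2.
  have /eqP : (2 * a + 1)%:R = (2 * N)%:R :> R by rewrite natrD !natrM; lra.
  by rewrite eqr_nat => /eqP; lia.
have hm0 a b : hmid N' a b != 0 by rewrite eq_complex /= negb_and half_neq.
have vm0 a b : vmid N' a b != 0 by rewrite eq_complex /= negb_and half_neq orbT.
pose f z := p.[z] / q.[z] / z.
have fA z : G z -> z != 0 -> cmod (f z) <= A / cmod z ^+ l.+1.
  move=> Gz z0; have zp : 0 < cmod z by rewrite cmod_gt0.
  have qp : 0 < cmod q.[z] by apply: lt_le_trans (hq _ Gz).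
  rewrite /f !cmod_div ler_pdivrMr // exprSr invfM mulrA mulfVK ?gt_eqF //.
  by rewrite ler_pdivrMr // mulrAC ler_pdivlMr ?exprn_gt0 // hp.
have fB z k : G z -> z != 0 -> k \in Q -> cmod k.1 / 4 <= cmod z -> cmod (f z) <= B k.
  move=> Gz z0 kQ hk; apply: le_trans (fA _ Gz z0) _; rewrite /B; apply: ler_wpM2l => //.
  have k0 := Q0 _ kQ.
  have zp : 0 < cmod z by rewrite cmod_gt0.
  rewrite -exprVn; apply: lerXn2r; rewrite ?nnegrE ?invr_ge0 ?divr_ge0 ?cmod_ge0 //.
  by rewrite -[leRHS]invf_div lef_pV2 ?posrE ?divr_gt0.
have fout z : G z -> z != 0 -> 1 <= cmod z -> cmod (f z) <= A.
  move=> Gz z0 z1; apply: le_trans (fA _ Gz z0) _.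
  by rewrite ler_pdivrMr ?exprn_gt0 ?cmod_gt0 // ler_peMr // exprn_ege1.
have split_f z : G z -> z != 0 -> r.[z] / q.[z] = f z - g0 * z^-1.
  move=> Gz z0; have qz : q.[z] != 0 by rewrite -cmod_gt0; apply: lt_le_trans (hq _ Gz).
  have := congr1 (fun P : {poly R[i]} => P.[z]) hr; rewrite !hornerE => e1.
  have -> : r.[z] = (p.[z] - g0 * q.[z]) / z by rewrite e1 mulfK.
  by rewrite /f; field; apply/andP.
have ends0 : (0%:R / N%:R - 1 : R) = -1 by rewrite mul0r sub0r.
have endsn : (n%:R / N%:R - 1 : R) = 1 by rewrite natrM mulfK ?gt_eqF //; ring.
pose circ F (a b : nat) := circulation F (center N' a b) e.
have circE F a b : circ F a b = F (hmid N' a b) - F (hmid N' a b.+1) + 'i%C * (F (vmid N' a.+1 b) - F (vmid N' a b)).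
  exact: circulation_grid.
pose S F := \sum_(a < n) \sum_(b < n) (fr a b)%:R * circ F a b.
(* Horizontal and vertical edges are two instances of [edge_bound], with the axes exchanged. On the
   outer boundary [|z| >= 1], so [f] is bounded by [A] there. *)
have free_sum : cmod (S f) <= 2 * (2 * n%:R * A + \sum_(k <- Q) (2 * N%:R * k.2 + 2) * 6 * B k).
  have -> : S f = \sum_(a < n) \sum_(b < n) (fr a b)%:R * (f (hmid N' a b) - f (hmid N' a b.+1)) -
      'i%C * \sum_(b < n) \sum_(a < n) (unmarked Q (meetsY N') (meetsX N') b a)%:R * (f (vmid N' a b) - f (vmid N' a.+1 b)).
    rewrite [X in _ - _ * X]exchange_big /= mulr_sumr -sumrB; apply: eq_bigr => a _.
    rewrite mulr_sumr -sumrB; apply: eq_bigr => b _; rewrite circE.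
    have -> : unmarked Q (meetsY N') (meetsX N') b a = fr a b.
      by congr negb; apply: eq_has => k; rewrite andbC.
    by ring.
  apply: le_trans (ler_cmodB _ _) _; rewrite cmodM cmod_i mul1r [leRHS]mulr_natl mulr2n.
  pose n' := (N' + (N'.+1 + 0))%N.
  have corner z : 1 <= `|complex.Re z| \/ 1 <= `|complex.Im z| -> 1 <= cmod z.
    by move=> []h; apply: le_trans h _; rewrite ?ler_Re_cmod ?ler_Im_cmod.
  apply: lerD.
    apply: (@edge_bound R _ Q (meetsX N') (meetsY N') n' (fun a b => f (hmid N' a b)) A B (fun k => 2 * N%:R * k.2 + 2)) => //.
    - move=> a an fa; apply: fout => //; first by apply: (frG a 0%N).
      by apply: corner; right; rewrite /= ends0 normrN normr1.
    - move=> a an fa; apply: fout => //; first exact: (frG a n').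
      by apply: corner; right; rewrite /= endsn normr1.
    - move=> a b k an bn kQ hh; have bn1 : (b.+1 < n)%N by [].
      have bn2 := ltnW bn1.
      case: hh => [[f1 m1]|[f1 m1]].
        apply: (fB _ k) => //; first by apply: (frG a b).
        exact: (badk a b.+1).
      apply: (fB _ k) => //; first by apply: (frG a b.+1).
      exact: (badk a b).
    - by move=> k /hQ[k0 _]; apply: meets_count.
    - by move=> k _; apply: meets_change.
  apply: (@edge_bound R _ Q (meetsY N') (meetsX N') n' (fun b a => f (vmid N' a b)) A B (fun k => 2 * N%:R * k.2 + 2)) => //.
  - move=> b bn fa; apply: fout => //; first by apply: (frG 0%N b) => //; move: fa; congr (~~ _); apply: eq_has => k; rewrite andbC.
    by apply: corner; left; rewrite /= ends0 normrN normr1.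
  - move=> b bn fa; apply: fout => //.
      by apply: (frG n' b _ (ltnSn n') bn _ (cell4 n' b)); move: fa; congr (~~ _); apply: eq_has => k; rewrite andbC.
    by apply: corner; left; rewrite /= endsn normr1.
  - move=> b a k bn an kQ hh; have an1 : (a.+1 < n)%N by [].
    have an2 := ltnW an1.
    case: hh => [[f1 m1]|[f1 m1]]; rewrite andbC in m1.
      apply: (fB _ k) => //; last exact: (badk a.+1 b).
      by apply: (frG a b) => //; move: f1; congr (~~ _); apply: eq_has => j; rewrite andbC.
    apply: (fB _ k) => //; last exact: (badk a b).
    by apply: (frG a.+1 b) => //; move: f1; congr (~~ _); apply: eq_has => j; rewrite andbC.
  - by move=> k /hQ[k0 _]; apply: meets_count.
  - by move=> k _; apply: meets_change.
have ne1 : n%:R * e = 1 by rewrite /e natrM divff // mulf_neq0 ?gt_eqF.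
have total (c : nat -> nat -> R[i]) (C : R) : 0 <= C ->
    (forall a b, (a < n)%N -> (b < n)%N -> cmod (c a b) <= C * e ^+ 2) ->
    cmod (\sum_(a < n) \sum_(b < n) c a b) <= C.
  move=> C0 hc; apply: (@le_trans _ _ (\sum_(a < n) \sum_(b < n) C * e ^+ 2)).
    apply: le_trans (ler_cmod_sum _ _ _) _; apply: ler_sum => a _.
    by apply: le_trans (ler_cmod_sum _ _ _) _; apply: ler_sum => b _; apply: hc.
  rewrite !sumr_const !card_ord -mulrnA -[leLHS]mulr_natr natrM.
  rewrite (_ : C * e ^+ 2 * (n%:R * n%:R) = C * (n%:R * e) ^+ 2); last by ring.
  by rewrite ne1 expr1n mulr1.
have mh a b : center N' a b - Complex 0 e = hmid N' a b.
  by apply/eqP; rewrite eq_complex /= subr0 eqxx /= /e -/N; apply/eqP; field; rewrite gt_eqF.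
have ph a b : center N' a b + Complex 0 e = hmid N' a b.+1.
  apply/eqP; rewrite eq_complex /= addr0 eqxx /= /e -/N; apply/eqP.
  by rewrite -[b.+1%:R]natr1; field; rewrite gt_eqF.
have mv a b : center N' a b - e%:C%C = vmid N' a b.
  apply/eqP; rewrite eq_complex /= subr0 eqxx andbT /e -/N; apply/eqP.
  by field; rewrite gt_eqF.
have pv a b : center N' a b + e%:C%C = vmid N' a.+1 b.
  apply/eqP; rewrite eq_complex /= addr0 eqxx andbT /e -/N; apply/eqP.
  by rewrite -[a.+1%:R]natr1; field; rewrite gt_eqF.
have sphi : cmod (S (fun z => r.[z] / q.[z])) <= C1.
  apply: (total (fun a b => (fr a b)%:R * circ (fun z => r.[z] / q.[z]) a b)) => // a b an bn.
  have [fab|_] := boolP (fr a b); last first.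
    by rewrite mul0r cmod0 mulr_ge0 ?exprn_ge0.
  rewrite mul1r; apply: hC1 => //; rewrite ?mh ?ph ?mv ?pv; apply: (frG a b) => //.
have sbad : cmod (\sum_(a < n) \sum_(b < n) (1 - (fr a b)%:R) * circ (@GRing.inv R[i]) a b) <= C2.
  apply: (total (fun a b => (1 - (fr a b)%:R) * circ (@GRing.inv R[i]) a b)) => // a b an bn.
  have [_|fab] := boolP (fr a b).
    by rewrite subrr mul0r cmod0 mulr_ge0 ?exprn_ge0.
  rewrite subr0 mul1r; apply: hC2 => //; rewrite ?mh ?ph ?mv ?pv; apply: (badG a b) => //.
have eS : S (fun z => r.[z] / q.[z]) = S f - g0 * S (@GRing.inv R[i]).
  rewrite /S mulr_sumr -sumrB; apply: eq_bigr => a _.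
  rewrite mulr_sumr -sumrB; apply: eq_bigr => b _.
  have [fab|_] := boolP (fr a b); last by rewrite !mul0r mulr0 subr0.
  have [an bn] := (ltn_ord a, ltn_ord b).
  rewrite !circE !split_f //; try exact: (frG a b).
  by ring.
have full := full_circulation N'.
have eF : \sum_(a < n) \sum_(b < n) circ (@GRing.inv R[i]) a b =
    S (@GRing.inv R[i]) + \sum_(a < n) \sum_(b < n) (1 - (fr a b)%:R) * circ (@GRing.inv R[i]) a b.
  rewrite /S -big_split; apply: eq_bigr => a _ /=; rewrite -big_split; apply: eq_bigr => b _ /=.
  by ring.
(* Divided by [4 * N], the outer boundary yields [2 * A], the terms in [2 * N * k.2] yield the sum
   of the statement, and all the rest is of order [1 / N]. *)
have main : cmod g0 * (4 * N%:R) <=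
    2 * (2 * n%:R * A + \sum_(k <- Q) (2 * N%:R * k.2 + 2) * 6 * B k) + C1 + cmod g0 * C2.
  have h1 : cmod g0 * (4 * N%:R) <= cmod (g0 * S (@GRing.inv R[i])) + cmod g0 * C2.
    rewrite [cmod (g0 * _)]cmodM -mulrDr; apply: ler_wpM2l; first exact: cmod_ge0.
    apply: le_trans full _; rewrite -/n eF; apply: le_trans (ler_cmodD _ _) _.
    by rewrite lerD2l.
  have h2 : cmod (g0 * S (@GRing.inv R[i])) <= cmod (S f) + cmod (S (fun z => r.[z] / q.[z])).
    have -> : g0 * S (@GRing.inv R[i]) = S f - S (fun z => r.[z] / q.[z]) by rewrite eS; ring.
    exact: ler_cmodB.
  apply: le_trans h1 _; apply: lerD => //; apply: le_trans h2 _; exact: lerD.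
have sumE : \sum_(k <- Q) (2 * N%:R * k.2 + 2) * 6 * B k =
    12 * N%:R * A * (\sum_(k <- Q) k.2 * (4 / cmod k.1) ^+ l.+1) + 12 * \sum_(k <- Q) B k.
  rewrite !mulr_sumr -big_split; apply: eq_bigr => k _ /=; rewrite /B.
  by set u := _ ^+ l.+1; ring.
rewrite sumE in main.
rewrite -(@ler_pM2r _ (4 * N%:R)) ?mulr_gt0 //; apply: le_trans main _.
rewrite /n natrM -/N; set s1 := \sum_(k <- Q) _ * _; set s2 := \sum_(k <- Q) _.
have Nn : N%:R != 0 :> R by rewrite gt_eqF.
rewrite le_eqVlt; apply/orP; left; apply/eqP.
by move: (N%:R) Nn => m Nn; field.
Qed.

End FiniteCauchy.

(** * Topology of the plane and Swiss cheeses *)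

Section Topology.
Variable R : realType.
Implicit Types (x y z : Cplx R) (K : set (Cplx R)).

Lemma nbhs_cmod x (A : set (Cplx R)) :
  nbhs x A <-> exists2 e : R, 0 < e & forall y, cmod (y - x) < e -> A y.
Proof.
rewrite nbhs_ballP; split=> [[e /= e0 h]|[e e0 h]].
  (* Radii of balls are elements of [R[i]]; being positive in its order forces them to be real. *)
  have [r er] : exists r : R, e = r%:C%C.
    by exists (complex.Re e); case: e e0 {h} => a b /=; rewrite ltcE /= => /andP[/eqP -> _].
  rewrite {}er in e0 h; exists r; first by rewrite -ltcR.
  by move=> y hy; apply: h; rewrite -ball_normE /= normC_cmod ltcR cmodB.
exists (e%:C%C) => /=; first by rewrite ltcR.
by move=> y; rewrite -ball_normE /= normC_cmod ltcR => hy; apply: h; rewrite cmodB.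
Qed.

Lemma nbhs_sub_cmod K (x : set_type K) (A : set (set_type K)) :
  nbhs x A <-> exists2 e : R, 0 < e & forall y : set_type K, cmod (\val y - \val x) < e -> A y.
Proof.
split.
  rewrite nbhsE /= => -[U [[V openV <-] /= Vx] VA].
  have /nbhs_cmod[e e0 he] : nbhs (\val x : Cplx R) V by apply: open_nbhs_nbhs.
  by exists e => // y hy; apply: VA; apply: he.
move=> [e e0 he].
have h : nbhs (\val x : Cplx R) [set z | cmod (z - \val x) < e] by apply/nbhs_cmod; exists e.
have : nbhs x (\val @^-1` [set z : Cplx R | cmod (z - \val x) < e]).
  exact: (@initial_continuous _ _ (@set_val _ K) x).
by apply: filterS.
Qed.

Lemma uniform_closureP (X : topologicalType) (A : set (X -> Cplx R)) f :
  uniform_closure A f <-> forall e : R, 0 < e ->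
    exists2 g, A g & forall t, cmod (f t - g t) < e.
Proof.
split=> [cl e e0|h].
  have : nbhs (f : {uniform X -> Cplx R}) [set g | forall t, cmod (f t - g t) < e].
    apply/uniform_nbhs; exists [set xy : Cplx R * Cplx R | cmod (xy.1 - xy.2) < e]; split.
      rewrite -entourage_ballE; exists (e%:C%C); first by rewrite /= ltcR.
      by move=> [a b] /=; rewrite -ball_normE /= normC_cmod ltcR.
    by move=> g /= hg y; apply: hg.
  by move=> /cl[g [Ag hg]]; exists g.
move=> B /uniform_nbhs[E [+ hB]]; rewrite -entourage_ballE => -[e /= e0 he].
have [r er] : exists r : R, e = r%:C%C.
  by exists (complex.Re e); case: e e0 {he} => a b /=; rewrite ltcE /= => /andP[/eqP -> _].
rewrite {}er in e0 he; rewrite ltcR in e0.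
have [g Ag hg] := h r e0; exists g; split=> //; apply: hB => y _; apply: he => /=.
by rewrite -ball_normE /= normC_cmod ltcR.
Qed.

Lemma compact_square : compact [set z : Cplx R | `|complex.Re z| <= 1 /\ `|complex.Im z| <= 1].
Proof.
pose I : set R := `[-1, 1]%classic.
have cI : compact I by apply: segment_compact.
have cf : continuous (fun ab : R * R => Complex ab.1 ab.2 : Cplx R).
  move=> [a b] A /nbhs_cmod[e e0 he].
  have e2 : 0 < e / 2 by rewrite divr_gt0.
  exists ([set x | `|a - x| < e / 2], [set x | `|b - x| < e / 2]) => /=.
    by split; apply/nbhs_ballP; exists (e / 2).
  move=> [u v] /= [h1 h2]; apply: he; apply: le_lt_trans (ler_cmod_ReIm _) _ => /=.
  by rewrite [`|u - a|]distrC [`|v - b|]distrC; lra.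
rewrite (_ : [set z | _] = (fun ab : R * R => Complex ab.1 ab.2 : Cplx R) @` (I `*` I)).
  by apply: continuous_compact (compact_setX cI cI); apply: continuous_subspaceT.
apply/seteqP; split=> [[a b] /= [h1 h2]|_ [[a b] [/= h1 h2] <-]] /=.
  by exists (a, b) => //; split=> /=; rewrite /I /= in_itv /= -ler_norml.
by move: h1 h2; rewrite /I /= !in_itv /= -!ler_norml.
Qed.

End Topology.

(** * From finitely many to infinitely many holes *)

Section Swiss.
Variable R : realType.
Implicit Types (z : R[i]) (k : R[i] * R).

Definition swiss (L : nat -> seq (R[i] * R)) : set (Cplx R) :=
  [set z | [/\ `|complex.Re z| <= 1, `|complex.Im z| <= 1 & forall n, ~~ has (fun k => insq k z) (L n)]].

Lemma insq_open k z : insq k z -> exists2 e : R, 0 < e &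
  forall y, cmod (y - z) < e -> insq k y.
Proof.
move=> /andP[h1 h2].
pose e := Num.min (k.2 - `|complex.Re (z - k.1)|) (k.2 - `|complex.Im (z - k.1)|).
exists e; first by rewrite /e lt_min !subr_gt0 h1 h2.
move=> y hy; have hr := le_lt_trans (ler_Re_cmod _) hy; have hi := le_lt_trans (ler_Im_cmod _) hy.
have er : e <= k.2 - `|complex.Re (z - k.1)| by rewrite /e ge_min lexx.
have ei : e <= k.2 - `|complex.Im (z - k.1)| by rewrite /e ge_min lexx orbT.
have -> : insq k y = insq k ((y - z) + z) by rewrite subrK.
rewrite /insq -addrA ![_ (_ + (z - k.1))]raddfD; apply/andP; split; apply: le_lt_trans (ler_normD _ _) _; lra.
Qed.

Lemma square_cluster (x : nat -> R[i]) :
  (forall n, `|complex.Re (x n)| <= 1 /\ `|complex.Im (x n)| <= 1) ->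
  exists2 a : R[i], `|complex.Re a| <= 1 /\ `|complex.Im a| <= 1 &
    forall (e : R) m, 0 < e -> exists2 n, (m <= n)%N & cmod (x n - a) < e.
Proof.
move=> hx; have xS : ((x : nat -> Cplx R) @ \oo) [set z : Cplx R | `|complex.Re z| <= 1 /\ `|complex.Im z| <= 1].
  by exists 0%N => // n _; exact: hx.
have [a [/= aS cla]] := @compact_square R ((x : nat -> Cplx R) @ \oo) _ xS.
exists a => // e m e0.
have [] := cla [set y | exists2 n, (m <= n)%N & y = x n] [set y : Cplx R | cmod (y - a) < e].
- by exists m => // n /= mn; exists n.
- by apply/nbhs_cmod; exists e.
by move=> y [[n mn ->] /= hy]; exists n.
Qed.

Lemma swiss_closed L : closed (swiss L).
Proof.
move=> z hz.
have app (e : R) : 0 < e -> exists2 y, swiss L y & cmod (y - z) < e.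
  move=> e0; have [|y [Ly hy]] := hz [set y : Cplx R | cmod (y - z) < e]; last by exists y.
  by apply/nbhs_cmod; exists e.
split.
- apply/ler_addgt0Pr => e e0; have [y [h _ _] hy] := app e e0.
  have := ler_normD (complex.Re (z - y)) (complex.Re y); rewrite -raddfD subrK => h1.
  have := ler_Re_cmod (z - y); rewrite cmodB; lra.
- apply/ler_addgt0Pr => e e0; have [y [_ h _] hy] := app e e0.
  have := ler_normD (complex.Im (z - y)) (complex.Im y); rewrite -raddfD subrK => h1.
  have := ler_Im_cmod (z - y); rewrite cmodB; lra.
move=> n; apply/hasPn => k kL; apply/negP => /insq_open[e e0 he].
have [y [_ _ /(_ n)/hasPn/(_ k kL)]] := app e e0.
by move=> /negP h hy; apply: h; apply: he.
Qed.

Lemma square_cmod z : `|complex.Re z| <= 1 -> `|complex.Im z| <= 1 -> cmod z <= 2.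
Proof. by move=> h1 h2; apply: le_trans (ler_cmod_ReIm _) _; lra. Qed.

Lemma poly_lip (p : {poly R[i]}) : exists2 C : R, 0 <= C &
  forall z w, cmod z <= 2 -> cmod w <= 2 -> cmod (p.[w] - p.[z]) <= C * cmod (w - z).
Proof.
have [C [f' [C0 _ h _]]] := @second_order_poly R (fun z => cmod z <= 2) 2 p (fun z h => h).
by exists C.
Qed.

Variable L : nat -> seq (R[i] * R).
Hypothesis L0 : forall n, {in L n, forall k, 0 < k.2 /\ 4 * k.2 <= cmod k.1}.
Hypothesis LW : forall l, exists W : R, forall m,
  \sum_(n < m) \sum_(k <- L n) k.2 * (4 / cmod k.1) ^+ l <= W.

Definition layers m := flatten [seq L n | n <- iota 0 m].

Lemma swiss_layers z m : square_minus (layers m) z <->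
  [/\ `|complex.Re z| <= 1, `|complex.Im z| <= 1 & forall n, (n < m)%N -> ~~ has (fun k => insq k z) (L n)].
Proof.
split=> -[h1 h2 h3]; split=> //.
  move=> n nm; apply: contraNN h3 => /hasP[k kL hk]; apply/hasP; exists k => //.
  by apply/flatten_mapP; exists n; rewrite ?mem_iota.
by apply/hasPn => k /flatten_mapP[n]; rewrite mem_iota add0n => /andP[_ nm] kL; apply: (hasPn (h3 n nm)).
Qed.

(** If every finite stage had a bad point, a cluster point of these would lie outside all the open
    holes, hence in [swiss L], where the strict inequality [A < A'] contradicts continuity. One
    index [m] serves both as the stage and as the lower bound for [q]. *)
Lemma swiss_approx (p q : {poly R[i]}) l (A A' : R) : 0 <= A < A' ->
  (forall z, swiss L z -> q.[z] != 0) ->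
  (forall z, swiss L z -> cmod p.[z] * cmod z ^+ l <= A * cmod q.[z]) ->
  exists m, forall z, square_minus (layers m) z ->
    (m.+1%:R)^-1 <= cmod q.[z] /\ cmod p.[z] * cmod z ^+ l <= A' * cmod q.[z].
Proof.
move=> /andP[A0 AA'] hq hp; apply: contrapT => /forallNP hn.
have H m : exists z, square_minus (layers m) z /\
    (cmod q.[z] < (m.+1%:R)^-1 \/ A' * cmod q.[z] < cmod p.[z] * cmod z ^+ l).
  have /existsNP[z /not_implyP[hz /not_andP h]] := hn m; exists z; split=> //.
  by case: h => [/negP|/negP]; rewrite -ltNge => h; [left|right].
have [x hx] := choice H.
have xS n : `|complex.Re (x n)| <= 1 /\ `|complex.Im (x n)| <= 1.
  by have [/swiss_layers[]] := hx n.
have [a [a1 a2] ha] := square_cluster xS.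
have aL : swiss L a.
  split=> // n; apply/hasPn => k kL; apply/negP => /insq_open[e e0 he].
  have [m nm hm] := ha e n.+1 e0; have [/swiss_layers[_ _ /(_ n nm)/hasPn/(_ k kL)/negP]] := hx m.
  by move=> h; case: h; apply: he.
have qa : 0 < cmod q.[a] by rewrite cmod_gt0 hq.
have [Cp Cp0 hCp] := poly_lip (p * 'X^l); have [Cq Cq0 hCq] := poly_lip q.
have pa : cmod (p * 'X^l).[a] <= A * cmod q.[a].
  by rewrite hornerM hornerXn cmodM cmodX; apply: hp.
(* The two available margins at [a]: half of [|q a|] for the lower bound on [q], and the gap between
   [A] and [A'] for the upper bound. *)
pose g := Num.min (cmod q.[a] / 2) ((A' - A) * cmod q.[a]).
have g0 : 0 < g by rewrite lt_min divr_gt0 // mulr_gt0 // subr_gt0.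
pose e := g / (Cp + (A' + 1) * Cq + 1).
have den : 0 < Cp + (A' + 1) * Cq + 1.
  have : 0 <= (A' + 1) * Cq by rewrite mulr_ge0 // addr_ge0 //; lra.
  lra.
have e0 : 0 < e by rewrite divr_gt0.
have [n hnn hxn] := ha e (Num.Def.archi_bound (2 / cmod q.[a])) e0.
have xn2 : cmod (x n) <= 2 by have [] := xS n; apply: square_cmod.
have a2' : cmod a <= 2 by apply: square_cmod.
have lq := hCq a (x n) a2' xn2; have lp := hCp a (x n) a2' xn2.
have ge : (Cp + (A' + 1) * Cq) * cmod (x n - a) <= g.
  apply: (@le_trans _ _ ((Cp + (A' + 1) * Cq + 1) * e)); last by rewrite /e mulrC divfK // gt_eqF.
  by apply: ler_pM; rewrite ?cmod_ge0 ?(ltW hxn) //; [have : 0 <= (A' + 1) * Cq by rewrite mulr_ge0 // addr_ge0 //; lra|]; lra.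
have gq : g <= cmod q.[a] / 2 by rewrite /g ge_min lexx.
have gp : g <= (A' - A) * cmod q.[a] by rewrite /g ge_min lexx orbT.
have tq : cmod q.[a] - Cq * cmod (x n - a) <= cmod q.[x n].
  have := lerB_cmod q.[a] (q.[a] - q.[x n]); rewrite subKr [cmod (_ - q.[x n])]cmodB; lra.
have tp : cmod (p * 'X^l).[x n] <= cmod (p * 'X^l).[a] + Cp * cmod (x n - a).
  have := ler_cmodD ((p * 'X^l).[x n] - (p * 'X^l).[a]) (p * 'X^l).[a]; rewrite subrK; lra.
have u0 : 0 <= Cq * cmod (x n - a) by rewrite mulr_ge0 // cmod_ge0.
have v0 : 0 <= Cp * cmod (x n - a) by rewrite mulr_ge0 // cmod_ge0.
have [_ [h|h]] := hx n.
  have h1 : (n.+1%:R)^-1 <= cmod q.[a] / 2.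
    rewrite -[leRHS]invrK lef_pV2 ?posrE ?ltr0n ?invr_gt0 ?divr_gt0 // invf_div.
    apply: le_trans (ltW (archi_boundP _)) _; first by rewrite divr_ge0 // cmod_ge0.
    by rewrite ler_nat ltnW.
  have : Cq * cmod (x n - a) <= g by have := mulr_ge0 (le_trans A0 (ltW AA')) u0; lra.
  have h2 := lt_le_trans h h1; lra.
move: h; rewrite -cmodX -hornerXn -cmodM -hornerM => h.
have : A' * cmod q.[a] - A' * (Cq * cmod (x n - a)) <= A' * cmod q.[x n].
  by rewrite -mulrBr ler_wpM2l // (le_trans A0 (ltW AA')).
lra.
Qed.

(** [LW] at exponent [l + 1] makes the constant of [finite_cauchy] uniform over the stages, and the
    slack [A'] tends to [A]. The weight [|z|^l] is there because iterated difference quotients at 0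
    are controlled only up to such a factor. *)
Lemma swiss_cauchy l : exists2 C : R, 0 <= C & forall (p q : {poly R[i]}) (A : R), 0 <= A ->
  (forall z, swiss L z -> q.[z] != 0) ->
  (forall z, swiss L z -> cmod p.[z] * cmod z ^+ l <= A * cmod q.[z]) ->
  cmod (p.[0] / q.[0]) <= C * A.
Proof.
have [W hW] := LW l.+1.
have W0 : 0 <= W by have := hW 0%N; rewrite big_ord0.
exists (2 + 6 * W) => [|p q A A0 hq hp]; first by lra.
have H A' : A < A' -> cmod (p.[0] / q.[0]) <= A' * (2 + 6 * W).
  move=> AA'; have hA : 0 <= A < A' by rewrite A0.
  have [m hm] := swiss_approx hA hq hp.
  have lL : {in layers m, forall k, 0 < k.2 /\ 4 * k.2 <= cmod k.1}.
    by move=> k /flatten_mapP[n _]; apply: L0.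
  have mp : 0 < (m.+1%:R)^-1 :> R by rewrite invr_gt0 ltr0n.
  have A'0 := ltW (le_lt_trans A0 AA').
  apply: le_trans (@finite_cauchy R (layers m) p q l A' _ lL mp A'0 _ _) _.
  - by move=> z /hm[].
  - by move=> z /hm[].
  apply: ler_wpM2l => //; rewrite lerD2l ler_pM2l //.
  have := hW m; rewrite -(big_mkord xpredT (fun n => \sum_(k <- L n) k.2 * (4 / cmod k.1) ^+ l.+1)).
  by rewrite /index_iota subn0 /layers big_flatten big_map.
rewrite [leRHS]mulrC -ler_pdivrMr; last by lra.
apply/ler_addgt0Pr => e e0; rewrite ler_pdivrMr; last by lra.
by apply: H; lra.
Qed.

End Swiss.

(** * Point derivations at the origin *)

Section Taylor.
Variable F : fieldType.
Implicit Types p q : {poly F}.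

(* The numerator, over the denominator [q], of the function obtained from [p / q]
   by applying [k] times the operation [f |-> (f - f 0) / 'X]. *)
Fixpoint tnum p q k : {poly F} :=
  if k is k'.+1 then drop_poly 1 (tnum p q k' - ((tnum p q k').[0] / q.[0]) *: q) else p.

Definition taylor p q k : F := (tnum p q k).[0] / q.[0].

Lemma tnumS p q k : q.[0] != 0 -> tnum p q k.+1 * 'X = tnum p q k - taylor p q k *: q.
Proof.
move=> q0 /=; rewrite -/(taylor p q k); set r := _ - _.
have r0 : r`_0 = 0 by rewrite -horner_coef0 /r !hornerE /taylor divfK // subrr.
rewrite -[RHS](poly_take_drop 1) expr1 -[LHS]add0r; congr (_ + _).
by apply/polyP => -[|i]; rewrite coef_take_poly coef0 // r0.
Qed.

(** The recurrence determines the numerators, so identities between Taylor coefficients follow by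
    exhibiting a sequence that satisfies it. *)
Lemma tnum_unique p q (T : nat -> {poly F}) : q.[0] != 0 -> T 0%N = p ->
  (forall k, T k.+1 * 'X = T k - ((T k).[0] / q.[0]) *: q) -> forall k, tnum p q k = T k.
Proof.
move=> q0 T0 TS; elim=> [|k IH]; first by rewrite T0.
by apply: (mulIf (negbT (polyX_eq0 F))); rewrite tnumS // TS /taylor IH.
Qed.

Lemma taylor_linear (a b : F) p q p' q' k : q.[0] != 0 -> q'.[0] != 0 ->
  taylor (a *: (p * q') + b *: (p' * q)) (q * q') k = a * taylor p q k + b * taylor p' q' k.
Proof.
move=> q0 q0'; have qq0 : (q * q').[0] != 0 by rewrite hornerM mulf_neq0.
rewrite /taylor (@tnum_unique _ _ (fun k => a *: (tnum p q k * q') + b *: (tnum p' q' k * q)) qq0) //.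
  by rewrite hornerD !hornerZ !hornerM; field; rewrite q0 q0'.
move=> j; rewrite mulrDl -!scalerAl [_ * q' * 'X]mulrAC [_ * q * 'X]mulrAC !tnumS //.
rewrite hornerD !hornerZ !hornerM; have -> : (a * ((tnum p q j).[0] * q'.[0]) + b * ((tnum p' q' j).[0] * q.[0])) / (q.[0] * q'.[0]) =
  a * taylor p q j + b * taylor p' q' j by rewrite /taylor; field; rewrite q0 q0'.
rewrite -!mul_polyC rmorphD !rmorphM /=; ring.
Qed.

Lemma taylorM p q p' q' k : q.[0] != 0 -> q'.[0] != 0 ->
  taylor (p * p') (q * q') k = \sum_(j < k.+1) taylor p q j * taylor p' q' (k - j).
Proof.
move=> q0 q0'; have qq0 : (q * q').[0] != 0 by rewrite hornerM mulf_neq0.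
(* With [S f = (f - f 0) / z], iterating [S (f g) = f (S g) + g(0) (S f)] expresses [S^k (f g)];
   this is its numerator over [q * q']. *)
pose T k := p * tnum p' q' k + \sum_(j < k) taylor p' q' (k - j.+1) *: (tnum p q j.+1 * q').
have val j : (T j).[0] / (q * q').[0] = \sum_(i < j.+1) taylor p q i * taylor p' q' (j - i).
  rewrite /T hornerD horner_sum mulrDl big_ord_recl subn0; congr (_ + _).
    by rewrite !hornerM /taylor /=; field; rewrite q0 q0'.
  rewrite mulr_suml; apply: eq_bigr => i _.
  by rewrite hornerZ !hornerM [taylor p q _]/taylor /=; field; rewrite q0 q0'.
rewrite /taylor -/(taylor p q) (@tnum_unique _ _ T qq0) ?val //.
  by rewrite /T big_ord0 addr0.
move=> j; rewrite val.
rewrite /T mulrDl -mulrA tnumS // mulr_suml scaler_suml.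
have -> : \sum_(i < j.+1) taylor p' q' (j.+1 - i.+1) *: (tnum p q i.+1 * q') * 'X =
    \sum_(i < j.+1) taylor p' q' (j - i) *: (tnum p q i * q') -
    \sum_(i < j.+1) (taylor p q i * taylor p' q' (j - i)) *: (q * q').
  rewrite -sumrB; apply: eq_bigr => i _.
  rewrite subSS -scalerAl mulrAC tnumS // mulrBl scalerBr -scalerAl scalerA.
  by rewrite [taylor p q i * _]mulrC.
rewrite addrA; congr (_ - _).
rewrite big_ord_recl subn0 /= mulrBr addrA; congr (_ + _).
by rewrite -scalerAr subrK.
Qed.

End Taylor.

(** * Boundedness of Taylor coefficients and their extension to [R(K)] *)

Section Derivation.
Variable R : realType.
Implicit Types (p q : {poly R[i]}).

Definition taylor_bounded (K : set (Cplx R)) := forall k, exists2 M : R, 0 <= M &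
  forall p q (A : R), 0 <= A -> (forall z, K z -> q.[z] != 0) ->
    (forall z, K z -> cmod p.[z] <= A * cmod q.[z]) -> cmod (taylor p q k) <= M * A.

(** With [f_k] the [k]-th iterated quotient of [f], one has [z f_(k+1) = f_k - f_k(0)]. A bound on
    [f_k z^k] therefore gives one on [f_k(0)] by [swiss_cauchy], and then one on
    [f_(k+1) z^(k+1)]. *)
Lemma swiss_taylor_bounded (L : nat -> seq (R[i] * R)) :
  (forall n, {in L n, forall k, 0 < k.2 /\ 4 * k.2 <= cmod k.1}) ->
  (forall l, exists W : R, forall m,
    \sum_(n < m) \sum_(k <- L n) k.2 * (4 / cmod k.1) ^+ l <= W) ->
  swiss L 0 -> taylor_bounded (swiss L).
Proof.
move=> L0 LW K0.
have num k : exists2 M : R, 0 <= M & forall p q (A : R), 0 <= A ->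
    (forall z, swiss L z -> q.[z] != 0) ->
    (forall z, swiss L z -> cmod p.[z] <= A * cmod q.[z]) ->
    forall z, swiss L z -> cmod (tnum p q k).[z] * cmod z ^+ k <= M * A * cmod q.[z].
  elim: k => [|k [M M0 hM]].
    by exists 1 => // p q A A0 hq hp z Kz; rewrite mulr1 mul1r hp.
  have [C C0 hC] := swiss_cauchy L0 LW k.
  exists (M + C * M * 2 ^+ k) => [|p q A A0 hq hp z Kz].
    by rewrite addr_ge0 // !mulr_ge0 // exprn_ge0.
  have q0 := hq 0 K0; have MA : 0 <= M * A by apply: mulr_ge0.
  have ht : cmod (taylor p q k) <= C * (M * A) by apply: hC => // w Kw; apply: hM.
  rewrite exprS mulrA -cmodM -hornerMX.
  rewrite tnumS // hornerD hornerN hornerZ.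
  have z2 : cmod z <= 2 by case: Kz => h1 h2 _; apply: square_cmod.
  apply: le_trans (ler_wpM2r (exprn_ge0 k (cmod_ge0 z)) (ler_cmodB _ _)) _.
  rewrite mulrDl cmodM; have h1 := hM p q A A0 hq hp z Kz.
  have h2 : cmod (taylor p q k) * cmod q.[z] * cmod z ^+ k <= C * (M * A) * cmod q.[z] * 2 ^+ k.
    apply: ler_pM; rewrite ?mulr_ge0 ?exprn_ge0 ?cmod_ge0 //; last first.
      by rewrite lerXn2r ?nnegrE ?cmod_ge0.
    by rewrite ler_wpM2r ?cmod_ge0.
  apply: le_trans (lerD h1 h2) _; rewrite le_eqVlt; apply/orP; left; apply/eqP; ring.
move=> k; have [M M0 hM] := num k; have [C C0 hC] := swiss_cauchy L0 LW k.
exists (C * M) => [|p q A A0 hq hp]; first exact: mulr_ge0.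
rewrite -mulrA; apply: hC => //; [exact: mulr_ge0|exact: hM].
Qed.

Variable K : set (Cplx R).
Hypothesis K0 : K 0.
Hypothesis TB : taylor_bounded K.

Definition offpoles q := forall z, K z -> q.[z] != 0.

Lemma RK_approx (f : K -> Cplx R) : RK K f <-> forall e : R, 0 < e ->
  exists p q, offpoles q /\ forall t : K, cmod (f t - p.[\val t] / q.[\val t]) < e.
Proof.
split=> [/uniform_closureP h e /h[g [p [q [hq hg]]] hfg]|h].
  exists p, q; split=> [z Kz|t]; first exact: hq.
  by rewrite -hg.
apply/uniform_closureP => e /h[p [q [hq hf]]].
exists (fun t => p.[\val t] / q.[\val t]) => //; exists p, q; split=> // z Kz; exact: hq.
Qed.

(** The value is characterized by its closeness to the coefficients of all rational approximants,
    which lets linearity and the Leibniz rule pass to the limit. *)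
Lemma taylor_extend k : exists2 M : R, 0 <= M & forall f : K -> Cplx R, RK K f ->
  exists l : R[i], forall p q (e : R), 0 <= e -> offpoles q ->
    (forall t : K, cmod (f t - p.[\val t] / q.[\val t]) <= e) ->
    cmod (l - taylor p q k) <= M * e.
Proof.
have [M M0 hM] := TB k; exists M => // f Rf.
have diff p q p' q' (e e' : R) : 0 <= e -> 0 <= e' -> offpoles q -> offpoles q' ->
    (forall t : K, cmod (f t - p.[\val t] / q.[\val t]) <= e) ->
    (forall t : K, cmod (f t - p'.[\val t] / q'.[\val t]) <= e') ->
    cmod (taylor p q k - taylor p' q' k) <= M * (e + e').
  move=> e0 e0' hq hq' h h'; have q0 := hq 0 K0; have q0' := hq' 0 K0.
  have := taylor_linear 1 (-1) p p' k q0 q0'; rewrite mul1r mulN1r => <-.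
  apply: hM; first exact: addr_ge0.
    by move=> z Kz; rewrite hornerM mulf_neq0 ?hq ?hq'.
  move=> z Kz; have qz := hq z Kz; have qz' := hq' z Kz.
  pose t : K := exist _ z (mem_set Kz).
  have -> : (1 *: (p * q') + -1 *: (p' * q)).[z] =
      (q * q').[z] * ((f t - p'.[\val t] / q'.[\val t]) - (f t - p.[\val t] / q.[\val t])).
    by rewrite hornerD !hornerZ !hornerM /=; move: (f t) => ft; field; rewrite qz qz'.
  rewrite cmodM mulrC; apply: ler_wpM2r; first exact: cmod_ge0.
  by apply: le_trans (ler_cmodB _ _) _; rewrite addrC; apply: lerD.
have H n : exists pq : {poly R[i]} * {poly R[i]}, offpoles pq.2 /\
    forall t : K, cmod (f t - pq.1.[\val t] / pq.2.[\val t]) <= 2^-1 ^+ n.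
  have [p [q [hq h]]] := (RK_approx f).1 Rf (2^-1 ^+ n) (half_pow_gt0 R n).
  by exists (p, q); split=> // t; apply: ltW.
have [pq hpq] := choice H.
pose u n := taylor (pq n).1 (pq n).2 k.
have hn n : 0 <= 2^-1 ^+ n :> R by apply/ltW/half_pow_gt0.
have hu n : cmod (u n.+1 - u n) <= M * 2 * 2^-1 ^+ n.
  have [h1 h2] := hpq n; have [h3 h4] := hpq n.+1.
  apply: le_trans (diff _ _ _ _ _ _ (hn n.+1) (hn n) h3 h1 h4 h2) _.
  rewrite -mulrA; apply: ler_wpM2l => //; rewrite half_powS; have := hn n; lra.
have [l hl] := geometric_climit hu.
exists l => p q e e0 hq h.
apply/ler_addgt0Pr => g g0.
(* The factor 9 is [8 * M] from the limit in [geometric_climit] plus [M] from [diff]. *)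
have [m hm] := half_pow_small (divr_gt0 g0 (ltr_pwDr (@ltr01 R) (mulr_ge0 (ler0n R 9) M0))).
have := hm m (leqnn m); rewrite ler_pdivlMr; last by rewrite ltr_pwDr // mulr_ge0.
have [h1 h2] := hpq m; have := diff _ _ _ _ _ _ (hn m) e0 h1 hq h2 h; have := hl m.
rewrite -/(u m); have := ler_dist_cmod l (u m) (taylor p q k); have := hn m.
set w := 2^-1 ^+ m; lra.
Qed.

End Derivation.

(** * [R(K)] as an algebra *)

Section Algebra.
Variables (R : realType) (K : set (Cplx R)).
Hypothesis clK : closed K.
Hypothesis sqK : forall z, K z -> `|complex.Re z| <= 1 /\ `|complex.Im z| <= 1.
Implicit Types (p q : {poly R[i]}) (f g : K -> Cplx R) (t : K).

Lemma val_in t : K (\val t).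
Proof. exact: set_valP. Qed.

Lemma mod_le2 z : K z -> cmod z <= 2.
Proof. by move=> /sqK[h1 h2]; apply: square_cmod. Qed.

Lemma denominator_below q : offpoles K q ->
  exists2 c : R, 0 < c & forall z, K z -> c <= cmod q.[z].
Proof.
move=> hq; apply: contrapT => hn.
have H n : exists z : R[i], K z /\ cmod q.[z] < (n.+1%:R)^-1.
  apply: contrapT => /forallNP h; apply: hn; exists (n.+1%:R)^-1; first by rewrite invr_gt0 ltr0n.
  by move=> z Kz; rewrite leNgt; apply/negP => hz; apply: (h z).
have [x hx] := choice H.
have [a [a1 a2] ha] := @square_cluster R x (fun n => sqK (hx n).1).
have Ka : K a.
  apply: clK => A /nbhs_cmod[e e0 he]; have [n _ hn'] := ha e 0%N e0.
  by exists (x n); split; [have [] := hx n|apply: he].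
have qa : 0 < cmod q.[a] by rewrite cmod_gt0 hq.
have [C C0 hC] := poly_lip q.
have C1 : 0 < C + 1 by lra.
have e0 : 0 < cmod q.[a] / 2 / (C + 1) by rewrite !divr_gt0.
have [n hnn hxn] := ha _ (Num.Def.archi_bound (2 / cmod q.[a])) e0.
have [Kx hqx] := hx n.
have l1 := hC _ _ (mod_le2 Ka) (mod_le2 Kx).
have h1 : (n.+1%:R)^-1 <= cmod q.[a] / 2.
  rewrite -[leRHS]invrK lef_pV2 ?posrE ?ltr0n ?invr_gt0 ?divr_gt0 // invf_div.
  apply: le_trans (ltW (archi_boundP _)) _; first by rewrite divr_ge0 // cmod_ge0.
  by rewrite ler_nat ltnW.
have h2 := lt_le_trans hqx h1.
have h3 := lerB_cmod q.[a] (q.[a] - q.[x n]); rewrite subKr [cmod (_ - q.[x n])]cmodB in h3.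
have h4 : (C + 1) * cmod (x n - a) < cmod q.[a] / 2 by rewrite mulrC -ltr_pdivlMr.
have := cmod_ge0 (x n - a); lra.
Qed.

Lemma RK_rat p q : offpoles K q -> RK K (fun t => p.[\val t] / q.[\val t]).
Proof. by move=> hq; apply/RK_approx => e e0; exists p, q; split=> // t; rewrite subrr cmod0. Qed.

Lemma RK_poly p : RK K (fun t => p.[\val t]).
Proof.
have -> : (fun t => p.[\val t]) = (fun t : K => p.[\val t] / (1 : {poly R[i]}).[\val t]).
  by apply/funext => t; rewrite hornerC divr1.
by apply: RK_rat => z _; rewrite hornerC oner_neq0.
Qed.

Lemma RK_cst (c : R[i]) : RK K (fun=> c).
Proof.
have := @RK_poly c%:P; congr (RK K _); apply/funext => t; exact: hornerC.
Qed.

Lemma RK_id : RK K (fun t => \val t).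
Proof. by have := @RK_poly 'X; congr (RK K _); apply/funext => t; rewrite hornerX. Qed.

Lemma RK_bounded f : RK K f -> exists2 B : R, 0 <= B & forall t, cmod (f t) <= B.
Proof.
move=> /RK_approx/(_ 1 ltr01)[p [q [hq hf]]].
have [c c0 hc] := denominator_below hq; have [C C0 hC] := poly_lip p.
have B0 : 0 <= (cmod p.[0] + C * 2) / c + 1.
  by rewrite addr_ge0 // divr_ge0 ?addr_ge0 ?mulr_ge0 ?cmod_ge0 // ltW.
exists ((cmod p.[0] + C * 2) / c + 1) => // t; have Kt := val_in t.
have h := hC 0 (\val t); rewrite cmod0 subr0 in h.
have h2 : cmod p.[\val t] <= cmod p.[0] + C * 2.
  have := ler_cmodD (p.[\val t] - p.[0]) p.[0]; rewrite subrK => h3.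
  have h4 := h (ler0n R 2) (mod_le2 Kt).
  have : C * cmod (\val t) <= C * 2 by apply: ler_wpM2l => //; apply: mod_le2.
  lra.
have h3 : cmod (p.[\val t] / q.[\val t]) <= (cmod p.[0] + C * 2) / c.
  rewrite cmod_div; apply: ler_pM; rewrite ?invr_ge0 ?cmod_ge0 //.
  by rewrite lef_pV2 ?posrE ?hc // (lt_le_trans c0 (hc _ Kt)).
have := ler_cmodD (f t - p.[\val t] / q.[\val t]) (p.[\val t] / q.[\val t]).
by rewrite subrK; have := hf t; lra.
Qed.

Lemma RK_lin (a b : R[i]) f g : RK K f -> RK K g -> RK K (fun t => a * f t + b * g t).
Proof.
move=> /RK_approx hf /RK_approx hg; apply/RK_approx => e e0.
have s0 : 0 < cmod a + cmod b + 1 by rewrite ltr_wpDl ?addr_ge0 ?cmod_ge0.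
have d0 : 0 < e / (cmod a + cmod b + 1) by rewrite divr_gt0.
have [p [q [hq h]]] := hf _ d0; have [p' [q' [hq' h']]] := hg _ d0.
exists (a *: (p * q') + b *: (p' * q)), (q * q'); split.
  by move=> z Kz; rewrite hornerM mulf_neq0 ?hq ?hq'.
move=> t; have qz := hq _ (val_in t); have qz' := hq' _ (val_in t).
have -> : a * f t + b * g t - (a *: (p * q') + b *: (p' * q)).[\val t] / (q * q').[\val t] =
   a * (f t - p.[\val t] / q.[\val t]) + b * (g t - p'.[\val t] / q'.[\val t]).
  rewrite hornerD !hornerZ !hornerM.
  by move: (f t) (g t) => ft gt; field; rewrite qz qz'.
apply: le_lt_trans (ler_cmodD _ _) _; rewrite !cmodM.
have h1 := ler_wpM2l (cmod_ge0 a) (ltW (h t)); have h2 := ler_wpM2l (cmod_ge0 b) (ltW (h' t)).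
have : (cmod a + cmod b + 1) * (e / (cmod a + cmod b + 1)) = e by rewrite mulrC divfK // gt_eqF.
set u := e / _ in d0 h1 h2 *; lra.
Qed.

Lemma RK_closed f : (forall e : R, 0 < e -> exists2 g, RK K g & forall t, cmod (f t - g t) < e) ->
  RK K f.
Proof.
move=> h; apply/RK_approx => e e0; have e2 : 0 < e / 2 by rewrite divr_gt0.
have [g /RK_approx/(_ _ e2)[p [q [hq hg]]] hf] := h _ e2.
exists p, q; split=> // t; apply: le_lt_trans (ler_dist_cmod _ (g t) _) _.
by have := hf t; have := hg t; lra.
Qed.

Lemma mul_close (u v u' v' : R[i]) (B e : R) : cmod u <= B -> cmod v <= B -> e <= 1 ->
  cmod (u - u') <= e -> cmod (v - v') <= e -> cmod (u * v - u' * v') <= (2 * B + 1) * e.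
Proof.
move=> hu hv e1 hu' hv'.
have -> : u * v - u' * v' = u * (v - v') + (u - u') * v - (u - u') * (v - v') by ring.
have e0 : 0 <= e by apply: le_trans hu'; apply: cmod_ge0.
apply: le_trans (ler_cmodB _ _) _; rewrite cmodM.
have h1 := ler_cmodD (u * (v - v')) ((u - u') * v); rewrite !cmodM in h1.
have h2 : cmod u * cmod (v - v') <= B * e by apply: ler_pM; rewrite ?cmod_ge0.
have h3 : cmod (u - u') * cmod v <= e * B by apply: ler_pM; rewrite ?cmod_ge0.
have h4 : cmod (u - u') * cmod (v - v') <= e * 1.
  by apply: ler_pM; rewrite ?cmod_ge0 // (le_trans hv').
lra.
Qed.

Lemma RK_mul f g : RK K f -> RK K g -> RK K (fun t => f t * g t).
Proof.
move=> Rf Rg; have [B B0 hB] := RK_bounded Rf; have [B' B0' hB'] := RK_bounded Rg.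
apply/RK_approx => e e0.
pose M := 2 * (B + B') + 1; have M0 : 0 < M by rewrite /M; lra.
pose d := Num.min 1 (e / 2 / M).
have d0 : 0 < d by rewrite lt_min ltr01 !divr_gt0.
have [p [q [hq h]]] := (RK_approx f).1 Rf _ d0.
have [p' [q' [hq' h']]] := (RK_approx g).1 Rg _ d0.
exists (p * p'), (q * q'); split.
  by move=> z Kz; rewrite hornerM mulf_neq0 ?hq ?hq'.
move=> t; rewrite !hornerM -mulf_div.
apply: (@le_lt_trans _ _ (M * d)).
  apply: mul_close; rewrite ?(ltW (h t)) ?(ltW (h' t)) //.
  - by have := hB t; lra.
  - by have := hB' t; lra.
  - by rewrite /d ge_min lexx.
apply: (@le_lt_trans _ _ (M * (e / 2 / M))).
  by rewrite ler_pM2l // /d ge_min lexx orbT.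
by rewrite mulrC divfK ?gt_eqF //; lra.
Qed.

(** A rational approximant within [c / 2] of [f] has no zero on [K], so its reciprocal is again a
    rational function with poles off [K]. *)
Lemma RK_inv f (c : R) : RK K f -> 0 < c -> (forall t, c <= cmod (f t)) ->
  RK K (fun t => (f t)^-1).
Proof.
move=> Rf c0 hc; apply/RK_approx => e e0.
pose d := Num.min (c / 2) (e * c * c / 4).
have d0 : 0 < d by rewrite lt_min !divr_gt0 ?mulr_gt0.
have [p [q [hq h]]] := (RK_approx f).1 Rf _ d0.
have d1 : d <= c / 2 by rewrite /d ge_min lexx.
have d2 : d <= e * c * c / 4 by rewrite /d ge_min lexx orbT.
have below t : c / 2 <= cmod (p.[\val t] / q.[\val t]).
  have := lerB_cmod (f t) (f t - p.[\val t] / q.[\val t]); rewrite subKr.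
  by have := h t; have := hc t; lra.
have pn t : p.[\val t] != 0.
  have : 0 < cmod (p.[\val t] / q.[\val t]) by apply: lt_le_trans (below t); rewrite divr_gt0.
  by rewrite cmod_gt0 mulf_eq0 negb_or => /andP[].
exists q, p; split=> [z Kz|t]; first exact: (pn (exist _ z (mem_set Kz))).
have ft : f t != 0 by rewrite -cmod_gt0 (lt_le_trans c0).
have qt := hq _ (val_in t).
have -> : (f t)^-1 - q.[\val t] / p.[\val t] =
    - ((f t - p.[\val t] / q.[\val t]) / (f t) / (p.[\val t] / q.[\val t])).
  have := pn t; move: (f t) ft qt => y; move: (p.[\val t]) (q.[\val t]) => P Q y0 Q0 P0.
  by field; rewrite y0 Q0 P0.
rewrite cmodN cmod_div [cmod (_ / f t)]cmod_div ltr_pdivrMr; last first.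
  by apply: lt_le_trans (below t); rewrite divr_gt0.
rewrite ltr_pdivrMr; last exact: lt_le_trans c0 (hc t).
apply: lt_le_trans (h t) _; apply: le_trans d2 _.
have h1 : c * (c / 2) <= cmod (f t) * cmod (p.[\val t] / q.[\val t]).
  by apply: ler_pM => //; rewrite ?divr_ge0 // ltW.
have := ler_wpM2l (ltW e0) h1; have := mulr_gt0 e0 (mulr_gt0 c0 c0); lra.
Qed.

Lemma supnorm_ge f t : RK K f -> cmod (f t) <= supnorm f.
Proof.
move=> /RK_bounded[B B0 hB]; apply: ub_le_sup; last by exists t.
by exists B => _ [s _ <-]; apply: hB.
Qed.

End Algebra.

(** * The point derivation of infinite order *)

Section PointDerivation.
Variables (R : realType) (K : set (Cplx R)).
Hypothesis clK : closed K.
Hypothesis sqK : forall z, K z -> `|complex.Re z| <= 1 /\ `|complex.Im z| <= 1.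
Hypothesis K0 : K 0.
Hypothesis TB : taylor_bounded K.
Variable x0 : K.
Hypothesis x0E : \val x0 = 0.
Implicit Types (p q : {poly R[i]}) (f g : K -> Cplx R) (t : K).

Lemma eq_of_close (u v : R[i]) (C : R) :
  (forall e : R, 0 < e <= 1 -> cmod (u - v) <= C * e) -> u = v.
Proof.
move=> h; apply/eqP; rewrite -subr_eq0 -cmod_eq0 eq_le cmod_ge0 andbT.
apply/ler_addgt0Pr => e e0; rewrite add0r.
pose d := Num.min 1 (e / (`|C| + 1)).
have C1 : 0 < `|C| + 1 by rewrite ltr_wpDl.
have d0 : 0 < d by rewrite lt_min ltr01 divr_gt0.
apply: le_trans (h d _) _; first by rewrite d0 /d ge_min lexx.
have : d <= e / (`|C| + 1) by rewrite /d ge_min lexx orbT.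
rewrite ler_pdivlMr //; have := ler_norm C; nra.
Qed.

Lemma derivation_exists : exists d : nat -> (K -> Cplx R) -> Cplx R,
  [/\ point_derivation_at (RK K) x0 d, bounded_derivation (RK K) d &
      nondegenerate_derivation (RK K) d].
Proof.
have H k : exists Md : R * ((K -> Cplx R) -> R[i]), 0 <= Md.1 /\
    forall f, RK K f -> forall p q (e : R), 0 <= e -> offpoles K q ->
    (forall t, cmod (f t - p.[\val t] / q.[\val t]) <= e) ->
    cmod (Md.2 f - taylor p q k) <= Md.1 * e.
  have [M M0 hM] := taylor_extend K0 TB k.
  (* The functionals are total maps, with default value [0] off [R(K)]. *)
  have F f : exists l : R[i], RK K f -> forall p q (e : R), 0 <= e -> offpoles K q ->
      (forall t, cmod (f t - p.[\val t] / q.[\val t]) <= e) ->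
      cmod (l - taylor p q k) <= M * e.
    by have [Rf|nRf] := pselect (RK K f); [have [l hl] := hM f Rf; exists l|exists 0].
  by have [dk hdk] := choice F; exists (M, dk).
have [Md hMd] := choice H.
pose M k := (Md k).1; pose d k := (Md k).2.
have M0 k : 0 <= M k by have [] := hMd k.
have hd k f p q (e : R) : RK K f -> 0 <= e -> offpoles K q ->
    (forall t, cmod (f t - p.[\val t] / q.[\val t]) <= e) ->
    cmod (d k f - taylor p q k) <= M k * e.
  by move=> Rf; have [_ h] := hMd k; apply: h.
have approx f (e : R) : RK K f -> 0 < e <= 1 -> exists p q, offpoles K q /\
    forall t, cmod (f t - p.[\val t] / q.[\val t]) <= e.
  move=> Rf /andP[e0 _]; have [p [q [hq h]]] := (RK_approx f).1 Rf _ e0.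
  by exists p, q; split=> // t; apply: ltW.
have lin k (a b : R[i]) f g : RK K f -> RK K g ->
    d k (fun t => a * f t + b * g t) = a * d k f + b * d k g.
  move=> Rf Rg; apply: (@eq_of_close _ _ (2 * M k * (cmod a + cmod b))) => e e01.
  have [p [q [hq h]]] := approx f e Rf e01; have [p' [q' [hq' h']]] := approx g e Rg e01.
  have e0 : 0 <= e by case/andP: e01 => /ltW.
  have hqq : offpoles K (q * q') by move=> z Kz; rewrite hornerM mulf_neq0 ?hq ?hq'.
  have s0 : 0 <= (cmod a + cmod b) * e by rewrite mulr_ge0 ?addr_ge0 ?cmod_ge0.
  have := hd k (fun t => a * f t + b * g t) (a *: (p * q') + b *: (p' * q)) (q * q')
    ((cmod a + cmod b) * e) (@RK_lin R K a b f g Rf Rg) s0 hqq.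
  have E t : cmod (a * f t + b * g t - (a *: (p * q') + b *: (p' * q)).[\val t] / (q * q').[\val t]) <= (cmod a + cmod b) * e.
    have qz := hq _ (val_in t); have qz' := hq' _ (val_in t).
    have -> : a * f t + b * g t - (a *: (p * q') + b *: (p' * q)).[\val t] / (q * q').[\val t] =
       a * (f t - p.[\val t] / q.[\val t]) + b * (g t - p'.[\val t] / q'.[\val t]).
      rewrite hornerD !hornerZ !hornerM.
      by move: (f t) (g t) => ft gt; field; rewrite qz qz'.
    apply: le_trans (ler_cmodD _ _) _; rewrite !cmodM mulrDl.
    by apply: lerD; apply: ler_wpM2l; rewrite ?cmod_ge0.
  move=> /(_ E); rewrite taylor_linear ?hq ?hq' //.
  have := hd k f p q e Rf e0 hq h; have := hd k g p' q' e Rg e0 hq' h'.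
  set T := taylor p q k; set T' := taylor p' q' k; set D := d k (fun t => a * f t + b * g t) => h1 h2 h3.
  have -> : D - (a * d k f + b * d k g) = (D - (a * T + b * T')) - (a * (d k f - T) + b * (d k g - T')).
    by ring.
  apply: le_trans (ler_cmodB _ _) _.
  have h4 := ler_cmodD (a * (d k f - T)) (b * (d k g - T')); rewrite !cmodM in h4.
  have h5 := ler_wpM2l (cmod_ge0 a) h2; have h6 := ler_wpM2l (cmod_ge0 b) h1.
  by lra.
have leib k f g : RK K f -> RK K g ->
    d k (fun t => f t * g t) = \sum_(j < k.+1) d j f * d (k - j)%N g.
  move=> Rf Rg; have [B B0 hB] := RK_bounded clK sqK Rf; have [B' B0' hB'] := RK_bounded clK sqK Rg.
  pose Bm := B + B'; pose C := M k * (2 * Bm + 1) +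
    \sum_(j < k.+1) (2 * (cmod (d j f) + cmod (d (k - j)%N g)) + 1) * (M j + M (k - j)%N + 1).
  (* Approximating within [s / MM] keeps the errors on all coefficients up to order [k] below 1, as
     [mul_close] requires. *)
  pose MM := \sum_(j < k.+1) (M j + M (k - j)%N) + 1.
  have MM0 : 0 < MM by rewrite ltr_wpDl // sumr_ge0 // => j _; rewrite addr_ge0.
  have MMge (j : 'I_k.+1) : M j + M (k - j)%N + 1 <= MM.
    by rewrite lerD2r (bigD1 j) //= lerDl sumr_ge0 // => i _; rewrite addr_ge0.
  apply: (@eq_of_close _ _ (C / MM)) => s /andP[s0 s1].
  pose e := s / MM; have e0 : 0 < e by rewrite divr_gt0.
  have eMM : e * MM = s by rewrite /e divfK // gt_eqF.
  have MM1 : 1 <= MM by rewrite lerDr sumr_ge0 // => j _; rewrite addr_ge0.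
  have e1 : e <= 1 by nra.
  have e01 : 0 < e <= 1 by rewrite e0 e1.
  have [p [q [hq h]]] := approx f e Rf e01; have [p' [q' [hq' h']]] := approx g e Rg e01.
  have hqq : offpoles K (q * q') by move=> z Kz; rewrite hornerM mulf_neq0 ?hq ?hq'.
  have E t : cmod (f t * g t - (p * p').[\val t] / (q * q').[\val t]) <= (2 * Bm + 1) * e.
    rewrite !hornerM -mulf_div; apply: mul_close => //.
      by have := hB t; rewrite /Bm; lra.
    by have := hB' t; rewrite /Bm; lra.
  have E0 : 0 <= (2 * Bm + 1) * e by rewrite /Bm mulr_ge0 ?ltW //; lra.
  have h1 := hd k (fun t => f t * g t) (p * p') (q * q') _ (RK_mul clK sqK Rf Rg) E0 hqq E.
  rewrite taylorM ?hq ?hq' // in h1.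
  have -> : C / MM * s = C * e by rewrite /e mulrAC mulrA.
  apply: le_trans (ler_dist_cmod _ (\sum_(j < k.+1) taylor p q j * taylor p' q' (k - j)) _) _.
  rewrite /C mulrDl -mulrA; apply: lerD => //.
  rewrite -sumrB mulr_suml; apply: le_trans (ler_cmod_sum _ _ _) _; apply: ler_sum => j _.
  have a1 := hd j f p q e Rf (ltW e0) hq h; have a2 := hd (k - j)%N g p' q' e Rg (ltW e0) hq' h'.
  rewrite cmodB -mulrA; apply: mul_close.
  - by have := cmod_ge0 (d j f); have := cmod_ge0 (d (k - j)%N g); lra.
  - by have := cmod_ge0 (d j f); have := cmod_ge0 (d (k - j)%N g); lra.
  - by apply: le_trans s1; rewrite -eMM [leRHS]mulrC ler_pM2r.
  - by apply: le_trans a1 _; rewrite ler_pM2r //; have := M0 (k - j)%N; lra.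
  - by apply: le_trans a2 _; rewrite ler_pM2r //; have := M0 j; lra.
exists d; split; first split.
- split=> // f g _ _ //.
- move=> f Rf; apply: (@eq_of_close _ _ (M 0%N + 1)) => e e01.
  have [p [q [hq h]]] := approx f e Rf e01; have e0 : 0 <= e by case/andP: e01 => /ltW.
  have h1 := hd 0%N f p q e Rf e0 hq h; have := h x0; rewrite x0E => h2.
  apply: le_trans (ler_dist_cmod _ (taylor p q 0) _) _.
  by rewrite mulrDl mul1r; apply: lerD => //; rewrite cmodB.
- by move=> k a b f g Rf Rg; apply: lin.
- move=> k _ f g Rf Rg; exact: leib.
- move=> k; exists (M k) => f Rf.
  have s0 : 0 <= supnorm f by apply: le_trans (supnorm_ge clK sqK x0 Rf); apply: cmod_ge0.
  have := hd k f 0 1 (supnorm f) Rf s0; have -> : taylor 0 1 k = 0 :> R[i].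
    have T0 : tnum 0 1 k = 0 :> {poly R[i]}.
      apply: (@tnum_unique _ 0 1 (fun=> 0)) => //; first by rewrite hornerC oner_neq0.
      by move=> j; rewrite horner0 !mul0r scale0r subr0.
    by rewrite /taylor T0 horner0 mul0r.
  rewrite subr0; apply; first by move=> z _; rewrite hornerC oner_neq0.
  by move=> t; rewrite horner0 mul0r subr0; exact: (supnorm_ge clK sqK t Rf).
- exists (fun t => \val t); first exact: RK_id.
  have := hd 1%N (fun t => \val t) 'X 1 0 (@RK_id R K) (lexx 0).
  have -> : taylor 'X 1 1 = 1 :> R[i].
    rewrite /taylor /= hornerX hornerC mul0r scale0r subr0 divr1.
    have -> : drop_poly 1 'X = 1 :> {poly R[i]} by apply/polyP => -[|i]; rewrite coef_drop_poly addn1 coefX coef1.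
    by rewrite hornerC.
  rewrite mulr0 => h; apply/eqP => d1; have : cmod (d 1%N (fun t => \val t) - 1) <= 0.
    apply: h => [z _|t]; first by rewrite hornerC oner_neq0.
    by rewrite hornerX hornerC divr1 subrr cmod0.
  by rewrite d1 sub0r cmodN cmod1; rewrite ler10.
Qed.

End PointDerivation.

(** * Naturality, strong regularity and normality *)

Section Regularity.
Variables (R : realType) (K : set (Cplx R)).
Hypothesis clK : closed K.
Hypothesis sqK : forall z, K z -> `|complex.Re z| <= 1 /\ `|complex.Im z| <= 1.
Implicit Types (p q : {poly R[i]}) (f g : K -> Cplx R) (t : K).

(** The homomorphism [phi] is only assumed algebraic. If [|phi f|] exceeded a bound of [f], then
    [f - phi f] would be invertible by [RK_inv], so [phi] is bounded. The point is [a = phi z],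
    which lies in [K] since otherwise [z - a] would be invertible. *)
Lemma RK_natural : natural_algebra (RK K).
Proof.
move=> phi [lin mul phi1].
have hlin (a b : R[i]) f g : RK K f -> RK K g ->
    phi (fun t => a * f t + b * g t) = a * phi f + b * phi g by exact: lin.
have hmul f g : RK K f -> RK K g -> phi (fun t => f t * g t) = phi f * phi g.
  by move=> Rf Rg; apply: mul.
have h1 : phi (fun=> 1) = 1 by exact: phi1.
have R1 : RK K (fun=> 1) by apply: RK_cst.
pose a : R[i] := phi (fun t => \val t).
have inv f (c : R) : RK K f -> 0 < c -> (forall t, c <= cmod (f t)) -> phi f != 0.
  move=> Rf c0 hc; apply/eqP => pf0.
  have := hmul f _ Rf (RK_inv Rf c0 hc); rewrite pf0 mul0r.
  have -> : (fun t => f t * (f t)^-1) = (fun=> 1 : Cplx R).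
    by apply/funext => t; rewrite mulfV // -cmod_gt0 (lt_le_trans c0).
  by rewrite h1 => /eqP; rewrite oner_eq0.
have bound f (B : R) : RK K f -> (forall t, cmod (f t) <= B) -> cmod (phi f) <= B.
  move=> Rf hB; rewrite leNgt; apply/negP => hlt.
  have Rg := @RK_lin R K 1 (- phi f) f (fun=> 1) Rf R1.
  have /eqP : phi (fun t => 1 * f t + - phi f * 1) != 0.
    apply: (inv _ (cmod (phi f) - B) Rg); first by rewrite subr_gt0.
    move=> t; rewrite mul1r mulr1 [f t + _]addrC; have := lerB_cmodD (- phi f) (f t); rewrite cmodN.
    by have := hB t; lra.
  by case; rewrite hlin // h1; ring.
have polyE p : phi (fun t => p.[\val t]) = p.[a].
  elim/poly_ind: p => [|p c IH].
    have := hlin 0 0 (fun=> 1) (fun=> 1) R1 R1; rewrite !mul0r addr0 => e0.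
    rewrite horner0 -[RHS]e0.
    by congr phi; apply/funext => t; rewrite horner0.
  have Rp := @RK_poly R K p; have Rz := @RK_id R K.
  have := hlin 1 c _ (fun=> 1) (RK_mul clK sqK Rp Rz) R1.
  rewrite hmul // IH h1 hornerMXaddC mul1r mulr1 -/a => <-.
  by congr phi; apply/funext => t; rewrite hornerMXaddC mul1r.
have Ka : K a.
  apply: contrapT => nKa.
  have hq : offpoles K ('X - a%:P).
    move=> z Kz; rewrite hornerXsubC subr_eq0; apply/eqP => za; apply: nKa; rewrite -za; exact: Kz.
  have [c c0 hc] := denominator_below clK sqK hq.
  have /eqP := inv _ c (@RK_poly R K ('X - a%:P)) c0 (fun t => hc _ (val_in t)).
  by rewrite polyE hornerXsubC subrr.
pose x : K := exist _ (a : Cplx R) (mem_set Ka).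
exists x; split=> [f Rf|y hy]; last first.
  by apply: val_inj; rewrite /= -/a /a -(hy _ (@RK_id R K)).
apply: (@eq_of_close _ _ _ 2) => e /andP[e0 _].
have [p [q [hq h]]] := (RK_approx f).1 Rf e e0.
have Rr := RK_rat hq.
have ratE : phi (fun t => p.[\val t] / q.[\val t]) = p.[a] / q.[a].
  have qa : q.[a] != 0 by apply: hq.
  apply: (mulIf qa); rewrite divfK // -(polyE p) -(polyE q) -hmul //; last exact: RK_poly.
  by congr phi; apply/funext => t; rewrite divfK // hq //; apply: val_in.
have b1 : cmod (phi f - p.[a] / q.[a]) <= e.
  rewrite -ratE; have <- : phi (fun t => 1 * f t + -1 * (p.[\val t] / q.[\val t])) =
     phi f - phi (fun t => p.[\val t] / q.[\val t]) by rewrite hlin //; ring.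
  by apply: bound => [|t]; [exact: RK_lin|rewrite mul1r mulN1r; apply: ltW].
apply: le_trans (ler_dist_cmod _ (p.[a] / q.[a]) _) _.
have b2 : cmod (p.[a] / q.[a] - f x) <= e by rewrite cmodB; apply/ltW/(h x).
lra.
Qed.

(** Here [x] is a point of the plane and not of the type [K], so that the condition can be compared
    between [K] and its subsets. *)
Definition idl (x : R[i]) f := forall e : R, 0 < e -> exists2 j : K -> Cplx R,
  RK K j & (exists2 d : R, 0 < d & forall t, cmod (\val t - x) < d -> j t = 0) /\
  forall t, cmod (f t - j t) < e.

Lemma idlP (x : K) f : uniform_closure (vanishing_near (RK K) x) f <-> idl (\val x) f.
Proof.
split=> [/uniform_closureP h e /h[j [Rj /nbhs_sub_cmod[d d0 hd]] hj]|h].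
  by exists j => //; split=> //; exists d.
apply/uniform_closureP => e /h[j Rj [[d d0 hd] hj]]; exists j => //; split=> //.
by apply/nbhs_sub_cmod; exists d.
Qed.

Lemma idl_close x f : (forall e : R, 0 < e -> exists2 g, idl x g & forall t, cmod (f t - g t) < e) ->
  idl x f.
Proof.
move=> h e e0; have e2 : 0 < e / 2 by rewrite divr_gt0.
have [g /(_ _ e2)[j Rj [hj1 hj2]] hg] := h _ e2; exists j => //; split=> // t.
by apply: le_lt_trans (ler_dist_cmod _ (g t) _) _; have := hg t; have := hj2 t; lra.
Qed.

Lemma idlM x f g : RK K g -> idl x f -> idl x (fun t => f t * g t).
Proof.
move=> Rg h e e0; have [B B0 hB] := RK_bounded clK sqK Rg.
have d0 : 0 < e / (B + 1) by rewrite divr_gt0 // ltr_wpDl.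
have [j Rj [[d dp hd] hj]] := h _ d0.
exists (fun t => j t * g t); first exact: RK_mul.
split; first by exists d => // t /hd ->; rewrite mul0r.
move=> t; rewrite -mulrBl cmodM.
have := hj t; rewrite ltr_pdivlMr ?ltr_wpDl // => h1.
have := ler_wpM2l (cmod_ge0 (f t - j t)) (hB t); have := cmod_ge0 (f t - j t); lra.
Qed.

(** A rational approximant minus its value at [x] is divisible by [z - x], hence lies in the closed
    ideal as soon as [z - x] does. *)
Lemma strongly_regular_of_idl (x : K) :
  idl (\val x) (fun t => \val t - \val x) -> strongly_regular_at (RK K) x.
Proof.
move=> hx; apply/seteqP; split=> f.
  move=> /idlP h; split.
    by apply: RK_closed => e /h[j Rj [_ hj]]; exists j.
  apply: (@eq_of_close _ _ _ 1) => e /andP[e0 _]; have [j _ [[d d0 hd] hj]] := h e e0.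
  by have := hj x; rewrite hd ?subrr ?cmod0 // mul1r => /ltW.
move=> [Rf fx]; apply/idlP; apply: idl_close => e e0.
have e2 : 0 < e / 2 by rewrite divr_gt0.
have [p [q [hq h]]] := (RK_approx f).1 Rf _ e2.
have qx := hq _ (val_in x); pose c := p.[\val x] / q.[\val x].
have [r hr] : exists r : {poly R[i]}, p - c *: q = r * ('X - (\val x)%:P).
  have : root (p - c *: q) (\val x) by rewrite rootE hornerD hornerN hornerZ /c divfK // subrr.
  by move=> /factor_theorem[r ->]; exists r.
exists (fun t => (\val t - \val x) * (r.[\val t] / q.[\val t])).
  by apply: idlM => //; apply: RK_rat.
move=> t; have qt := hq _ (val_in t).
have -> : f t - (\val t - \val x) * (r.[\val t] / q.[\val t]) = (f t - p.[\val t] / q.[\val t]) + c.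
  have := congr1 (fun P : {poly R[i]} => P.[\val t]) hr.
  rewrite hornerD hornerN hornerZ hornerM hornerXsubC => hrt.
  have -> : (\val t - \val x) * (r.[\val t] / q.[\val t]) = (p.[\val t] - c * q.[\val t]) / q.[\val t].
    by rewrite hrt; ring.
  by move: (f t) => y; field.
apply: le_lt_trans (ler_cmodD _ _) _; have h1 := h t.
have : cmod c < e / 2 by have := h x; rewrite fx sub0r cmodN.
lra.
Qed.

(** Arbitrarily small functions with value 0 and derivative 1 at [x]. The second-order part is kept
    explicit because multiplication by [(z - x)^m] then gives [(z - x)^(m+1)] modulo
    [(z - x)^(m+2)]. *)
Definition flat_at (x : R[i]) := forall e : R, 0 < e -> exists2 u : K -> Cplx R, RK K u &
  forall t, cmod ((\val t - x) * (1 + (\val t - x) * u t)) <= e.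

(* Modulo the closure of J_x the coordinate z - x is nilpotent; a nonzero class
   would be detected by a bounded point derivation. *)
Lemma idl_descent x m : K x -> flat_at x -> idl x (fun t => (\val t - x) ^+ m.+1) ->
  idl x (fun t => \val t - x).
Proof.
move=> Kx flat; elim: m => [|m IH] hm; first exact: hm.
apply: IH; apply: idl_close => e e0.
have d0 : 0 < e / 2 / 4 ^+ m by rewrite !divr_gt0 // exprn_gt0.
have [u Ru hu] := flat _ d0.
exists (fun t => (\val t - x) ^+ m.+2 * (-1 * u t + 0 * u t)).
  by apply: idlM => //; apply: RK_lin.
move=> t; have -> : (\val t - x) ^+ m.+1 - (\val t - x) ^+ m.+2 * (-1 * u t + 0 * u t) =
    (\val t - x) ^+ m * ((\val t - x) * (1 + (\val t - x) * u t)).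
  by rewrite !exprS; ring.
rewrite cmodM cmodX.
have h4 : cmod (\val t - x) ^+ m <= 4 ^+ m.
  rewrite lerXn2r ?nnegrE ?cmod_ge0 //; apply: le_trans (ler_cmodB _ _) _.
  by have := mod_le2 sqK (val_in t); have := mod_le2 sqK Kx; lra.
apply: (@le_lt_trans _ _ (4 ^+ m * (e / 2 / 4 ^+ m))).
  by apply: ler_pM; rewrite ?exprn_ge0 ?cmod_ge0.
by rewrite mulrC divfK ?expf_neq0 //; lra.
Qed.

Lemma separated (L0 L1 : set K) : closed L0 -> closed L1 -> L0 `&` L1 = set0 ->
  exists2 d : R, 0 < d & forall s t, L0 s -> L1 t -> d <= cmod (\val s - \val t).
Proof.
move=> c0 c1 L01; apply: contrapT => hn.
have H n : exists st : K * K, [/\ L0 st.1, L1 st.2 & cmod (\val st.1 - \val st.2) < 2^-1 ^+ n].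
  apply: contrapT => /forallNP h; apply: hn; exists (2^-1 ^+ n); first exact: half_pow_gt0.
  by move=> s t Ls Lt; rewrite leNgt; apply/negP => hst; apply: (h (s, t)).
have [st hst] := choice H.
have [a [a1 a2] ha] := @square_cluster R (fun n => \val (st n).1) (fun n => sqK (val_in _)).
have Ka : K a.
  apply: clK => A /nbhs_cmod[e e0 he]; have [n _ hn'] := ha e 0%N e0.
  by exists (\val (st n).1); split; [exact: val_in|apply: he].
pose x : K := exist _ (a : Cplx R) (mem_set Ka).
suff : (L0 `&` L1) x by rewrite L01.
split.
  apply: c0 => A /nbhs_sub_cmod[e e0 he]; have [n _ hn'] := ha e 0%N e0.
  by exists (st n).1; split; [have [] := hst n|apply: he].
apply: c1 => A /nbhs_sub_cmod[e e0 he].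
have e2 : 0 < e / 2 by rewrite divr_gt0.
have [m hm] := half_pow_small e2; have [n mn hn'] := ha _ m e2.
exists (st n).2; split; first by have [] := hst n.
apply: he; apply: le_lt_trans (ler_dist_cmod _ (\val (st n).1) _) _.
have [_ _] := hst n; have := hm n mn; rewrite [cmod (\val (st n).2 - _)]cmodB; lra.
Qed.

(** A product of at most [n] functions bounded by [M] and within [e] of 1 is within [e * n * M^n] of
    1; the extra factor [1 + M^n] allows for multiplication by one minus an arbitrary product of
    plateau functions. *)
Definition plateau_cover (d : R) := exists (n : nat) (c : nat -> R[i]) (r : nat -> R)
    (v : nat -> K -> Cplx R) (M e : R),
  [/\ 1 <= M, 0 <= e /\ e * n%:R * M ^+ n * (1 + M ^+ n) <= 2^-1,
      forall t, exists2 s, (s < n)%N & cmod (\val t - c s) < r s &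
      forall s, (s < n)%N -> [/\ RK K (v s), r s <= d,
        forall t, cmod (v s t) <= M,
        forall t, cmod (\val t - c s) < r s -> v s t = 0 &
        forall t, d <= cmod (\val t - c s) -> cmod (v s t - 1) <= e]].

Lemma RK_prod (P : pred nat) n (v : nat -> K -> Cplx R) : (forall s, (s < n)%N -> RK K (v s)) ->
  RK K (fun t => \prod_(s < n | P s) v s t).
Proof.
elim: n => [|n IH] hv.
  by have := @RK_cst R K 1; congr (RK K _); apply/funext => t; rewrite big_ord0.
have h1 := IH (fun s sn => hv s (ltnW sn)); have h2 := hv n (ltnSn n).
case: (boolP (P n)) => Pn.
  have := RK_mul clK sqK h1 h2; congr (RK K _); apply/funext => t.
  by rewrite [RHS]big_mkcond big_ord_recr /= Pn -big_mkcond.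
move: h1; congr (RK K _); apply/funext => t.
by rewrite [RHS]big_mkcond big_ord_recr /= (negbTE Pn) mulr1 -big_mkcond.
Qed.

Lemma prod_bounds (P : pred nat) n (w : nat -> R[i]) (M e : R) : 1 <= M -> 0 <= e ->
  (forall s, (s < n)%N -> cmod (w s) <= M) ->
  cmod (\prod_(s < n | P s) w s) <= M ^+ n /\
  ((forall s, (s < n)%N -> P s -> cmod (w s - 1) <= e) ->
    cmod (1 - \prod_(s < n | P s) w s) <= e * n%:R * M ^+ n).
Proof.
move=> M1 e0; elim: n => [|n IH] hw.
  by rewrite big_ord0 cmod1 subrr cmod0 mulr0 mul0r.
have [h1 h2] := IH (fun s sn => hw s (ltnW sn)).
have Mn : 0 <= M ^+ n by rewrite exprn_ge0 //; lra.
have nn := ler0n R n.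
have MnS : M ^+ n <= M ^+ n.+1 by rewrite exprS ler_peMl.
rewrite !(big_mkcond (fun s : 'I_n.+1 => P s)) big_ord_recr /= -big_mkcond.
set X := \prod_(s < n | P s) w s in h1 h2 *.
case: (boolP (P n)) => Pn; last first.
  rewrite mulr1; split; first exact: le_trans MnS.
  move=> h; have h3 := h2 (fun s sn => h s (ltnW sn)).
  apply: le_trans h3 _; apply: ler_pM; rewrite ?mulr_ge0 //.
  by apply: ler_wpM2l => //; rewrite ler_nat.
split.
  by rewrite cmodM exprSr; apply: ler_pM; rewrite ?cmod_ge0 // hw.
move=> h; have h3 := h2 (fun s sn => h s (ltnW sn)); have h4 := h n (ltnSn n) Pn.
have -> : 1 - X * w n = (1 - X) + X * (1 - w n) by ring.
apply: le_trans (ler_cmodD _ _) _; rewrite cmodM [cmod (1 - w n)]cmodB.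
have h5 : cmod X * cmod (w n - 1) <= M ^+ n * e by apply: ler_pM; rewrite ?cmod_ge0.
apply: (@le_trans _ _ (e * n.+1%:R * M ^+ n)); first by rewrite -natr1; lra.
by apply: ler_wpM2l => //; rewrite mulr_ge0.
Qed.

(* With [u] (resp. [v]) the product of the plateau functions vanishing at points of
   [L1] (resp. [L0]), the quotient of [v] by [1 - (1 - u) * (1 - v)] is 1 on [L1]. *)
Lemma normal_of_covers : (forall d : R, 0 < d -> plateau_cover d) -> normal_on (RK K).
Proof.
move=> cov L0 L1 c0 c1 L01; have [d d0 sep] := separated c0 c1 L01.
have d4 : 0 < d / 4 by rewrite divr_gt0.
have [n [c [r [v [M [e [M1 [e0 eM] hc hv]]]]]]] := cov _ d4.
pose P (L : set K) s : bool := `[< exists2 t, L t & cmod (\val t - c s) < r s >].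
pose w (L : set K) t := \prod_(s < n | P L s) v s t.
have Rw L : RK K (w L) by apply: RK_prod => s /hv[].
have wM L t : cmod (w L t) <= M ^+ n.
  by have [] := @prod_bounds (P L) n (fun s => v s t) M e M1 e0 (fun s sn => let: And5 _ _ h _ _ := hv s sn in h t).
have w0 L t : L t -> w L t = 0.
  move=> Lt; have [s sn hs] := hc t; apply/eqP/prodf_eq0; exists (Ordinal sn) => /=.
    by apply/asboolP; exists t.
  by apply/eqP; have [_ _ _ h _] := hv s sn; apply: h.
have w1 L t : (forall s, (s < n)%N -> P L s -> d / 4 <= cmod (\val t - c s)) ->
    cmod (1 - w L t) <= e * n%:R * M ^+ n.
  move=> h; have [_] := @prod_bounds (P L) n (fun s => v s t) M e M1 e0 (fun s sn => let: And5 _ _ h _ _ := hv s sn in h t).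
  by apply=> s sn Ps; have [_ _ _ _] := hv s sn; apply; apply: h.
have Mn : 0 <= M ^+ n by rewrite exprn_ge0 //; lra.
pose q t := 1 - (1 - w L1 t) * (1 - w L0 t).
have small t : cmod ((1 - w L1 t) * (1 - w L0 t)) <= 2^-1.
  have big L : cmod (1 - w L t) <= 1 + M ^+ n.
    by apply: le_trans (ler_cmodB _ _) _; rewrite cmod1 lerD2l.
  have en : 0 <= e * n%:R * M ^+ n by rewrite !mulr_ge0.
  (* At [t], either all discs meeting [L0] or all discs meeting [L1] have centres at distance at
     least [d / 4]: otherwise four steps shorter than [d / 4] would join [L0] to [L1]. *)
  have [h|/existsNP[s /not_implyP[sn /not_implyP[Ps /negP]]]] :=
      pselect (forall s, (s < n)%N -> P L0 s -> d / 4 <= cmod (\val t - c s)).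
    rewrite cmodM mulrC; apply: le_trans eM.
    by apply: ler_pM; rewrite ?cmod_ge0 ?w1 ?big.
  rewrite -ltNge => hs.
  rewrite cmodM; apply: le_trans eM; apply: ler_pM; rewrite ?cmod_ge0 ?big // w1 // => s' sn' Ps'.
  rewrite leNgt; apply/negP => hs'.
  have /asboolP[t0 Lt0 ht0] := Ps; have /asboolP[t1 Lt1 ht1] := Ps'.
  have [_ r0 _ _ _] := hv s sn; have [_ r1 _ _ _] := hv s' sn'.
  have := sep _ _ Lt0 Lt1; apply/negP; rewrite -ltNge.
  have := ler_dist_cmod (\val t0) (\val t) (\val t1).
  have := ler_dist_cmod (\val t0) (c s) (\val t).
  have := ler_dist_cmod (\val t) (c s') (\val t1).
  rewrite [cmod (c s - _)]cmodB [cmod (c s' - _)]cmodB; lra.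
have qb t : 2^-1 <= cmod (q t).
  by have := lerB_cmod 1 ((1 - w L1 t) * (1 - w L0 t)); rewrite cmod1 -/(q t); have := small t; lra.
have Rq : RK K q.
  have R1 : RK K (fun=> 1) by apply: RK_cst.
  have Ru L : RK K (fun t => 1 * 1 + -1 * w L t) by apply: (RK_lin R1 (Rw L)).
  have := RK_lin (a := 1) (b := -1) R1 (RK_mul clK sqK (Ru L1) (Ru L0)).
  by congr (RK K _); apply/funext => t; rewrite /q; ring.
have half0 : 0 < 2^-1 :> R by [].
have qn t : q t != 0 by rewrite -cmod_gt0 (lt_le_trans half0).
exists (fun t => w L0 t * (q t)^-1); split.
- exact: (RK_mul clK sqK (Rw L0) (@RK_inv R K q _ Rq half0 qb)).
- move=> t Lt; have e1 : q t = w L0 t by rewrite /q (w0 L1) //; ring.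
  by rewrite -{1}e1 mulfV.
- by move=> t Lt; rewrite (w0 L0) // mul0r.
Qed.

End Regularity.

(** * The construction *)

Section Assembly.
Variable R : realType.

Local Notation h n := ((2^-1 : R) ^+ n).

(** Summation by parts lowers the exponent [k] by one; the boundary term is carried along in the
    inner induction. *)
Lemma power_sums_bounded k : exists W : R, forall m, \sum_(n < m) n.+1%:R ^+ k * h n <= W.
Proof.
elim: k => [|k [W hW]].
  exists 2 => m; suff : \sum_(n < m) n.+1%:R ^+ 0 * h n <= 2 - 2 * h m by have := half_pow_gt0 R m; lra.
  elim: m => [|m IH]; first by rewrite big_ord0 expr0; lra.
  by rewrite big_ord_recr /= expr0 mul1r half_powS; lra.
have diff m : m.+1%:R ^+ k.+1 - m%:R ^+ k.+1 <= k.+1%:R * m.+1%:R ^+ k :> R.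
  elim: k {W hW} => [|k IH]; first by rewrite !expr1 expr0 -natr1; lra.
  have m0 := ler0n R m; have m1 : m%:R <= m.+1%:R :> R by rewrite ler_nat.
  have h1 : m%:R ^+ k.+1 <= m.+1%:R ^+ k.+1 :> R by rewrite lerXn2r ?nnegrE.
  have -> : m.+1%:R ^+ k.+2 - m%:R ^+ k.+2 = m.+1%:R * (m.+1%:R ^+ k.+1 - m%:R ^+ k.+1) + m%:R ^+ k.+1 :> R.
    by rewrite -natr1 !exprS; ring.
  have h2 := ler_wpM2l (ler0n R m.+1) IH.
  rewrite -[k.+2%:R]natr1 [m.+1%:R ^+ k.+1]exprS in h1 *; rewrite [m.+1%:R ^+ k.+1]exprS in h2; lra.
exists (2 + 2 * k.+1%:R * W) => m.
suff : \sum_(n < m) n.+1%:R ^+ k.+1 * h n + 2 * m%:R ^+ k.+1 * h m <=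
    2 + 2 * k.+1%:R * \sum_(n < m) n.+1%:R ^+ k * h n.
  have := hW m; have : 0 <= m%:R ^+ k.+1 * h m by rewrite mulr_ge0 ?exprn_ge0.
  have := ler0n R k.+1; move=> k0 h0 h1 h2.
  by have := ler_wpM2l k0 h1; lra.
elim: m => [|m IH]; first by rewrite !big_ord0 expr0n /= !mulr0 mul0r; lra.
rewrite !big_ord_recr /= half_powS.
have := ler_wpM2r (ltW (half_pow_gt0 R m)) (diff m); lra.
Qed.

Lemma half_pow_le_inv i : h i <= (i.+1%:R)^-1.
Proof.
rewrite exprVn lef_pV2 ?posrE ?exprn_gt0 ?ltr0n //.
by rewrite -natrX ler_nat ltn_expl.
Qed.

(* The squares of level [i] are at distance at least [lev_dist i] from 0, and the sum
   of their half-sides is at most of order [2^-i]; the plateau functions of level [i]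
   are bounded by [lev_bound i] and within [lev_err i] of 1 off their disc, of radius
   [lev_rad i], or [lev_rad0 i] for the disc around 0. *)
Definition lev_dist i : R := (i.+1%:R)^-1.
Definition lev_rad i : R := 4 * h i.
Definition lev_rad0 i : R := 2 * (lev_dist i + 2 * lev_rad i).
Definition lev_budget i : R := h i ^+ 3 / 100.
Definition lev_bound i : R := 15000 / h i ^+ 3.

(** Grid centres whose circles would come too close to 0 are dropped, and the disc at 0 covers their
    place. Its radius is doubled because plateau functions vanish only on the disc of half the
    radius. *)
Definition centers i : seq (R[i] * R) :=
  (0, lev_rad0 i) :: [seq (c, lev_rad i) |
    c <- [seq gridpt R (2 ^ i) a b | a <- iota 0 (4 * 2 ^ i).+1, b <- iota 0 (4 * 2 ^ i).+1] &
    lev_dist i + lev_rad i <= cmod c].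

Definition lev_err i : R := let n := size (centers i) in
  Num.min (h i) (2 * (n%:R * lev_bound i ^+ n * (1 + lev_bound i ^+ n) + 1))^-1.

Lemma lev_dist_gt0 i : 0 < lev_dist i. Proof. by rewrite invr_gt0 ltr0n. Qed.

Lemma lev_bound_ge1 i : 1 <= lev_bound i.
Proof.
rewrite ler_pdivlMr ?exprn_gt0 ?half_pow_gt0 // mul1r.
have : h i ^+ 3 <= 1 by rewrite exprn_ile1 ?half_pow_le1 // ltW ?half_pow_gt0.
lra.
Qed.

(** The last inequality is the one asked by [plateau_cover]. It can be met because the number of
    plateau functions and their bound are fixed before the error. *)
Lemma lev_err_prop i : let n := size (centers i) in
  [/\ 0 < lev_err i <= 1, lev_err i <= h i &
    lev_err i * n%:R * lev_bound i ^+ n * (1 + lev_bound i ^+ n) <= 2^-1].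
Proof.
move=> n; have M1 := lev_bound_ge1 i.
have M0 : 0 <= lev_bound i ^+ n by rewrite exprn_ge0 //; lra.
pose X := n%:R * lev_bound i ^+ n * (1 + lev_bound i ^+ n).
have X0 : 0 <= X by rewrite !mulr_ge0 //; lra.
have e1 : lev_err i <= h i by rewrite /lev_err ge_min lexx.
have e2 : lev_err i <= (2 * (X + 1))^-1 by rewrite /lev_err ge_min lexx orbT.
have p0 : 0 < 2 * (X + 1) by lra.
split=> //.
  by rewrite (le_trans e1 (half_pow_le1 R i)) lt_min half_pow_gt0 invr_gt0 p0.
rewrite -!mulrA -/X; move: e2; rewrite -[X in _ <= X]mul1r ler_pdivlMr //.
have : 0 <= lev_err i by rewrite le_min ltW ?half_pow_gt0 // invr_ge0 ltW.
rewrite /X -!mulrA; set Y := n%:R * _; nra.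
Qed.

Lemma centersP i cr : cr \in centers i ->
  [/\ 2 * lev_budget i <= cr.2, cr.2 <= lev_rad0 i & forall k : R[i], cr.2 / 2 <= cmod (k - cr.1) <= cr.2 ->
   lev_dist i <= cmod k].
Proof.
have h0 := half_pow_gt0 R i; have h1 := half_pow_le1 R i; have d0 := lev_dist_gt0 i.
have h3 : h i ^+ 3 <= h i by rewrite -[leRHS]expr1 ler_wiXn2l // ltW.
rewrite inE => /predU1P[->|/mapP[c]].
  rewrite /= /lev_rad0 /lev_budget /lev_rad; split=> [||k]; [lra|lra|].
  by rewrite subr0 => /andP[hk _]; lra.
rewrite mem_filter => /andP[hc _] ->; rewrite /= /lev_rad0 /lev_budget /lev_rad in hc *; split=> [||k]; [lra|lra|].
by move=> /andP[_ hk]; have := lerB_cmod c (c - k); rewrite subKr cmodB; lra.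
Qed.

Lemma centers_cover i (x : R[i]) : `|complex.Re x| <= 1 -> `|complex.Im x| <= 1 ->
  exists2 cr, cr \in centers i & cmod (x - cr.1) < cr.2 / 2 /\
    (lev_dist i + 2 * lev_rad i <= cmod x -> cr.2 = lev_rad i).
Proof.
move=> x1 x2; have h0 := half_pow_gt0 R i.
have [xs|xl] := ltP (cmod x) (lev_dist i + 2 * lev_rad i).
  exists (0, lev_rad0 i); first by rewrite inE eqxx.
  by rewrite subr0 /lev_rad0 /=; split; [lra|move=> ?; lra].
have P0 : 0 < (2 ^ i)%:R :> R by rewrite ltr0n expn_gt0.
have Pn : (2 ^ i)%:R != 0 :> R by rewrite gt_eqF.
have coord (y : R) : `|y| <= 1 -> exists2 a, (a <= 4 * 2 ^ i)%N &
    `|y - (a%:R - (2 * 2 ^ i)%:R) / (2 ^ i)%:R| < h i.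
  rewrite ler_norml => /andP[y1 y2].
  have yP : 0 <= (y + 2) * (2 ^ i)%:R by rewrite mulr_ge0 //; lra.
  have /andP[t1 t2] := truncn_itv yP; set a := Num.truncn _ in t1 t2.
  exists a.
    rewrite -(ler_nat R); apply: le_trans t1 _; rewrite natrM ler_pM2r //; lra.
  have hE : h i = (2 ^ i)%:R^-1 by rewrite natrX exprVn.
  have -> : y - (a%:R - (2 * 2 ^ i)%:R) / (2 ^ i)%:R = ((y + 2) * (2 ^ i)%:R - a%:R) / (2 ^ i)%:R.
    by rewrite natrM; field.
  rewrite normrM hE [`|_^-1|]gtr0_norm ?invr_gt0 // -[ltRHS]mul1r ltr_pM2r ?invr_gt0 //.
  by rewrite ger0_norm ?subr_ge0 //; rewrite -natr1 in t2; lra.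
have [a ha xa] := coord _ x1; have [b hb xb] := coord _ x2.
pose c := gridpt R (2 ^ i) a b.
have xc : cmod (x - c) < lev_rad i / 2.
  apply: le_lt_trans (ler_cmod_ReIm _) _; rewrite /lev_rad.
  by move: xa xb; case: (x) => u v /=; lra.
exists (c, lev_rad i) => //=.
rewrite inE; apply/orP; right; apply/mapP; exists c => //.
rewrite mem_filter; apply/andP; split.
  by have := lerB_cmod x (x - c); rewrite subKr; move: xc; rewrite /lev_rad in xl *; lra.
by apply/allpairsP; exists (a, b); rewrite !mem_iota !add0n !ltnS.
Qed.

(** There are at most [26 * 4^i] centres; this count is what fixes the exponent 3 in
    [lev_budget]. *)
Lemma size_centers i : (size (centers i))%:R * lev_budget i <= h i / 2.
Proof.
have h0 := half_pow_gt0 R i; have h1 := half_pow_le1 R i.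
have hs : (size (centers i) <= (4 * 2 ^ i).+1 * (4 * 2 ^ i).+1 + 1)%N.
  rewrite addn1 /centers -[size (_ :: _)]/((size _).+1) ltnS size_map size_filter; apply: leq_trans (count_size _ _) _.
  by rewrite size_allpairs !size_iota.
have : (size (centers i))%:R <= 26 * (2 ^ i)%:R * (2 ^ i)%:R :> R.
  apply: (@le_trans _ _ (((4 * 2 ^ i).+1 * (4 * 2 ^ i).+1 + 1)%:R)); first by rewrite ler_nat.
  rewrite -!natrM ler_nat; have : (0 < 2 ^ i)%N by rewrite expn_gt0.
  by move: (2 ^ i)%N => N; nia.
move=> hc; have b0 : 0 <= lev_budget i by rewrite divr_ge0 // exprn_ge0 // ltW.
apply: le_trans (ler_wpM2r b0 hc) _.
have e : (2 ^ i)%:R * h i = 1 :> R by rewrite natrX exprVn mulfV // expf_neq0.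
rewrite /lev_budget (_ : 26 * (2 ^ i)%:R * (2 ^ i)%:R * (h i ^+ 3 / 100) =
  26 * ((2 ^ i)%:R * h i) ^+ 2 * h i / 100); last by ring.
rewrite e expr1n; lra.
Qed.

Definition plateau_data i (cr : R[i] * R)
    (D : (nat -> seq (R[i] * R)) * (nat -> {poly R[i]}) * (nat -> {poly R[i]}) * (R[i] -> R[i])) :=
  let: (L, p, q, v) := D in let: (c, r) := cr in let b := lev_budget i in
  [/\ forall n, \sum_(k <- L n) k.2 <= b * h n.+1,
      forall n, {in L n, forall k, r / 2 <= cmod (k.1 - c) <= r /\ 0 < k.2 <= b} &
      forall z, (forall n, off (L n) z) ->
        [/\ forall n, (q n).[z] != 0 /\ cmod (v z - (p n).[z] / (q n).[z]) <= h n,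
            cmod (v z) <= lev_bound i,
            r <= cmod (z - c) -> cmod (v z - 1) <= lev_err i &
            cmod (z - c) <= r / 2 -> v z = 0]].

Lemma plateau_data_exists (ic : nat * (R[i] * R)) :
  exists D, ic.2 \in centers ic.1 -> plateau_data ic.1 ic.2 D.
Proof.
case: ic => i [c r] /=.
have [hc|_] := boolP ((c, r) \in centers i); last first.
  by exists (fun=> [::], fun=> 0, fun=> 0, fun=> 0).
have [rb rr _] := centersP hc; have [he _ _] := lev_err_prop i.
have h0 := half_pow_gt0 R i; have h1 := half_pow_le1 R i.
have b0 : 0 < lev_budget i by rewrite divr_gt0 // exprn_gt0.
have hb : 0 < lev_budget i <= r / 2 by rewrite b0 /=; move: rb => /=; lra.
have [L [p [q [v [H1 H2 H3]]]]] := plateau c hb he.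
exists (L, p, q, v) => _; split=> // z /H3[a1 a2 a3 a4]; split=> //.
apply: le_trans a2 _; rewrite /lev_bound /lev_budget.
have d1 : lev_dist i <= 1 by rewrite invf_le1 ?ltr0n // ler1n.
(* 18 is the bound for [lev_rad0] at [i = 0], and [8 * 18 * 100 = 14400] lies below the 15000 of
   [lev_bound]. *)
have hr : r <= 18 by move: rr; rewrite /= /lev_rad0 /lev_rad; lra.
have -> : 8 * r / (h i ^+ 3 / 100) = 800 * r / h i ^+ 3 by field; rewrite expf_neq0 // gt_eqF.
rewrite ler_pM2r ?invr_gt0 ?exprn_gt0 //; lra.
Qed.

(** The harmonic sum is made so large that the bound in [lattice_derivation], with [c = h i / 100],
    becomes [h i]. *)
Lemma lattice_size_exists i : exists2 P, (0 < P)%N &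
  (64 / (h i / 100) + 192) / h i <= \sum_(j < P) (j.+1%:R)^-1.
Proof. exact: harmonic_unbounded. Qed.

End Assembly.

(** * Choice of the removed squares *)

Section Cheese.
Variable R : realType.

Local Notation h n := ((2^-1 : R) ^+ n).

Lemma off_of_insq (l : seq (R[i] * R)) (z : R[i]) : ~~ has (fun k => insq k z) l -> off l z.
Proof.
move=> /hasPn hl k kl; have := hl k kl; rewrite negb_and -!leNgt => /orP[] h1.
  by apply: le_trans h1 (ler_Re_cmod _).
by apply: le_trans h1 (ler_Im_cmod _).
Qed.

Lemma RK_sum (K : set (Cplx R)) (T : Type) (s : seq T) (F : T -> K -> Cplx R) :
  (forall k, RK K (F k)) -> RK K (fun t => \sum_(k <- s) F k t).
Proof.
move=> hF; elim: s => [|k s IH].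
  by have := @RK_cst R K 0; congr (RK K _); apply/funext => t; rewrite big_nil.
have := @RK_lin R K 1 1 _ _ (hF k) IH; congr (RK K _); apply/funext => t.
by rewrite big_cons !mul1r.
Qed.

Theorem regular_cheese : exists K : set (Cplx R),
  [/\ closed K, forall z, K z -> `|complex.Re z| <= 1 /\ `|complex.Im z| <= 1, K 0,
      taylor_bounded K & normal_on (RK K) /\
      forall x : R[i], K x -> x != 0 -> idl x (fun t : K => \val t - x)].
Proof.
have [G hG] := choice (@plateau_data_exists R).
have [P hP] := choice (fun i => let: ex_intro2 P a b := lattice_size_exists R i in
  ex_intro (fun P => (0 < P)%N /\ _ <= \sum_(j < P) (j.+1%:R : R)^-1) P (conj a b)).
pose lat i := lattice (P i) (lev_dist R i) (h i / 100).
pose GL i cr n := (G (i, cr)).1.1.1 n.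
pose lev i n := (if n is 0 then lat i else [::]) ++ flatten [seq GL i cr n | cr <- centers R i].
(* Each level consists of infinitely many finite lists, so the double family is enumerated along
   diagonals; each [lay n] is finite and involves only the levels up to [n]. *)
pose lay n := flatten [seq lev i (n - i)%N | i <- iota 0 n.+1].
have h0 i := half_pow_gt0 R i; have h1 i := half_pow_le1 R i.
have d0 i := lev_dist_gt0 R i.
have GP i cr : cr \in centers R i -> plateau_data i cr (G (i, cr)) by move=> hc; apply: (hG (i, cr)).
have GL1 i cr n : cr \in centers R i -> \sum_(k <- GL i cr n) k.2 <= lev_budget R i * h n.+1.
  by move=> /GP; rewrite /GL; case: (G (i, cr)) => -[[L p] q] v; case: cr => c r [].
have GL2 i cr n k : cr \in centers R i -> k \in GL i cr n ->
    lev_dist R i <= cmod k.1 /\ 0 < k.2 <= lev_budget R i.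
  move=> hc; have [_ _ hd] := centersP hc; have := GP i cr hc; move: hd; rewrite /GL.
  case: (G (i, cr)) => -[[L p] q] v; case: cr hc => c r hc hd [_ hL _] /(hL n)[hk1 hk2].
  by split=> //; apply: hd.
have bd i : 4 * lev_budget R i <= lev_dist R i.
  have := half_pow_le_inv R i; rewrite -/(lev_dist R i) /lev_budget.
  have : h i ^+ 3 <= h i by rewrite -[leRHS]expr1 ler_wiXn2l // ltW.
  by have := d0 i; lra.
have lev_ok i n k : k \in lev i n -> [/\ lev_dist R i <= cmod k.1, 0 < k.2 & 4 * k.2 <= cmod k.1].
  rewrite mem_cat => /orP[|/flatten_mapP[cr hc /(GL2 _ _ _ _ hc)[k1 /andP[k2 k3]]]].
    case: n => // /latticeP[a [b [_ _ hd ->]]] /=; have [P0 _] := hP i.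
    have PR : 1 <= (P i)%:R :> R by rewrite ler1n.
    have P2 : 1 <= (P i)%:R ^+ 2 :> R by rewrite exprn_ege1.
    split=> //; first by rewrite !divr_gt0 // exprn_gt0 //; lra.
    apply: le_trans hd; have := half_pow_le_inv R i; rewrite -/(lev_dist R i) => hh.
    apply: (@le_trans _ _ (4 * (h i / 100))); last by have := h0 i; lra.
    have h4 := h0 i; rewrite ler_pM2l // ler_pdivrMr; last by lra.
    by rewrite ler_peMr //; lra.
  by split=> //; have := bd i; lra.
(* For [n = 0] the lattice contributes at most [25 * h i / 100] and the plateau functions at most
   [h i / 4]. *)
have lev_sum i n : \sum_(k <- lev i n) k.2 <= h i * h n.
  have s1 : \sum_(k <- flatten [seq GL i cr n | cr <- centers R i]) k.2 <= h i / 2 * h n.+1.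
    rewrite big_flatten big_map /= big_seq.
    apply: (@le_trans _ _ (\sum_(cr <- centers R i | cr \in centers R i) lev_budget R i * h n.+1)).
      by apply: ler_sum => cr hc; apply: GL1.
    rewrite -big_seq big_const_seq count_predT iter_addr_0 -[leLHS]mulr_natl mulrA.
    by apply: ler_wpM2r; [exact: ltW|exact: size_centers].
  rewrite big_cat /=; case: n s1 => [|n] s1.
    have s2 := lattice_radii (hP i).1 (lev_dist R i) (divr_ge0 (ltW (h0 i)) (ler0n R 100)).
    rewrite expr1 in s1; rewrite expr0.
    by apply: le_trans (lerD s2 s1) _; have := h0 i; lra.
  rewrite big_nil add0r; apply: le_trans s1 _; rewrite half_powS.
  by have := mulr_gt0 (h0 i) (h0 n.+1); lra.
have L0 n : {in lay n, forall k, 0 < k.2 /\ 4 * k.2 <= cmod k.1}.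
  by move=> k /flatten_mapP[i _ /lev_ok[]].
(* Squares of [lay n] are at distance at least [1 / (n + 1)] from 0, and [lay n] gathers [n + 1]
   lists of total half-side at most [h n] each, whence the terms [(n + 1)^(l+1) * h n]. *)
have LW l : exists W : R, forall m, \sum_(n < m) \sum_(k <- lay n) k.2 * (4 / cmod k.1) ^+ l <= W.
  have [W hW] := power_sums_bounded R l.+1.
  exists (4 ^+ l * W) => m; apply: (@le_trans _ _ (\sum_(n < m) 4 ^+ l * (n.+1%:R ^+ l.+1 * h n))); last first.
    by rewrite -mulr_sumr; apply: ler_wpM2l; rewrite ?exprn_ge0.
  apply: ler_sum => n _; rewrite big_flatten big_map.
  apply: (@le_trans _ _ (\sum_(i <- iota 0 n.+1 | i \in iota 0 n.+1) (4 * n.+1%:R) ^+ l * h n)).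
    rewrite big_seq; apply: ler_sum => i; rewrite mem_iota add0n ltnS => /andP[_ ile].
    have -> : h n = h i * h (n - i) by rewrite -exprD subnKC.
    apply: (@le_trans _ _ (\sum_(k <- lev i (n - i)%N | k \in lev i (n - i)%N) (4 * n.+1%:R) ^+ l * k.2)).
      rewrite big_seq; apply: ler_sum => k /lev_ok[k1 k2 _]; rewrite mulrC ler_pM2r //.
      have kp : 0 < cmod k.1 by apply: lt_le_trans k1.
      rewrite lerXn2r ?nnegrE ?divr_ge0 ?mulr_ge0 ?cmod_ge0 // ler_pM2l //.
      rewrite -[leRHS]invrK lef_pV2 ?posrE ?invr_gt0 ?ltr0n //.
      by apply: le_trans k1; rewrite lef_pV2 ?posrE ?ltr0n // ler_nat ltnS.
    rewrite -big_seq -mulr_sumr; apply: ler_wpM2l; first by rewrite exprn_ge0 // mulr_ge0.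
    exact: lev_sum.
  rewrite -big_seq big_const_seq count_predT iter_addr_0 size_iota -[leLHS]mulr_natl exprMn exprS.
  by rewrite le_eqVlt; apply/orP; left; apply/eqP; ring.
pose K := swiss lay.
have Klev i n (z : R[i]) : K z -> off (lev i n) z.
  move=> [_ _ hz]; apply: off_of_insq; apply/hasPn => k hk.
  apply: (hasPn (hz (i + n)%N)); apply/flatten_mapP; exists i.
    by rewrite mem_iota /= add0n ltnS leq_addr.
  by rewrite addKn.
have Klat i (z : R[i]) : K z -> off (lat i) z.
  by move=> Kz k hk; apply: (Klev i 0%N z Kz); rewrite mem_cat hk.
have KGL i cr n (z : R[i]) : cr \in centers R i -> K z -> off (GL i cr n) z.
  move=> hc Kz k hk; apply: (Klev i n z Kz); rewrite mem_cat; apply/orP; right.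
  by apply/flatten_mapP; exists cr.
have K0 : K 0.
  split; rewrite ?raddf0 ?normr0 // => n.
  by have [_ _] := zero_square_minus (L0 n).
have clK : closed K by apply: swiss_closed.
have sqK z : K z -> `|complex.Re z| <= 1 /\ `|complex.Im z| <= 1 by case.
pose V i cr (t : K) : Cplx R := (G (i, cr)).2 (\val t).
have VP i cr : cr \in centers R i -> [/\ RK K (V i cr), forall t, cmod (V i cr t) <= lev_bound R i,
    forall t, cr.2 <= cmod (\val t - cr.1) -> cmod (V i cr t - 1) <= lev_err R i &
    forall t, cmod (\val t - cr.1) <= cr.2 / 2 -> V i cr t = 0].
  move=> hc; have kgl t n := KGL i cr n (\val t) hc (val_in t).
  have kgl' z n := KGL i cr n z hc.
  move: kgl kgl' (GP i cr hc); rewrite /V /GL; case: (G (i, cr)) => -[[L p] q] v /=.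
  case: cr hc => c r hc kgl kgl' [_ _ H]; split=> [|t|t|t]; last first.
  - by have [_ _ _ h4] := H _ (kgl t).
  - by have [_ _ h4 _] := H _ (kgl t).
  - by have [_ h4 _ _] := H _ (kgl t).
  apply: RK_closed => e e0; have e2 : 0 < e / 2 by rewrite divr_gt0.
  have [m hm] := half_pow_small e2.
  exists (fun t => (p m).[\val t] / (q m).[\val t]).
    by apply: RK_rat => z Kz; have [/(_ m)[]] := H z (fun n => kgl' z n Kz).
  move=> t; have [/(_ m)[_ h4] _ _ _] := H _ (kgl t).
  by apply: le_lt_trans h4 _; have := hm m (leqnn m); lra.
have small e : 0 < e -> exists m, forall i, (m <= i)%N -> lev_dist R i <= e.
  move=> e0; exists (Num.Def.archi_bound e^-1) => i mi.
  rewrite -[leRHS]invrK lef_pV2 ?posrE ?invr_gt0 ?ltr0n //.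
  apply: le_trans (ltW (archi_boundP _)) _; first by rewrite invr_ge0 ltW.
  by rewrite ler_nat leqW.
exists K; split=> //; first exact: swiss_taylor_bounded.
split.
  apply: (normal_of_covers clK sqK) => d dp.
  have d18 : 0 < d / 18 by rewrite divr_gt0.
  have [i /(_ i (leqnn i)) hi] := small _ d18.
  have di : lev_rad0 R i <= d.
    by have := half_pow_le_inv R i; rewrite -/(lev_dist R i) /lev_rad0 /lev_rad; lra.
  pose cs := centers R i; pose cr s := nth (0, 0) cs s.
  exists (size cs), (fun s => (cr s).1), (fun s => (cr s).2 / 2), (fun s => V i (cr s)), (lev_bound R i), (lev_err R i).
  have [/andP[e0 _] _ eM] := lev_err_prop R i.
  split; [exact: lev_bound_ge1|by rewrite (ltW e0)| |].
    move=> t; have [x1 x2] := sqK _ (val_in t); have [k kc [hk _]] := centers_cover i x1 x2.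
    by exists (index k cs); [rewrite index_mem|rewrite /cr nth_index].
  move=> s sn; have hc : cr s \in cs by apply: mem_nth.
  have [v1 v2 v3 v4] := VP i _ hc; have [b1 b2 _] := centersP hc.
  have b0 : 0 <= lev_budget R i by rewrite divr_ge0 // exprn_ge0 // ltW.
  split=> //.
  - by lra.
  - by move=> t /ltW; apply: v4.
  - by move=> t dt; apply: v3; apply: le_trans dt; apply: le_trans b2 di.
move=> x Kx x0; have xp : 0 < cmod x by rewrite cmod_gt0.
have [x1 x2] := sqK _ Kx.
apply: (@idl_descent _ K clK sqK x 3) => //.
  move=> e e0; have em : 0 < Num.min e (cmod x) by rewrite lt_min e0.
  have [i /(_ i (leqnn i))] := small _ em; rewrite le_min => /andP[di1 di2].
  have [P0 PD] := hP i.
  have c0 : 0 < h i / 100 by rewrite divr_gt0.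
  have D0 : 0 < (64 / (h i / 100) + 192) / h i.
    by rewrite divr_gt0 // addr_gt0 // divr_gt0.
  have [T [T1 T2]] := lattice_derivation P0 c0 (d0 i) D0 PD x1 x2 di2 (Klat i x Kx).
  have RT (k : R[i] * R[i]) : k \in T -> RK K (fun t => k.1 / (\val t - k.2)).
    move=> /T1[r hr].
    have := @RK_rat R K k.1%:P ('X - k.2%:P); move=> hh.
    have : RK K (fun t => k.1%:P.[\val t] / ('X - k.2%:P).[\val t]).
      apply: hh => z Kz; rewrite hornerXsubC -cmod_gt0.
      have r0 : 0 < r by have [] := lev_ok i 0%N (k.2, r); rewrite ?mem_cat ?hr.
      by apply: lt_le_trans r0 _; have := Klat i z Kz (k.2, r) hr.
    by congr (RK K _); apply/funext => t; rewrite hornerC hornerXsubC.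
  exists (fun t => \sum_(k <- T) k.1 / (\val t - k.2)).
    have : RK K (fun t => \sum_(k <- T) (if k \in T then k.1 / (\val t - k.2) else 0)).
      apply: RK_sum => k; case: (boolP (k \in T)) => [/RT //|_]; exact: RK_cst.
    congr (RK K _); apply/funext => t; rewrite big_seq [RHS]big_seq.
    by apply: eq_bigr => k ->.
  move=> t; apply: le_trans (T2 (\val t) (Klat i _ (val_in t))) _.
  have E0 : 64 / (h i / 100) + 192 != 0 by rewrite gt_eqF // addr_gt0 // divr_gt0.
  have -> : (64 / (h i / 100) + 192) / ((64 / (h i / 100) + 192) / h i) = h i.
    have hn := lt0r_neq0 (h0 i); move: E0; set E := 64 / (h i / 100) + 192 => E0.
    by rewrite invf_div mulrCA divff // mulr1.
  by apply: le_trans (half_pow_le_inv R i) di1.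
(* Inside the disc [(8 * h i)^4] meets the norm [15001 / h i ^+ 3]; outside it [4^4] meets the error
   [h i]. Below, [|x| / 9] keeps [x] away from the large disc at 0, since [lev_dist i + 8 * h i] is
   at most [9 * lev_dist i]. *)
move=> e e0; pose CC : R := 4096 * 15001 + 256.
have em : 0 < Num.min (e / (CC + 1)) (cmod x / 9).
  by rewrite lt_min !divr_gt0 // /CC; lra.
have [i /(_ i (leqnn i))] := small _ em; rewrite le_min => /andP[di1 di2].
have hd := half_pow_le_inv R i; rewrite -/(lev_dist R i) in hd.
have far : lev_dist R i + 2 * lev_rad R i <= cmod x by rewrite /lev_rad; lra.
have [cr hc [xc /(_ far) hr]] := centers_cover i x1 x2.
have [v1 v2 v3 v4] := VP i _ hc; have [_ e02 _] := lev_err_prop R i.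
have RX : RK K (fun t => (\val t - x) ^+ 4).
  have := @RK_poly R K (('X - x%:P) ^+ 4); congr (RK K _); apply/funext => t.
  by rewrite horner_exp hornerXsubC.
exists (fun t => (\val t - x) ^+ 4 * V i cr t); first exact: RK_mul.
split.
  exists (cr.2 / 2 - cmod (x - cr.1)); first by rewrite subr_gt0.
  move=> t ht; rewrite v4 ?mulr0 //.
  by have := ler_dist_cmod (\val t) x cr.1; lra.
move=> t.
have -> : (\val t - x) ^+ 4 - (\val t - x) ^+ 4 * V i cr t = (\val t - x) ^+ 4 * (1 - V i cr t).
  by rewrite mulrBr mulr1.
rewrite cmodM cmodX.
have hi0 := h0 i.
have bnd : cmod (\val t - x) ^+ 4 * cmod (1 - V i cr t) <= CC * h i.
  have [tc|tc] := leP cr.2 (cmod (\val t - cr.1)).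
    have q1 : cmod (\val t - x) ^+ 4 <= 256.
      rewrite (_ : 256 = 4 ^+ 4) ?lerXn2r ?nnegrE ?cmod_ge0 //; last by rewrite -natrX.
      apply: le_trans (ler_cmodB _ _) _.
      by have := mod_le2 sqK (val_in t); have := mod_le2 sqK Kx; lra.
    have q2 : cmod (1 - V i cr t) <= h i by rewrite cmodB; apply: le_trans (v3 t tc) e02.
    apply: (@le_trans _ _ (256 * h i)); first by apply: ler_pM; rewrite ?exprn_ge0 ?cmod_ge0.
    by rewrite ler_pM2r // /CC; lra.
  have q1 : cmod (\val t - x) ^+ 4 <= (8 * h i) ^+ 4.
    rewrite lerXn2r ?nnegrE ?cmod_ge0 ?mulr_ge0 ?(ltW hi0) //.
    have := ler_dist_cmod (\val t) cr.1 x; rewrite [cmod (cr.1 - x)]cmodB.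
    by move: tc xc; rewrite hr /lev_rad; lra.
  have q2 : cmod (1 - V i cr t) <= 15001 / h i ^+ 3.
    apply: le_trans (ler_cmodB _ _) _; rewrite cmod1.
    apply: (@le_trans _ _ ((h i ^+ 3)^-1 + lev_bound R i)); last by rewrite /lev_bound -{1}[_^-1]mul1r -mulrDl; lra.
    apply: lerD => //; rewrite invf_ge1 ?exprn_gt0 //.
    by rewrite exprn_ile1 // ltW.
  apply: (@le_trans _ _ ((8 * h i) ^+ 4 * (15001 / h i ^+ 3))).
    by apply: ler_pM; rewrite ?exprn_ge0 ?cmod_ge0.
  have -> : (8 * h i) ^+ 4 * (15001 / h i ^+ 3) = 4096 * 15001 * h i by field; rewrite expf_neq0 // gt_eqF.
  by rewrite ler_pM2r // /CC; lra.
apply: le_lt_trans bnd _.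
have C0 : 0 < CC by rewrite /CC; lra.
apply: (@le_lt_trans _ _ (CC * (e / (CC + 1)))).
  by rewrite ler_pM2l //; apply: le_trans hd di1.
by rewrite mulrCA gtr_pMr // ltr_pdivrMr; lra.
Qed.

End Cheese.

(** * The two halves *)

Section Conclusion.
Variable R : realType.

Local Notation h n := ((2^-1 : R) ^+ n).

(** If [j] vanishes near [x0], normality provides [g] with [g x0 = 1] and [j g = 0], and the Leibniz
    rule gives [d 1 j = 0]. By boundedness [d 1] vanishes on the closure of these [j]; were this all
    of [M_x0], then [d 1] would be zero, as it kills constants. *)
Lemma not_strongly_regular (K : set (Cplx R)) (x0 : K) (d : nat -> (K -> Cplx R) -> Cplx R) :
  normal_on (RK K) -> point_derivation_at (RK K) x0 d -> bounded_derivation (RK K) d ->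
  nondegenerate_derivation (RK K) d -> ~ strongly_regular_at (RK K) x0.
Proof.
move=> norm [_ d0 lin leib] bdd [f Rf] /eqP; apply: contra_not => sr.
have R1 : RK K (fun=> 1) by apply: RK_cst.
have hlin (a b : R[i]) u v : RK K u -> RK K v ->
    d 1%N (fun t => a * u t + b * v t) = a * d 1%N u + b * d 1%N v by apply: lin.
have hleib u v : RK K u -> RK K v -> d 1%N (fun t => u t * v t) = u x0 * d 1%N v + d 1%N u * v x0.
  move=> Ru Rv; have := leib 1%N isT u v Ru Rv.
  by rewrite !big_ord_recl big_ord0 addr0 /= subn0 subnn !d0.
have d10 : d 1%N (fun=> 0) = 0.
  by have := hlin 0 0 _ _ R1 R1; rewrite !mul0r addr0.
have d11 : d 1%N (fun=> 1) = 0.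
  have := hleib _ _ R1 R1; rewrite !mul1r mulr1.
  by move=> /eqP; rewrite -subr_eq0 opprD addrA subrr sub0r oppr_eq0 => /eqP.
have dJ j : vanishing_near (RK K) x0 j -> d 1%N j = 0.
  move=> [Rj]; rewrite nbhsE /= => -[V [oV Vx] Vj].
  have cx : closed [set x0].
    move=> y hy; have [e|e|e] := ltgtP 0 (cmod (\val x0 - \val y)).
    - have [|z [-> hz]] := hy [set z : K | cmod (\val z - \val y) < cmod (\val x0 - \val y)].
        by apply/nbhs_sub_cmod; exists (cmod (\val x0 - \val y)).
      by move: hz; rewrite /= ltxx.
    - by have := cmod_ge0 (\val x0 - \val y); rewrite leNgt e.
    by apply: val_inj; apply/eqP; rewrite -subr_eq0 -cmod_eq0 cmodB -e.
  have [||g [Rg g1 g0]] := norm (~` V) [set x0] _ cx.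
  - exact: open_closedC.
  - by apply/seteqP; split=> // y [nV yx]; apply: nV; rewrite yx.
  have := hleib _ _ Rj Rg; rewrite (g1 x0) // mulr1 (Vj _ Vx) mul0r add0r => <-.
  rewrite -[RHS]d10; congr (d 1%N _); apply/funext => t.
  have [Vt|nVt] := pselect (V t); first by rewrite (Vj _ Vt) mul0r.
  by rewrite g0 // mulr0.
have dM u : RK K u -> u x0 = 0 -> d 1%N u = 0.
  move=> Ru ux; have : vanishing_at (RK K) x0 u by [].
  rewrite -sr => /uniform_closureP hu; have [M hM] := bdd 1%N.
  apply: (@eq_of_close _ _ _ `|M|) => e /andP[e0 _]; have [j Jj hj] := hu e e0.
  have Rd := @RK_lin R K 1 (-1) _ _ Ru (proj1 Jj).
  have -> : d 1%N u - 0 = d 1%N (fun t => 1 * u t + -1 * j t).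
    by rewrite (hlin 1 (-1)) ?(dJ _ Jj) //; [ring|exact: (proj1 Jj)].
  pose w t := 1 * u t + -1 * j t.
  have hw t : cmod (w t) <= e.
    by rewrite (_ : w t = u t - j t) ?(ltW (hj t)) // /w mul1r mulN1r.
  have s0 : 0 <= supnorm w.
    apply: (@le_trans _ _ (cmod (w x0))); first exact: cmod_ge0.
    by apply: ub_le_sup; [exists e => _ [t _ <-]; apply: hw|exists x0].
  apply: le_trans (hM _ Rd) _; apply: (@le_trans _ _ (`|M| * supnorm w)).
    by rewrite ler_wpM2r ?ler_norm.
  apply: ler_wpM2l => //; apply: ge_sup; first by exists (cmod (w x0)), x0.
  by move=> _ [t _ <-]; apply: hw.
have Ru := @RK_lin R K 1 (- f x0) _ _ Rf R1.
have z0 : 1 * f x0 + - f x0 * 1 = 0 by rewrite mul1r mulr1 subrr.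
by have := dM _ Ru z0; rewrite (hlin 1 (- f x0)) // d11 mulr0 addr0 mul1r.
Qed.

(** Restriction sends [R(K)] into [R(K')] without increasing norms and preserves vanishing near
    [x]. *)
Lemma idl_restrict (K K' : set (Cplx R)) (x : R[i]) : K' `<=` K ->
  idl x (fun t : K => \val t - x) -> idl x (fun t : K' => \val t - x).
Proof.
move=> sub hx e e0; have [j Rj [[d d0 hd] hj]] := hx e e0.
pose inc (t : K') : K := exist _ (\val t) (mem_set (sub _ (val_in t))).
exists (fun t => j (inc t)); last first.
  by split=> [|t]; [exists d => // t ht; apply: (hd (inc t))|exact: (hj (inc t))].
apply/RK_approx => g g0; have [p [q [hq h]]] := (RK_approx j).1 Rj g g0.
by exists p, q; split=> [z /sub|t]; [exact: hq|exact: (h (inc t))].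
Qed.

Definition gapped (K : set (Cplx R)) (b : bool) : set (Cplx R) :=
  [set z | K z /\ forall n, odd n = b -> ~ (h n.+1 < cmod z < h n)].

Lemma gapped_closed K b : closed K -> closed (gapped K b).
Proof.
move=> clK z hz; split.
  by apply: clK => A /hz[y [[Ky _] Ay]]; exists y.
move=> n nb /andP[h1 h2].
pose e := Num.min (cmod z - h n.+1) (h n - cmod z).
have e0 : 0 < e by rewrite lt_min !subr_gt0 h1 h2.
have [|y [[_ /(_ n nb) hy] /= yz]] := hz [set y : Cplx R | cmod (y - z) < e].
  by apply/nbhs_cmod; exists e.
apply: hy; have e1 : e <= cmod z - h n.+1 by rewrite /e ge_min lexx.
have e2 : e <= h n - cmod z by rewrite /e ge_min lexx orbT.
have := lerB_cmod y (y - z); have := lerB_cmod z (z - y); rewrite !subKr cmodB.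
by move=> h3 h4; apply/andP; split; lra.
Qed.

(** The open annuli are pairwise disjoint, so no point is removed from both halves. *)
Lemma gappedU K : gapped K true `|` gapped K false = K.
Proof.
apply/seteqP; split=> [z [[]|[]]//|z Kz].
have [[n [nb hn]]|no] := pselect (exists n, odd n = true /\ h n.+1 < cmod z < h n); last first.
  by left; split=> // n nb hn; apply: no; exists n.
right; split=> // m mb hm.
have mon i j : (i < j)%N -> h j <= h i.+1.
  by move=> ij; rewrite ler_wiXn2l ?invr_ge0 ?invf_le1 ?ler1n.
move: hn hm => /andP[n1 n2] /andP[m1 m2].
have [nm|mn|nm] := ltngtP n m; last by move: nb; rewrite nm mb.
  by have := mon _ _ nm; lra.
by have := mon _ _ mn; lra.
Qed.

Lemma gapped_idl0 (K : set (Cplx R)) b : closed K ->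
  (forall z, K z -> `|complex.Re z| <= 1 /\ `|complex.Im z| <= 1) ->
  idl 0 (fun t : gapped K b => \val t - 0).
Proof.
move=> clK sqK e e0; set K' := gapped K b.
have clK' : closed K' by apply: gapped_closed.
have sqK' z : K' z -> `|complex.Re z| <= 1 /\ `|complex.Im z| <= 1 by case=> /sqK.
have [m hm] := half_pow_small e0.
(* The least index of parity [b] that is at least [2 * m]; its annulus is a gap. *)
pose n := (2 * m + b)%N.
have nb : odd n = b by rewrite /n oddD oddM /= oddb.
have hn : h n <= e by apply: hm; rewrite /n; lia.
have h0 := half_pow_gt0 R n; have hS := half_powS R n.
pose chi (t : K') : Cplx R := if cmod (\val t) <= h n.+1 then 0 else 1.
have dich z : K' z -> cmod z <= h n.+1 \/ h n <= cmod z.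
  move=> [_ /(_ n nb)/negP]; rewrite negb_and -!leNgt => /orP[]; by [left|right].
have Rchi : RK K' chi.
  apply: RK_closed => g g0; pose d := Num.min 1 (g / 2).
  have dd : 0 < d <= 1 by rewrite lt_min ltr01 divr_gt0 //= /d ge_min lexx.
  have dg : d < g.
    have : d <= g / 2 by rewrite /d ge_min lexx orbT.
    lra.
  (* The circle of radius [3 / 4 * h n] runs in the middle of the gap, and discs of radius at most
     [h n / 4] around its points do not reach the set in their interior. The factors of
     [circle_factor] then approximate [chi] uniformly. *)
  have ha : 0 <= h n.+1 < 3 / 4 * h n by apply/andP; split; lra.
  have hb : 3 / 4 * h n < h n by lra.
  have hc : 0 < h n / 4 <= 3 / 4 * h n by apply/andP; split; lra.
  have [l [p [q [_ hl H]]]] := circle_factor 0 ha hb hc dd.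
  have offl z : K' z -> off l z.
    move=> /dich hz k kl; have [k1 /andP[_ k2]] := hl k kl; rewrite subr0 in k1.
    apply: le_trans k2 _; case: hz => hz.
      by have := lerB_cmod k.1 z; rewrite cmodB; lra.
    by have := lerB_cmod z k.1; lra.
  exists (fun t => p.[\val t] / q.[\val t]).
    by apply: RK_rat => z /offl/H[].
  move=> t; have [_ _ H1 H2] := H _ (offl _ (val_in t)); rewrite !subr0 in H1 H2.
  apply: le_lt_trans dg; rewrite /chi; case: (leP (cmod (\val t)) (h n.+1)) => ht.
    by rewrite sub0r cmodN; apply: H2.
  rewrite cmodB; apply: H1; case: (dich _ (val_in t)) => //; lra.
exists (fun t => \val t * chi t); first exact: (RK_mul clK' sqK' (@RK_id R K') Rchi).
split.
  exists (h n.+1); first exact: half_pow_gt0.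
  by move=> t; rewrite subr0 /chi => /ltW ->; rewrite mulr0.
move=> t; rewrite subr0 /chi; case: (leP (cmod (\val t)) (h n.+1)) => ht.
  by rewrite mulr0 subr0; lra.
by rewrite mulr1 subrr cmod0.
Qed.

End Conclusion.

Theorem corollary1p6 (R : realType) :
  exists K1 K2 : set (Cplx R),
    [/\ compact_plane_set K1, compact_plane_set K2,
        strongly_regular (RK K1) & strongly_regular (RK K2)] /\
    ~ strongly_regular (RK (K1 `|` K2)) /\
    normal_algebra (RK (K1 `|` K2)) /\
    exists x0 : set_type (K1 `|` K2),
      [/\ forall x, x <> x0 -> strongly_regular_at (RK (K1 `|` K2)) x,
          ~ strongly_regular_at (RK (K1 `|` K2)) x0 &
          exists d : nat -> (set_type (K1 `|` K2) -> Cplx R) -> Cplx R,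
            [/\ point_derivation_at (RK (K1 `|` K2)) x0 d,
                bounded_derivation (RK (K1 `|` K2)) d &
                nondegenerate_derivation (RK (K1 `|` K2)) d]].
Proof.
have [K [clK sqK K0 TB [norm idlK]]] := regular_cheese R.
have part b : compact_plane_set (gapped K b) /\ strongly_regular (RK (gapped K b)).
  have clb := @gapped_closed R K b clK.
  have sqb z : gapped K b z -> `|complex.Re z| <= 1 /\ `|complex.Im z| <= 1 by case=> /sqK.
  split.
    split; first by apply: subclosed_compact clb (@compact_square R) _ => z /sqb.
    exists 0; split=> // n _; rewrite cmod0 => /andP[]; rewrite ltNge ltW //; exact: half_pow_gt0.
  move=> x; apply: (strongly_regular_of_idl clb sqb).
  have [x0|xn] := eqVneq (\val x) (0 : R[i]); first by rewrite x0; apply: gapped_idl0.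
  apply: (@idl_restrict _ K); first by move=> z [].
  by apply: idlK => //; have [] := val_in x.
exists (gapped K true), (gapped K false); rewrite gappedU.
have [c1 s1] := part true; have [c2 s2] := part false.
pose x0 : K := exist _ (0 : Cplx R) (mem_set K0).
have [d [pd bd nd]] := derivation_exists clK sqK K0 TB (erefl : \val x0 = 0).
have nsr := not_strongly_regular norm pd bd nd.
split=> //; split; first by move=> /(_ x0).
split; first by split; [exact: RK_natural|].
exists x0; split=> //; last by exists d.
move=> x xx0; apply: strongly_regular_of_idl => //; apply: idlK; first exact: val_in.
by apply/eqP => x0E; apply: xx0; apply: val_inj.
Qed.
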